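(* Let $(R,\mathfrak m)$ be a commutative Noetherian local ring of dimension $d$ with a normalized dualizing complex $I$, and let $W_1=\{\mathfrak p\in\mathrm{Spec}(R):\dim R/\mathfrak p\leqq 1\}$. Let $X$ be a chain complex of $R$-modules all of whose cohomology modules are finitely generated, and assume that $\mathrm{supp}(\sigma_{\leqq -1}X)\subseteq W_1$. Then for every $i>0$ there is a short exact sequence $$0\to H^0_{\mathfrak m}(H^{-i}(X))^{\vee}\to H^{d+i}(X^{\dagger})^{\wedge}\to H^1_{\mathfrak m}(H^{-i-1}(X))^{\vee}\to 0$$ and an isomorphism $$H^0_{\mathfrak m}(H^{-i}(X))^{\vee}\;\cong\;H^0_{\mathfrak m}(H^{d+i}(X^{\dagger})),$$ where $X^{\dagger}=\mathrm{RHom}_R(X,I)$, $(-)^{\vee}=\mathrm{Hom}_R(-,E_R(R/\mathfrak m))$ and ${}^{\wedge}$ denotes $\mathfrak m$-adic completion.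
   Context: Complexes are considered in the full (unbounded) derived category $D(R)$ with cohomological notation. The dualizing complex $I$ is normalized so that it has the form $0\to I^0\to I^1\to\cdots\to I^d\to 0$ with $I^i=\bigoplus_{\dim R/\mathfrak p=d-i}E_R(R/\mathfrak p)$, where $E_R(-)$ denotes injective hull. The small support of $X$ is $\mathrm{supp}(X)=\{\mathfrak{p}\in\mathrm{Spec}(R) : X\otimes^{\mathrm L}_R\kappa(\mathfrak{p})\neq 0\}$ with $\kappa(\mathfrak p)=R_{\mathfrak p}/\mathfrak pR_{\mathfrak p}$. $\sigma_{\leqq -1}X$ is the truncation $(\cdots\to X^{-3}\to X^{-2}\to\mathrm{Ker}\,d^{-1}\to 0\to\cdots)$; the condition $\mathrm{supp}(\sigma_{\leqq -1}X)\subseteq W_1$ is equivalent to $\mathrm{Supp}\,H^i(X)\subseteq W_1$ for all $i<0$. $H^j_{\mathfrak m}$ is local cohomology. *)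

(* Defs.v *)
From HB Require Import structures.
From mathcomp Require Import all_boot all_order all_algebra ring zify.
From mathcomp Require Import boolp classical_sets functions cardinality.

Set Implicit Arguments.
Unset Strict Implicit.
Unset Printing Implicit Defensive.

Import Order.TTheory GRing.Theory Num.Theory.
Local Open Scope classical_set_scope.
Local Open Scope ring_scope.
Local Open Scope quotient_scope.

Section LinearOf.
Variables (R : comNzRingType) (M N : lmodType R).

Definition linear_of (f : M -> N) (f_lin : linear f) : {linear M -> N} :=
  HB.pack f (GRing.isLinear.Build R M N *:%R f f_lin).

Definition mod_iso : Prop := exists f : {linear M -> N}, bijective f.

Definition is_zero_mod : Prop := forall x : M, x = 0.

End LinearOf.

Definition short_exact (R : comNzRingType) (A B C : lmodType R) : Prop :=
  exists (f : {linear A -> B}) (g : {linear B -> C}),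
    [/\ injective f,
        forall y, g y = 0 <-> exists x, f x = y
      & forall z, exists y, g y = z].

Record submodule (R : comNzRingType) (M : lmodType R) := Submodule {
  submod_mem :> M -> Prop;
  submod0 : submod_mem 0;
  submodD : forall x y, submod_mem x -> submod_mem y -> submod_mem (x + y);
  submodZ : forall r x, submod_mem x -> submod_mem (r *: x) }.

Definition submod_set (R : comNzRingType) (M : lmodType R) (N : submodule M) :
  set M := [set x | N x].
Coercion submod_set : submodule >-> set.

Section Subm.
Variables (R : comNzRingType) (M : lmodType R) (N : submodule M).

Lemma submodN x : N x -> N (- x).
Proof. by move=> Nx; rewrite -scaleN1r; apply: submodZ. Qed.

Lemma submodB x y : N x -> N y -> N (x - y).
Proof. by move=> Nx Ny; apply: submodD => //; apply: submodN. Qed.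

Definition submod_pred : pred M := fun x => `[< N x >].

Definition subm := {x : M | submod_pred x}.

HB.instance Definition _ := SubChoice.on subm.

Fact subm_closed : subsemimod_closed submod_pred.
Proof.
split; first split.
- exact/asboolP/submod0.
- move=> x y /asboolP Nx /asboolP Ny; exact/asboolP/submodD.
- move=> r x /asboolP Nx; exact/asboolP/submodZ.
Qed.

HB.instance Definition _ :=
  GRing.SubChoice_isSubLmodule.Build R M submod_pred subm subm_closed.

Definition mk_subm (x : M) (Nx : N x) : subm := exist _ x (asboolT Nx).

Lemma submP (x : subm) : N (val x).
Proof. by case: x => x /= /asboolP. Qed.

End Subm.

Section SubmConstructions.
Variables (R : comNzRingType) (M : lmodType R).

Definition full_subm : submodule M :=
  @Submodule R M (fun=> True) I (fun _ _ _ _ => I) (fun _ _ _ => I).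

Definition zero_subm : submodule M.
Proof.
exists [set 0] => //.
- by move=> x y -> ->; rewrite /= addr0.
- by move=> r x ->; rewrite /= scaler0.
Defined.

Definition span_subm (A : set M) : submodule M.
Proof.
exists [set x | forall N : submodule M, A `<=` N -> N x].
- by move=> N _; exact: submod0.
- by move=> x y Ax Ay N AN; apply: submodD; [exact: Ax | exact: Ay].
- by move=> r x Ax N AN; apply: submodZ; exact: Ax.
Defined.

Definition fg_subm (N : submodule M) : Prop :=
  exists s : seq M, submod_set N = span_subm [set x | x \in s].

Definition fg_mod : Prop := fg_subm full_subm.

End SubmConstructions.

Arguments full_subm {R} M.
Arguments zero_subm {R} M.
Arguments fg_mod {R} M.

(* A module given by a carrier with operations satisfying the axioms up to the
   relation [pm_eq]; [pm_quot] below is the actual module. *)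
Record premodule (R : comNzRingType) := Premodule {
  pm_car :> choiceType;
  pm_eq : pm_car -> pm_car -> Prop;
  pm_zero : pm_car;
  pm_opp : pm_car -> pm_car;
  pm_add : pm_car -> pm_car -> pm_car;
  pm_scale : R -> pm_car -> pm_car;
  pm_refl : forall x, pm_eq x x;
  pm_sym : forall x y, pm_eq x y -> pm_eq y x;
  pm_trans : forall x y z, pm_eq x y -> pm_eq y z -> pm_eq x z;
  pm_oppE : forall x y, pm_eq x y -> pm_eq (pm_opp x) (pm_opp y);
  pm_addE : forall x x' y y', pm_eq x x' -> pm_eq y y' ->
    pm_eq (pm_add x y) (pm_add x' y');
  pm_scaleE : forall r x y, pm_eq x y -> pm_eq (pm_scale r x) (pm_scale r y);
  pm_addA : forall x y z,
    pm_eq (pm_add x (pm_add y z)) (pm_add (pm_add x y) z);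
  pm_addC : forall x y, pm_eq (pm_add x y) (pm_add y x);
  pm_add0 : forall x, pm_eq (pm_add pm_zero x) x;
  pm_addN : forall x, pm_eq (pm_add (pm_opp x) x) pm_zero;
  pm_scaleA : forall r s x,
    pm_eq (pm_scale r (pm_scale s x)) (pm_scale (r * s) x);
  pm_scale1 : forall x, pm_eq (pm_scale 1 x) x;
  pm_scaleDr : forall r x y,
    pm_eq (pm_scale r (pm_add x y)) (pm_add (pm_scale r x) (pm_scale r y));
  pm_scaleDl : forall x r s,
    pm_eq (pm_scale (r + s) x) (pm_add (pm_scale r x) (pm_scale s x)) }.

Section PremoduleQuotient.
Variables (R : comNzRingType) (P : premodule R).

Definition pm_rel : rel P := fun x y => `[< pm_eq x y >].

Fact pm_rel_refl : reflexive pm_rel.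
Proof. by move=> x; apply/asboolP/pm_refl. Qed.

Fact pm_rel_sym : symmetric pm_rel.
Proof. by move=> x y; apply: asbool_equiv_eq; split=> /pm_sym. Qed.

Fact pm_rel_trans : transitive pm_rel.
Proof.
by move=> y x z /asboolP xy /asboolP yz; apply/asboolP/(pm_trans xy yz).
Qed.

Canonical pm_equiv := EquivRel pm_rel pm_rel_refl pm_rel_sym pm_rel_trans.

Definition pm_quot := {eq_quot pm_rel}.

HB.instance Definition _ := Choice.on pm_quot.

Definition pm_pi (x : P) : pm_quot := \pi_{eq_quot pm_rel} x.
Definition pm_repr (c : pm_quot) : P := @repr P {eq_quot pm_rel} c.

Lemma pm_reprK c : pm_pi (pm_repr c) = c.
Proof. exact: reprK. Qed.

Lemma pm_piP x y : pm_pi x = pm_pi y <-> pm_eq x y.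
Proof.
split; first by move=> /eqmodP /asboolP.
by move=> xy; apply/eqmodP/asboolP.
Qed.

Lemma pm_repr_pi x : pm_eq (pm_repr (pm_pi x)) x.
Proof. by apply/pm_piP; rewrite pm_reprK. Qed.

Definition pmq_zero : pm_quot := pm_pi (pm_zero P).
Definition pmq_opp (a : pm_quot) := pm_pi (pm_opp (pm_repr a)).
Definition pmq_add (a b : pm_quot) := pm_pi (pm_add (pm_repr a) (pm_repr b)).
Definition pmq_scale r (a : pm_quot) := pm_pi (pm_scale r (pm_repr a)).

Lemma pmq_oppE x : pmq_opp (pm_pi x) = pm_pi (pm_opp x).
Proof. by apply/pm_piP/pm_oppE/pm_repr_pi. Qed.
Lemma pmq_addE x y : pmq_add (pm_pi x) (pm_pi y) = pm_pi (pm_add x y).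
Proof. by apply/pm_piP/pm_addE; apply: pm_repr_pi. Qed.
Lemma pmq_scaleE r x : pmq_scale r (pm_pi x) = pm_pi (pm_scale r x).
Proof. by apply/pm_piP/pm_scaleE/pm_repr_pi. Qed.

Fact pmq_addA : associative pmq_add.
Proof.
move=> a b c; rewrite -(pm_reprK a) -(pm_reprK b) -(pm_reprK c) !pmq_addE.
exact/pm_piP/pm_addA.
Qed.
Fact pmq_addC : commutative pmq_add.
Proof.
move=> a b; rewrite -(pm_reprK a) -(pm_reprK b) !pmq_addE.
exact/pm_piP/pm_addC.
Qed.
Fact pmq_add0 : left_id pmq_zero pmq_add.
Proof. move=> a; rewrite -(pm_reprK a) pmq_addE; exact/pm_piP/pm_add0. Qed.
Fact pmq_addN : left_inverse pmq_zero pmq_opp pmq_add.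
Proof.
move=> a; rewrite -(pm_reprK a) pmq_oppE pmq_addE; exact/pm_piP/pm_addN.
Qed.

HB.instance Definition _ := GRing.isZmodule.Build pm_quot
  pmq_addA pmq_addC pmq_add0 pmq_addN.

Fact pmq_scaleA r s a : pmq_scale r (pmq_scale s a) = pmq_scale (r * s) a.
Proof.
rewrite -(pm_reprK a) !pmq_scaleE; exact/pm_piP/pm_scaleA.
Qed.
Fact pmq_scale1 : left_id 1 pmq_scale.
Proof. move=> a; rewrite -(pm_reprK a) pmq_scaleE; exact/pm_piP/pm_scale1. Qed.
Fact pmq_scaleDr : right_distributive pmq_scale +%R.
Proof.
move=> r a b; rewrite -(pm_reprK a) -(pm_reprK b).
rewrite [LHS](congr1 (pmq_scale r) (pmq_addE _ _)) !pmq_scaleE.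
rewrite [RHS]pmq_addE; exact/pm_piP/pm_scaleDr.
Qed.
Fact pmq_scaleDl a : {morph pmq_scale^~ a : r s / r + s}.
Proof.
move=> r s; rewrite -(pm_reprK a) !pmq_scaleE [RHS]pmq_addE.
exact/pm_piP/pm_scaleDl.
Qed.

HB.instance Definition _ := GRing.Zmodule_isLmodule.Build R pm_quot
  pmq_scaleA pmq_scale1 pmq_scaleDr pmq_scaleDl.

Lemma pm_piD x y : pm_pi (pm_add x y) = pm_pi x + pm_pi y.
Proof. by rewrite -pmq_addE. Qed.
Lemma pm_piZ r x : pm_pi (pm_scale r x) = r *: pm_pi x.
Proof. by rewrite -pmq_scaleE. Qed.

Section Lift.
Variables (L : lmodType R) (f : P -> L).
Hypothesis f_eq : forall x y, pm_eq x y -> f x = f y.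
Hypothesis f_add : forall x y, f (pm_add x y) = f x + f y.
Hypothesis f_scale : forall r x, f (pm_scale r x) = r *: f x.

Fact pm_lift_linear : linear (fun c : pm_quot => f (pm_repr c)).
Proof.
move=> r a b; rewrite -f_scale -f_add; apply/f_eq/pm_piP.
by rewrite pm_reprK pm_piD pm_piZ !pm_reprK.
Qed.

Definition pm_lift : {linear pm_quot -> L} := linear_of pm_lift_linear.

Lemma pm_liftE x : pm_lift (pm_pi x) = f x.
Proof. exact/f_eq/pm_repr_pi. Qed.
End Lift.

End PremoduleQuotient.

Section Quot.
Variables (R : comNzRingType) (M : lmodType R) (N : submodule M).

Definition quot_premodule : premodule R.
Proof.
refine (@Premodule R M (fun x y => N (x - y)) 0 -%R +%R *:%R
  _ _ _ _ _ _ _ _ _ _ _ _ _ _).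
- by move=> x; rewrite /= subrr; apply: submod0.
- by move=> x y /submodN; rewrite /= opprB.
- by move=> x y z xy yz; rewrite /= -(subrK y x) -addrA; apply: submodD.
- by move=> x y /submodN; rewrite /= opprD.
- move=> x x' y y' xx yy; rewrite /= opprD addrACA; exact: submodD.
- by move=> r x y xy; rewrite /= -scalerBr; apply: submodZ.
- by move=> x y z; rewrite /= addrA subrr; apply: submod0.
- by move=> x y; rewrite /= [y + x]addrC subrr; apply: submod0.
- by move=> x; rewrite /= add0r subrr; apply: submod0.
- by move=> x; rewrite /= addNr subrr; apply: submod0.
- by move=> r s x; rewrite /= scalerA subrr; apply: submod0.
- by move=> x; rewrite /= scale1r subrr; apply: submod0.
- by move=> r x y; rewrite /= scalerDr subrr; apply: submod0.
- by move=> x r s; rewrite /= scalerDl subrr; apply: submod0.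
Defined.

Definition quot : lmodType R := pm_quot quot_premodule.

Fact quot_pi_linear : linear (@pm_pi R quot_premodule).
Proof. by move=> r x y; rewrite -pm_piZ -pm_piD. Qed.

Definition quot_pi : {linear M -> quot} := @linear_of R M quot _ quot_pi_linear.

Lemma quot_piP x y : quot_pi x = quot_pi y <-> N (x - y).
Proof. exact: (@pm_piP R quot_premodule). Qed.

Section Lift.
Variables (L : lmodType R) (f : {linear M -> L}).
Hypothesis f_N : forall x, N x -> f x = 0.

Fact quot_lift_eq x y : @pm_eq R quot_premodule x y -> f x = f y.
Proof. by move=> /f_N /eqP; rewrite linearB subr_eq0 => /eqP. Qed.

Definition quot_lift : {linear quot -> L} :=
  pm_lift quot_lift_eq (linearD f) (linearZZ f).

Lemma quot_liftE x : quot_lift (quot_pi x) = f x.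
Proof. exact: (pm_liftE quot_lift_eq). Qed.
End Lift.

End Quot.

Section Product.
Variables (R : comNzRingType) (I : Type) (M : I -> lmodType R).

Definition prodm := forall i, M i.

HB.instance Definition _ := gen_eqMixin prodm.
HB.instance Definition _ := gen_choiceMixin prodm.

Definition prodm_zero : prodm := fun i => 0.
Definition prodm_opp (u : prodm) : prodm := fun i => - u i.
Definition prodm_add (u v : prodm) : prodm := fun i => u i + v i.
Definition prodm_scale r (u : prodm) : prodm := fun i => r *: u i.

Fact prodm_addA : associative prodm_add.
Proof.
by move=> u v w; apply: functional_extensionality_dep => i; exact: addrA.
Qed.
Fact prodm_addC : commutative prodm_add.
Proof.
by move=> u v; apply: functional_extensionality_dep => i; exact: addrC.
Qed.
Fact prodm_add0 : left_id prodm_zero prodm_add.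
Proof.
by move=> u; apply: functional_extensionality_dep => i; exact: add0r.
Qed.
Fact prodm_addN : left_inverse prodm_zero prodm_opp prodm_add.
Proof.
by move=> u; apply: functional_extensionality_dep => i; exact: addNr.
Qed.

HB.instance Definition _ := GRing.isZmodule.Build prodm
  prodm_addA prodm_addC prodm_add0 prodm_addN.

Fact prodm_scaleA r s u :
  prodm_scale r (prodm_scale s u) = prodm_scale (r * s) u.
Proof. by apply: functional_extensionality_dep => i; exact: scalerA. Qed.
Fact prodm_scale1 : left_id 1 prodm_scale.
Proof.
by move=> u; apply: functional_extensionality_dep => i; exact: scale1r.
Qed.
Fact prodm_scaleDr : right_distributive prodm_scale +%R.
Proof.
by move=> r u v; apply: functional_extensionality_dep => i; exact: scalerDr.
Qed.
Fact prodm_scaleDl u : {morph prodm_scale^~ u : r s / r + s}.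
Proof.
by move=> r s; apply: functional_extensionality_dep => i; exact: scalerDl.
Qed.

HB.instance Definition _ := GRing.Zmodule_isLmodule.Build R prodm
  prodm_scaleA prodm_scale1 prodm_scaleDr prodm_scaleDl.

Definition dsum_subm : submodule prodm.
Proof.
exists [set u : prodm | finite_set [set i | u i <> 0]].
- by apply: (sub_finite_set _ (finite_set0 I)) => i /=; apply.
- move=> u v fu fv; apply: (sub_finite_set _ (_ : finite_set (_ `|` _))).
    2: by rewrite finite_setU; split; [exact: fu | exact: fv].
  move=> i /= uvi; have [u0|] := pselect (u i = 0); last by left.
  by right=> v0; apply: uvi; rewrite /GRing.add /= /prodm_add u0 v0 addr0.
- move=> r u fu; apply: sub_finite_set fu => i /= rui u0; apply: rui.
  by rewrite /GRing.scale /= /prodm_scale u0 scaler0.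
Defined.

Definition dsum : lmodType R := subm dsum_subm.

End Product.

Section Hom.
Variable R : comNzRingType.

Definition hom_subm (M N : lmodType R) : submodule (M -> N).
Proof.
exists [set f : M -> N | linear f].
- by move=> r x y; rewrite /GRing.zero /= scaler0 addr0.
- move=> f g fl gl r x y; rewrite !fctE fl gl scalerDr.
  by rewrite addrACA.
- move=> s f fl r x y; rewrite !fctE fl scalerDr !scalerA.
  by rewrite mulrC.
Defined.

Definition hom_mod (M N : lmodType R) : lmodType R := subm (hom_subm M N).

Definition hom_fun (M N : lmodType R) (f : hom_mod M N) : {linear M -> N} :=
  linear_of (submP f).

Definition hom_of (M N : lmodType R) (f : {linear M -> N}) : hom_mod M N :=
  mk_subm (linearP f : hom_subm M N f).

Definition hom_comp (M N L : lmodType R) (g : {linear N -> L})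
    (f : {linear M -> N}) : hom_mod M L :=
  hom_of (g \o f : {linear M -> L}).

End Hom.

Notation ideal R := (submodule (R^o : lmodType R)).

Section Ideals.
Variable R : comNzRingType.

Definition noetherian_ring : Prop := forall a : ideal R, fg_subm a.

Definition prime_ideal (p : ideal R) : Prop :=
  ~ p 1 /\ forall x y : R, p (x * y) -> p x \/ p y.

Definition maximal_ideal (a : ideal R) : Prop :=
  ~ a 1 /\ forall b : ideal R, ~ b 1 -> a `<=` b -> b `<=` a.

Definition local_ring_with (m : ideal R) : Prop :=
  maximal_ideal m /\
  forall n : ideal R, maximal_ideal n -> submod_set n = submod_set m.

Record spec := Spec {
  spec_ideal :> ideal R;
  spec_prime : prime_ideal spec_ideal }.

(* The primes of R / a are the primes of R containing a, so chains of primes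
   of R / a are taken in R. *)
Definition prime_chain (a : ideal R) (n : nat) : Prop :=
  exists c : nat -> spec, a `<=` c 0%N /\
    forall i, (i < n)%N -> c i `<=` c i.+1 /\ ~ (c i.+1 `<=` c i).

(* The Krull dimension of R / a is n. *)
Definition quot_dim (a : ideal R) (n : nat) : Prop :=
  prime_chain a n /\ forall k, prime_chain a k -> (k <= n)%N.

Definition krull_dim (n : nat) : Prop := quot_dim (zero_subm R^o) n.

Definition dim_le1_locus : set spec :=
  [set p | exists2 n, quot_dim (spec_ideal p) n & (n <= 1)%N].

Definition ideal_smul (a : ideal R) (M : lmodType R) (N : submodule M) :
  submodule M :=
  span_subm [set z | exists (r : R) (x : M), [/\ a r, N x & z = r *: x]].

Fixpoint ideal_pow (a : ideal R) (n : nat) : ideal R :=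
  if n is n'.+1 then ideal_smul a (ideal_pow a n') else full_subm R^o.

Lemma ideal_powS a n : ideal_pow a n.+1 `<=` ideal_pow a n.
Proof.
move=> z az; apply: az => _ [r [x [_ anx ->]]]; exact: submodZ.
Qed.

Lemma ideal_pow_le a n k : (n <= k)%N -> ideal_pow a k `<=` ideal_pow a n.
Proof.
move=> /subnK <-; elim: (k - n)%N => [//|l IHl] z.
by rewrite addSn => /ideal_powS /IHl.
Qed.

End Ideals.

Arguments spec : clear implicits.
Arguments noetherian_ring : clear implicits.
Arguments krull_dim : clear implicits.
Arguments dim_le1_locus : clear implicits.

Section Localization.
Variables (R : comNzRingType) (p : spec R) (M : lmodType R).

Record denom := Denom { den : R; denomP : ~ p den }.

HB.instance Definition _ := gen_eqMixin denom.
HB.instance Definition _ := gen_choiceMixin denom.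

Definition denom1 : denom := Denom (spec_prime p).1.

Fact denomM_subproof (s t : denom) : ~ p (den s * den t).
Proof. by move=> /(spec_prime p).2 [/denomP|/denomP]. Qed.
Definition denomM (s t : denom) : denom := Denom (@denomM_subproof s t).

(* the pair (x, s) stands for the fraction x / s *)
Definition loc_premodule : premodule R.
Proof.
refine (@Premodule R (M * denom)%type
  (fun a b => exists u : denom,
     den u *: (den b.2 *: a.1) = den u *: (den a.2 *: b.1))
  (0, denom1)
  (fun a => (- a.1, a.2))
  (fun a b => (den b.2 *: a.1 + den a.2 *: b.1, denomM a.2 b.2))
  (fun r a => (r *: a.1, a.2))
  _ _ _ _ _ _ _ _ _ _ _ _ _ _).
- by move=> [x s]; exists denom1.
- by move=> [x s] [y t] [u]; exists u.
- move=> [x s] [y t] [z w] [u /= uE] [v /= vE].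
  exists (denomM (denomM u v) t) => /=.
  transitivity ((den v * den w) *: (den u *: (den t *: x))).
    by rewrite !scalerA; congr (_ *: _); ring.
  rewrite uE; transitivity ((den u * den s) *: (den v *: (den w *: y))).
    by rewrite !scalerA; congr (_ *: _); ring.
  by rewrite vE !scalerA; congr (_ *: _); ring.
- by move=> [x s] [y t] [u /= uE]; exists u; rewrite !scalerN uE.
- move=> [x s] [x' s'] [y t] [y' t'] [u /= uE] [v /= vE].
  exists (denomM u v) => /=; rewrite !scalerDr; congr (_ + _).
    transitivity ((den v * den t * den t') *: (den u *: (den s' *: x))).
      by rewrite !scalerA; congr (_ *: _); ring.
    by rewrite uE !scalerA; congr (_ *: _); ring.
  transitivity ((den u * den s * den s') *: (den v *: (den t' *: y))).
    by rewrite !scalerA; congr (_ *: _); ring.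
  by rewrite vE !scalerA; congr (_ *: _); ring.
- move=> r [x s] [y t] [u /= uE]; exists u => /=.
  transitivity (r *: (den u *: (den t *: x))).
    by rewrite !scalerA; congr (_ *: _); ring.
  by rewrite uE !scalerA; congr (_ *: _); ring.
- move=> [x s] [y t] [z w]; exists denom1 => /=.
  rewrite !scale1r !scalerDr !scalerA addrA.
  by congr (_ *: _ + _ *: _ + _ *: _); ring.
- move=> [x s] [y t]; exists denom1 => /=.
  rewrite !scale1r !scalerDr !scalerA [RHS]addrC.
  by congr (_ *: _ + _ *: _); ring.
- move=> [x s]; exists denom1 => /=.
  by rewrite !scale1r scaler0 add0r mul1r.
- move=> [x s]; exists denom1 => /=.
  by rewrite !scale1r scalerN addNr !scaler0.
- by move=> r t [x s]; exists denom1; rewrite /= (scalerA r t).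
- by move=> [x s]; exists denom1; rewrite /= !scale1r.
- move=> r [x s] [y t]; exists denom1 => /=.
  rewrite !scale1r !scalerDr !scalerA.
  by congr (_ *: _ + _ *: _); ring.
- move=> [x s] r t; exists denom1 => /=.
  rewrite !scale1r !scalerDr !scalerA -!scalerDl.
  by congr (_ *: _); ring.
Defined.

Definition loc : lmodType R := pm_quot loc_premodule.

End Localization.

(* R_p / p R_p, as an R-module *)
Definition residue_field (R : comNzRingType) (p : spec R) : lmodType R :=
  quot (ideal_smul p (full_subm (loc p R^o))).

Section Tensor.
Variables (R : comNzRingType) (M N : lmodType R).

Definition bilinear_map (L : lmodType R) (b : M -> N -> L) : Prop :=
  (forall y, linear (b^~ y)) /\ (forall x, linear (b x)).

(* A list of pairs stands for a sum of pure tensors. *)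
Definition tensor_eval (L : lmodType R) (b : M -> N -> L) (s : seq (M * N)) :
  L := \sum_(t <- s) b t.1 t.2.

(* Two formal sums are the same element of the tensor product when no bilinear
   map separates them. *)
Definition tensor_eq (s t : seq (M * N)) : Prop :=
  forall (L : lmodType R) (b : M -> N -> L),
    bilinear_map b -> tensor_eval b s = tensor_eval b t.

Lemma tensor_eval_cat (L : lmodType R) (b : M -> N -> L) s t :
  tensor_eval b (s ++ t) = tensor_eval b s + tensor_eval b t.
Proof. exact: big_cat. Qed.

Lemma tensor_eval_scale (L : lmodType R) (b : M -> N -> L) r s :
  bilinear_map b ->
  tensor_eval b [seq (r *: t.1, t.2) | t <- s] = r *: tensor_eval b s.
Proof.
move=> [bl _]; rewrite /tensor_eval big_map scaler_sumr.
apply: eq_bigr => -[x y] _ /=.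
exact: (linearZZ (linear_of (bl y))).
Qed.

Definition tensor_premodule : premodule R.
Proof.
refine (@Premodule R (seq (M * N)) tensor_eq [::]
  (map (fun t => (-1 *: t.1, t.2))) cat
  (fun r => map (fun t => (r *: t.1, t.2)))
  _ _ _ _ _ _ _ _ _ _ _ _ _ _).
- by [].
- by move=> s t st L b bb; rewrite st.
- by move=> s t u st tu L b bb; rewrite st ?tu.
- by move=> s t st L b bb; rewrite !tensor_eval_scale // st.
- by move=> s s' t t' ss tt L b bb; rewrite !tensor_eval_cat ss ?tt.
- by move=> r s t st L b bb; rewrite !tensor_eval_scale // st.
- by move=> s t u L b bb; rewrite catA.
- by move=> s t L b bb; rewrite !tensor_eval_cat addrC.
- by move=> s L b bb.
- move=> s L b bb; rewrite tensor_eval_cat tensor_eval_scale //.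
  by rewrite scaleN1r addNr /tensor_eval big_nil.
- by move=> r t s L b bb; rewrite !tensor_eval_scale // scalerA.
- by move=> s L b bb; rewrite tensor_eval_scale // scale1r.
- by move=> r s t L b bb; rewrite map_cat.
- move=> s r t L b bb.
  by rewrite tensor_eval_cat !tensor_eval_scale // scalerDl.
Defined.

Definition tensor : lmodType R := pm_quot tensor_premodule.

End Tensor.

Section TensorMap.
Variables (R : comNzRingType) (M M' N : lmodType R) (f : {linear M -> M'}).

Definition tensor_map_fun (s : tensor_premodule M N) : tensor M' N :=
  @pm_pi R (tensor_premodule M' N) [seq (f t.1, t.2) | t <- s].

Fact tensor_map_eq s t : pm_eq s t -> tensor_map_fun s = tensor_map_fun t.
Proof.
move=> st; apply/pm_piP => L b bb.
have bfb : bilinear_map (fun x y => b (f x) y).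
  by case: bb => bl br; split=> // y r x z /=; rewrite linearP bl.
by have := st _ _ bfb; rewrite /tensor_eval !big_map.
Qed.

Fact tensor_map_add s t :
  tensor_map_fun (pm_add s t) = tensor_map_fun s + tensor_map_fun t.
Proof. by rewrite /tensor_map_fun -pm_piD /= map_cat. Qed.

Fact tensor_map_scale r s :
  tensor_map_fun (pm_scale r s) = r *: tensor_map_fun s.
Proof.
rewrite /tensor_map_fun -pm_piZ /= -!map_comp; congr pm_pi.
by apply: eq_map => -[x y] /=; rewrite linearZ.
Qed.

(* f (x) N : M (x) N -> M' (x) N *)
Definition tensor_map : {linear tensor M N -> tensor M' N} :=
  pm_lift tensor_map_eq tensor_map_add tensor_map_scale.

Lemma tensor_mapE (s : seq (M * N)) :
  tensor_map (@pm_pi R (tensor_premodule M N) s) =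
  @pm_pi R (tensor_premodule M' N) [seq (f t.1, t.2) | t <- s].
Proof. exact: pm_liftE. Qed.

End TensorMap.

Section Modules.
Variable R : comNzRingType.

Definition injective_mod (E : lmodType R) : Prop :=
  forall (A B : lmodType R) (f : {linear A -> B}) (g : {linear A -> E}),
    injective f -> exists h : {linear B -> E}, forall a, h (f a) = g a.

Definition essential_mono (M E : lmodType R) (f : {linear M -> E}) : Prop :=
  injective f /\ forall N : submodule E,
    (forall x, N (f x) -> x = 0) -> forall y, N y -> y = 0.

Definition is_injective_hull (M E : lmodType R) : Prop :=
  injective_mod E /\ exists f : {linear M -> E}, essential_mono f.

Definition torsion_subm (a : ideal R) (M : lmodType R) : submodule M.
Proof.
exists [set x : M | exists n, forall r : R, ideal_pow a n r -> r *: x = 0].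
- by exists 0%N => r _; rewrite scaler0.
- move=> x y [n nx] [k ky]; exists (n + k)%N => r ar; rewrite scalerDr.
  rewrite nx ?ky ?addr0 //; apply: ideal_pow_le ar; first exact: leq_addl.
  exact: leq_addr.
- move=> r x [n nx]; exists n => s /nx sx.
  by rewrite scalerA mulrC -scalerA sx scaler0.
Defined.

(* the inverse limit of the M / a^n M: compatible families of classes *)
Definition completion_subm (a : ideal R) (M : lmodType R) : submodule
  (prodm (fun n => quot (ideal_smul (ideal_pow a n) (full_subm M)))).
Proof.
exists [set u : prodm _ | forall n, exists x : M,
  u n.+1 = quot_pi _ x /\ u n = quot_pi _ x].
- by move=> n; exists 0; rewrite !linear0.
- move=> u v uP vP n; have [x [x1 x0]] := uP n; have [y [y1 y0]] := vP n.
  exists (x + y); rewrite !linearD -x1 -x0 -y1 -y0; split; reflexivity.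
- move=> r u uP n; have [x [x1 x0]] := uP n.
  exists (r *: x); rewrite !linearZZ -x1 -x0; split; reflexivity.
Defined.

Definition completion (a : ideal R) (M : lmodType R) : lmodType R :=
  subm (completion_subm a M).

Section SubmMap.
Variables (M M' : lmodType R) (N : submodule M) (N' : submodule M').
Variables (f : {linear M -> M'}) (f_N : forall x, N x -> N' (f x)).

Definition subm_map_fun (x : subm N) : subm N' := mk_subm (f_N (submP x)).

Fact subm_map_linear : linear subm_map_fun.
Proof. by move=> r x y; apply: val_inj; rewrite /= !linearP. Qed.

Definition subm_map : {linear subm N -> subm N'} := linear_of subm_map_linear.
End SubmMap.

Section HomMaps.
Variables M N L : lmodType R.

Fact hom_post_linear (g : {linear N -> L}) :
  linear (fun f : hom_mod M N => hom_comp g (hom_fun f)).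
Proof.
move=> r f f'; apply: val_inj; apply: funext => x /=.
by rewrite fctE /= linearP.
Qed.

Definition hom_post (g : {linear N -> L}) :
  {linear hom_mod M N -> hom_mod M L} :=
  linear_of (hom_post_linear g).

Fact hom_pre_linear (g : {linear M -> N}) :
  linear (fun f : hom_mod N L => hom_comp (hom_fun f) g).
Proof. by move=> r f f'; apply: val_inj; apply: funext. Qed.

Definition hom_pre (g : {linear M -> N}) :
  {linear hom_mod N L -> hom_mod M L} :=
  linear_of (hom_pre_linear g).
End HomMaps.

End Modules.

(* [cdiff i j] is the differential when j = i + 1 and zero otherwise. *)
Record complex (R : comNzRingType) := Complex {
  cobj :> int -> lmodType R;
  cdiff : forall i j, {linear cobj i -> cobj j};
  cdiff_shape : forall i j x, j <> i + 1 -> cdiff i j x = 0;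
  cdiff_comp : forall i j k x, cdiff j k (cdiff i j x) = 0 }.

Record chain_map (R : comNzRingType) (X Y : complex R) := ChainMap {
  cmap :> forall n, {linear X n -> Y n};
  cmap_comm : forall i j x, cmap j (cdiff X i j x) = cdiff Y i j (cmap i x) }.

Section Cohomology.
Variable R : comNzRingType.

Definition cycles (X : complex R) (n : int) : submodule (X n).
Proof.
exists [set x : X n | cdiff X n (n + 1) x = 0].
- by rewrite /= linear0.
- by move=> x y /= x0 y0; rewrite linearD x0 y0 addr0.
- by move=> r x /= x0; rewrite linearZZ x0 scaler0.
Defined.

Definition boundaries (X : complex R) (n : int) : submodule (subm (cycles X n)).
Proof.
exists [set z : subm (cycles X n) | exists y, cdiff X (n - 1) n y = val z].
- by exists 0; rewrite linear0.
- by move=> x y [x' xE] [y' yE]; exists (x' + y'); rewrite linearD xE yE.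
- by move=> r x [x' xE]; exists (r *: x'); rewrite linearZZ xE.
Defined.

Definition cohomology (X : complex R) (n : int) : lmodType R :=
  quot (boundaries X n).

Definition acyclic (X : complex R) : Prop :=
  forall n, is_zero_mod (cohomology X n).

Section CohomologyMap.
Variables (X Y : complex R) (f : chain_map X Y) (n : int).

Fact cycles_map x : cycles X n x -> cycles Y n (f n x).
Proof. by rewrite /= -cmap_comm => ->; rewrite linear0. Qed.

Fact boundaries_map z : boundaries X n z ->
  quot_pi (boundaries Y n) (subm_map cycles_map z) = 0.
Proof.
move=> [y yE]; rewrite -(linear0 (quot_pi (boundaries Y n))).
by apply/quot_piP; exists (f _ y); rewrite subr0 /= -cmap_comm yE.
Qed.

Definition cohomology_map : {linear cohomology X n -> cohomology Y n} :=
  @quot_lift _ _ _ _ (quot_pi (boundaries Y n) \o subm_map cycles_map :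
    {linear _ -> cohomology Y n}) boundaries_map.
End CohomologyMap.

Definition quasi_iso (X Y : complex R) (f : chain_map X Y) : Prop :=
  forall n, bijective (cohomology_map f n).

End Cohomology.

Section Subcomplex.
Variables (R : comNzRingType) (X : complex R) (S : forall n, submodule (X n)).
Hypothesis S_diff : forall i j x, S i x -> S j (cdiff X i j x).

Definition subcomplex : complex R.
Proof.
refine (@Complex R (fun n => subm (S n))
  (fun i j => subm_map (@S_diff i j)) _ _).
- by move=> i j x ij; apply: val_inj; rewrite /= cdiff_shape.
- by move=> i j k x; apply: val_inj; rewrite /= cdiff_comp.
Defined.
End Subcomplex.

Section Truncation.
Variables (R : comNzRingType) (k : int) (X : complex R).

Definition trunc_le_subm (n : int) : submodule (X n).
Proof.
exists [set x : X n | (k < n -> x = 0) /\ (n = k -> cdiff X n (n + 1) x = 0)].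
- by split=> // _; rewrite linear0.
- move=> x y [x0 xd] [y0 yd]; split=> [kn|nk].
    by rewrite x0 // y0 // addr0.
  by rewrite linearD xd // yd // addr0.
- move=> r x [x0 xd]; split=> [kn|nk]; first by rewrite x0 // scaler0.
  by rewrite linearZZ xd // scaler0.
Defined.

Fact trunc_le_diff i j x :
  trunc_le_subm i x -> trunc_le_subm j (cdiff X i j x).
Proof.
move=> [x0 xd]; split; last by move=> _; rewrite cdiff_comp.
have [->|/eqP ji] := eqVneq j (i + 1); last by rewrite cdiff_shape.
rewrite ltzD1 le_eqVlt => /orP [/eqP ik|ki]; first exact: xd.
by rewrite x0 // linear0.
Qed.

(* ... -> X^(k-2) -> X^(k-1) -> Ker d^k -> 0 -> ... *)
Definition trunc_le : complex R := subcomplex trunc_le_diff.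
End Truncation.

Section Stalk.
Variables (R : comNzRingType) (M : lmodType R).

Definition stalk_subm (n : int) : submodule M.
Proof.
exists [set x : M | n <> 0 -> x = 0] => //.
- by move=> x y x0 y0 n0; rewrite x0 // y0 // addr0.
- by move=> r x x0 n0; rewrite x0 // scaler0.
Defined.

(* M in degree 0 and zero in the other degrees *)
Definition stalk : complex R.
Proof.
by refine (@Complex R (fun n => subm (stalk_subm n)) (fun i j => \0) _ _).
Defined.
End Stalk.

Section TensorComplex.
Variables (R : comNzRingType) (X : complex R) (N : lmodType R).

Definition tensor_complex : complex R.
Proof.
refine (@Complex R (fun n => tensor (X n) N)
  (fun i j => tensor_map N (cdiff X i j)) _ _).
- move=> i j x ij; rewrite -[x]pm_reprK tensor_mapE.
  apply/pm_piP => L b [bl _]; rewrite [RHS]/tensor_eval big_nil.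
  rewrite /tensor_eval big_map big1 // => -[y z] _ /=.
  rewrite cdiff_shape //; exact: (linear0 (linear_of (bl z))).
- move=> i j k x; rewrite -[x]pm_reprK !tensor_mapE.
  apply/pm_piP => L b [bl _]; rewrite [RHS]/tensor_eval big_nil.
  rewrite /tensor_eval !big_map big1 // => -[y z] _ /=.
  rewrite cdiff_comp; exact: (linear0 (linear_of (bl z))).
Defined.
End TensorComplex.

Section HomComplex.
Variables (R : comNzRingType) (X Y : complex R).

Definition hom_family : lmodType R :=
  prodm (fun pq : int * int => hom_mod (X pq.1) (Y pq.2)).

(* In degree n: the product over p of Hom (X^p, Y^(p+n)), written as the
   families indexed by all pairs (p, q) which vanish unless q = p + n. *)
Definition hom_complex_subm (n : int) : submodule hom_family.
Proof.
exists [set f : hom_family | forall p q, q <> p + n -> f (p, q) = 0] => //.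
- move=> f g f0 g0 p q pq.
  by rewrite [LHS](_ : _ = f (p, q) + g (p, q)) // f0 // g0 // addr0.
- move=> r f f0 p q pq.
  by rewrite [LHS](_ : _ = r *: f (p, q)) // f0 // scaler0.
Defined.

Definition hom_complex_obj (n : int) : lmodType R := subm (hom_complex_subm n).

(* f |-> d f - (-1)^n f d *)
Definition hom_complex_diff_family (n : int) (f : hom_family) : hom_family :=
  fun pq => let: (p, q) := pq in
    hom_post (X p) (cdiff Y (q - 1) q) (f (p, q - 1))
    - (-1) ^+ `|n|%N *: hom_pre (Y q) (cdiff X p (p + 1)) (f (p + 1, q)).

Fact hom_complex_diff_family_linear n : linear (@hom_complex_diff_family n).
Proof.
move=> r f g; apply: functional_extensionality_dep => -[p q].
pose s : R := (-1) ^+ `|n|%N.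
rewrite [LHS](_ : _ =
    hom_post (X p) (cdiff Y (q - 1) q) (r *: f (p, q - 1) + g (p, q - 1))
    - s *: hom_pre (Y q) (cdiff X p (p + 1)) (r *: f (p + 1, q) + g (p + 1, q)))
  //.
rewrite linearP [X in s *: X]linearP. 
 rewrite scalerDr opprD [s *: (r *: _)]scalerA mulrC -scalerA -scalerN.
by rewrite addrACA -scalerDr.
Qed.

Fact hom_complex_diff_subproof n m f : hom_complex_subm n f ->
  hom_complex_subm m (if m == n + 1 then hom_complex_diff_family n f else 0).
Proof.
move=> fn p q pq; case: eqP => // mn.
have f1 : f (p, q - 1) = 0 by apply: fn => qE; apply: pq; rewrite mn; lia.
have f2 : f (p + 1, q) = 0 by apply: fn => qE; apply: pq; rewrite mn; lia.
by rewrite /hom_complex_diff_family f1 f2 !linear0 addr0.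
Qed.

Definition hom_complex_diff_fun n m (f : hom_complex_obj n) :
  hom_complex_obj m := 
  mk_subm (@hom_complex_diff_subproof n m _ (submP f)).

Fact hom_complex_diff_linear n m : linear (@hom_complex_diff_fun n m).
Proof.
move=> r f g; apply: val_inj => /=; case: eqP => _; last first.
  by rewrite scaler0 addr0.
exact: hom_complex_diff_family_linear.
Qed.

Definition hom_complex_diff n m :
  {linear hom_complex_obj n -> hom_complex_obj m} :=
  linear_of (@hom_complex_diff_linear n m).

Fact absz_sign (n : int) : (-1) ^+ absz (n + 1)%R = - (-1) ^+ absz n :> R.
Proof.
case: n => [n|[|n]]; first by rewrite -PoszD addn1 exprS mulN1r.
  by rewrite /= expr1 opprK.
rewrite (_ : Negz n.+1 + 1 = Negz n).
  by rewrite [in RHS]/= [in RHS]exprS mulN1r opprK.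
by rewrite !NegzE; lia.
Qed.

Fact hom_complex_shape i j x : j <> i + 1 -> hom_complex_diff i j x = 0.
Proof. by move=> /eqP/negbTE ij; apply: val_inj; rewrite /= ij. Qed.

Fact hom_complex_comp i j k x :
  hom_complex_diff j k (hom_complex_diff i j x) = 0.
Proof.
apply: val_inj => /=; case: eqP => // kj; case: eqP => ji; last first.
  exact: (linear0 (linear_of (@hom_complex_diff_family_linear j))).
apply: functional_extensionality_dep => -[p q] /=; apply: val_inj.
apply: funext => a /=; rewrite ji absz_sign.
pose s : R := (-1) ^+ `|i|%N; pose F u v := hom_fun (sval x (u, v)).
rewrite [LHS](_ : _ =
    cdiff Y (q - 1) q (cdiff Y (q - 1 - 1) (q - 1) (F p (q - 1 - 1) a)
      - s *: F (p + 1) (q - 1) (cdiff X p (p + 1) a))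
    - - s *: (cdiff Y (q - 1) q (F (p + 1) (q - 1) (cdiff X p (p + 1) a))
      - s *: F (p + 1 + 1) q
               (cdiff X (p + 1) (p + 1 + 1) (cdiff X p (p + 1) a)))) //.
rewrite linearB cdiff_comp cdiff_comp linear0 scaler0 subr0 linearZZ.
by rewrite sub0r scaleNr opprK addNr.
Qed.

Definition hom_complex : complex R :=
  Complex hom_complex_shape hom_complex_comp.

End HomComplex.

Section Homothety.
Variables (R : comNzRingType) (X : complex R).

Definition deg_cast (p q : int) (e : p = q) : {linear X p -> X q} :=
  ecast q {linear X p -> X q} e (idfun : {linear X p -> X p}).

Definition homothety_family (r : R) : hom_family X X :=
  fun pq => match pq.1 =P pq.2 with
            | ReflectT e => r *: hom_of (deg_cast e)
            | ReflectF _ => 0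
            end.

Lemma homothety_familyE r p q (x : X p) (e : p = q) :
  hom_fun (homothety_family r (p, q)) x = r *: deg_cast e x.
Proof.
rewrite /homothety_family /=; case: eqP => // e'.
by rewrite (eq_irrelevance e' e).
Qed.

Lemma homothety_family0 r p q : p <> q -> homothety_family r (p, q) = 0.
Proof. by rewrite /homothety_family /=; case: eqP. Qed.

Fact homothety_subproof n (r : stalk R^o n) :
  hom_complex_subm X X n (homothety_family (val r)).
Proof.
move=> p q pq; have [pq0|pq0] := eqVneq p q; last first.
  by apply: homothety_family0; apply/eqP.
rewrite /homothety_family /=; case: eqP => // e.
rewrite (submP r) ?scale0r // => n0; apply: pq; rewrite n0 pq0; lia.
Qed.

Definition homothety_fun n (r : stalk R^o n) : hom_complex X X n :=
  mk_subm (homothety_subproof r).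

Fact homothety_linear n : linear (@homothety_fun n).
Proof.
move=> r s t; apply: val_inj; apply: functional_extensionality_dep => -[p q].
rewrite [RHS](_ : _ = r *: homothety_family (val s) (p, q)
  + homothety_family (val t) (p, q)) //= /homothety_family /=.
case: eqP => [e|_]; last by rewrite scaler0 addr0.
by rewrite scalerA -scalerDl.
Qed.

Lemma homothety_family_comm r p p' q' q (a : X p) : p' = p + 1 -> q = q' + 1 ->
  cdiff X q' q (hom_fun (homothety_family r (p, q')) a) =
  hom_fun (homothety_family r (p', q)) (cdiff X p p' a).
Proof.
move=> p'E qE; have [e|/eqP ne] := eqVneq p q'; last first.
  rewrite !homothety_family0 //; first exact: linear0.
  by rewrite p'E qE => /addIr.
have e' : p' = q by rewrite p'E qE e.
rewrite (homothety_familyE _ _ e) (homothety_familyE _ _ e') linearZZ.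
by congr (_ *: _); case: q' / e {qE}; case: q / e'.
Qed.

Fact homothety_comm i j (r : stalk R^o i) :
  linear_of (@homothety_linear j) (cdiff (stalk R^o) i j r) =
  cdiff (hom_complex X X) i j (linear_of (@homothety_linear i) r).
Proof.
rewrite [X in linear_of _ X](_ : _ = 0) // linear0.
have [i0|/eqP i0] := eqVneq i 0; last first.
  have -> : r = 0 by apply: val_inj; exact: (submP r).
  by rewrite !linear0.
subst i; apply: val_inj => /=; case: eqP => // _.
apply: functional_extensionality_dep => -[p q]; apply: val_inj.
apply: funext => a.
rewrite [RHS](_ : _ =
    cdiff X (q - 1) q (hom_fun (homothety_family (val r) (p, q - 1)) a)
    - 1 *: hom_fun (homothety_family (val r) (p + 1, q)) (cdiff X p (p + 1) a))
  //.
rewrite (@homothety_family_comm _ _ (p + 1)) ?scale1r ?subrr //.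
by rewrite subrK.
Qed.

Definition homothety : chain_map (stalk R^o) (hom_complex X X) :=
  @ChainMap R (stalk R^o) (hom_complex X X)
    (fun n => linear_of (@homothety_linear n)) homothety_comm.

End Homothety.

Definition K_projective (R : comNzRingType) (P : complex R) : Prop :=
  forall A : complex R, acyclic A -> acyclic (hom_complex P A).

(* The derived tensor product of X and kappa(p) is computed by a K-projective
   resolution P -> X. *)
Definition small_support (R : comNzRingType) (X : complex R) : set (spec R) :=
  [set p | exists P : complex R,
     [/\ K_projective P,
         exists f : chain_map P X, quasi_iso f
       & ~ acyclic (tensor_complex P (residue_field p))]].

Section LocalCohomology.
Variable R : comNzRingType.

Definition injective_resolution (M : lmodType R) (J : complex R) : Prop :=
  [/\ forall n, injective_mod (J n),
      forall n, n < 0 -> is_zero_mod (J n)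
    & exists f : chain_map (stalk M) J, quasi_iso f].

Fact torsion_diff (a : ideal R) (X : complex R) i j x :
  torsion_subm a (X i) x -> torsion_subm a (X j) (cdiff X i j x).
Proof.
by move=> [n nx]; exists n => r /nx rx; rewrite -linearZZ rx linear0.
Qed.

Definition torsion_complex (a : ideal R) (X : complex R) : complex R :=
  subcomplex (@torsion_diff a X).

(* L is isomorphic to H^j_a(M), the j-th right derived functor of the a-torsion
   functor, computed on some injective resolution of M. *)
Definition is_local_cohomology (a : ideal R) (j : int) (M L : lmodType R) :
  Prop := exists2 J : complex R, injective_resolution M J
                               & mod_iso L (cohomology (torsion_complex a J) j).

End LocalCohomology.

Section Dualizing.
Variable R : comNzRingType.

(* A dualizing complex given by a bounded complex of injective modules, so
   that Hom_R(-, D) computes RHom_R(-, D). *)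
Definition dualizing_complex (D : complex R) : Prop :=
  [/\ exists a b : int, forall n, n < a \/ b < n -> is_zero_mod (D n),
      forall n, injective_mod (D n),
      forall n, fg_mod (cohomology D n)
    & quasi_iso (homothety D)].

Definition normalized_dualizing_complex (d : nat) (D : complex R) : Prop :=
  [/\ dualizing_complex D,
      forall n : int, n < 0 \/ d%:Z < n -> is_zero_mod (D n)
    & exists2 E : spec R -> lmodType R,
        forall p, is_injective_hull (quot (spec_ideal p)) (E p)
      & forall i : nat, (i <= d)%N ->
          mod_iso (D i%:Z)
            (dsum (fun p : {p : spec R | quot_dim p (d - i)} => E (sval p)))].

(* RHom_R(X, D), for D a bounded complex of injective modules *)
Definition dagger (D X : complex R) : complex R := hom_complex X D.

End Dualizing.

(* Main.v *)
(* With [n = d + i], [F = D^(d-1)] and [G = D^d], the injective modules [D^q]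
   with [q < d - 1] receive no nonzero map from a module of dimension at most 1,
   since their summands E(R/p) have dim R/p > 1.  Hence every [n]-cocycle of
   Hom(X, D) can be normalized so as to vanish into [D^q] for [q < d - 1], and
   H^n(Hom(X, D)) is an extension of ker(Hom(N, F) -> Hom(N, G)), where
   N = H^(-i-1)(X), by coker(Hom(M, F) -> Hom(M, G)), where M = H^(-i)(X).

   If the support of M has dimension at most 1 there is a parameter x in m with
   m^l contained in ann M + (x); then x is regular on M modulo its m-torsion T.
   As Ext^d(M, D) is finitely generated and m-torsion, some power of x kills it,
   which forces a map M -> G to lift to F as soon as it kills T: the cokernel
   above is Hom(T, G), and G is E(R/m).  For the kernel K one extends f : N -> F
   to the elements y of J^0 with m^k y contained in N, where J is the given
   injective resolution of N; composing with F -> G yields a pairing of K with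
   H^1_m(N), and division by x^n in J^0 identifies K / x^n K with the dual of
   the x^n-torsion of H^1_m(N).  Passing to the limit gives the completion.

   The hypothesis on the small support is used through a resolution P of the
   truncation of X by finite free modules: if P (x) kappa(p) is acyclic then,
   by Cramer's rule, P is contractible in each degree after inverting a single
   element outside p, so that this element kills the cohomology. *)
Require Import Defs.
From mathcomp Require Import all_boot all_order all_algebra perm ring zify.
From mathcomp Require Import boolp classical_sets functions cardinality.

Set Implicit Arguments.
Unset Strict Implicit.
Unset Printing Implicit Defensive.

Import Order.TTheory GRing.Theory Num.Theory.
Local Open Scope classical_set_scope.
Local Open Scope ring_scope.

(** * Linear relations and finiteness *)

(** The natural maps of this proof are zigzags: choose a representative, extend it along an
    injective module, divide by a power of x. Each is given as a linear relation, and
    [linear_choice] turns it into a linear map once totality and the value at 0 are checked. Write W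
    for H^n(Hom(X, D)), T for the m-torsion of M and V for Hom(T, G). The image of W in Hom(N, F)
    need not be complete, so the dual of H^1_m(N) is reached only modulo powers of x, and the limit
    has to be taken by hand inside the completion of W. What keeps V intact in this limit is a
    contrast: some m^a kills V, whereas x acts injectively on Hom(N, F), because F has no m-torsion.
    Hence V meets x^a W in 0. The same contrast identifies V with the whole m-torsion of W, which is
    the second assertion. It also shows that the x-adic and m-adic topologies of W agree. All
    recursions on complexes run downwards from a degree where something vanishes: the truncation of
    X is 0 in degrees >= 0, and D is 0 in negative degrees. *)

Section LinearRelations.
Variable R : comNzRingType.

Definition linear_pred (M : lmodType R) (P : M -> Prop) : Prop :=
  P 0 /\ forall r x y, P x -> P y -> P (r *: x + y).

Definition linear_rel (M N : lmodType R) (rho : M -> N -> Prop) : Prop :=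
  rho 0 0 /\ forall r x x' y y', rho x y -> rho x' y' ->
    rho (r *: x + x') (r *: y + y').

Lemma submod_linear (M : lmodType R) (N : submodule M) : linear_pred N.
Proof.
split; first exact: submod0.
by move=> r x y Nx Ny; apply: submodD => //; apply: submodZ.
Qed.

Definition mk_submodule (M : lmodType R) (P : M -> Prop)
  (P_lin : linear_pred P) : submodule M.
Proof.
exists P.
- exact: P_lin.1.
- by move=> x y Px Py; rewrite -[x]scale1r; apply: P_lin.2.
- by move=> r x Px; rewrite -[_ *: _]addr0; apply: P_lin.2 => //; exact: P_lin.1.
Defined.

Lemma linear_pred_and (M : lmodType R) (P Q : M -> Prop) :
  linear_pred P -> linear_pred Q -> linear_pred (fun x => P x /\ Q x).
Proof.
move=> [P0 PD] [Q0 QD]; split=> // r x y [Px Qx] [Py Qy].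
by split; [apply: PD | apply: QD].
Qed.

Lemma linear_pred_preim (M N : lmodType R) (f : {linear M -> N})
  (P : N -> Prop) : linear_pred P -> linear_pred (fun x => P (f x)).
Proof.
move=> [P0 PD]; split; first by rewrite linear0.
by move=> r x y Px Py; rewrite linearP; apply: PD.
Qed.

Lemma linear_pred_image (M N : lmodType R) (rho : M -> N -> Prop)
  (P : M -> Prop) (B : N -> Prop) :
  linear_rel rho -> linear_pred P -> linear_pred B ->
  linear_pred (fun y => exists x b, [/\ P x, B b & rho x (y - b)]).
Proof.
move=> [r0 rD] [P0 PD] [B0 BD]; split.
  by exists 0, 0; split; rewrite ?subr0.
move=> r y y' [x [b [Px Bb xy]]] [x' [b' [Px' Bb' xy']]].
exists (r *: x + x'), (r *: b + b'); split; [exact: PD | exact: BD |].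
rewrite opprD addrACA -scalerBr; exact: rD.
Qed.

Lemma linear_pred_im (M N : lmodType R) (f : {linear M -> N})
  (P : M -> Prop) : linear_pred P ->
  linear_pred (fun y => exists2 x, P x & f x = y).
Proof.
move=> [P0 PD]; split; first by exists 0; rewrite ?linear0.
move=> r _ _ [x Px <-] [x' Px' <-]; exists (r *: x + x'); first exact: PD.
by rewrite linearP.
Qed.

Lemma linear_rel_fun (M N : lmodType R) (f : {linear M -> N}) :
  linear_rel (fun x y => y = f x).
Proof.
split; first by rewrite linear0.
by move=> r x x' y y' -> ->; rewrite linearP.
Qed.

Lemma linear_rel_sym (M N : lmodType R) (rho : M -> N -> Prop) :
  linear_rel rho -> linear_rel (fun y x => rho x y).
Proof. by move=> [r0 rD]; split=> // r x x' y y' ? ?; apply: rD. Qed.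

Lemma linear_relB (M N : lmodType R) (rho : M -> N -> Prop) x y x' y' :
  linear_rel rho -> rho x y -> rho x' y' -> rho (x - x') (y - y').
Proof.
move=> [_ rD] xy xy'; rewrite addrC -scaleN1r [y - _]addrC -scaleN1r.
exact: rD.
Qed.

(** By linearity, single-valuedness has to be checked over 0 only, so two sets of choices are never
    compared directly. *)
Lemma linear_choice (M N : lmodType R) (rho : M -> N -> Prop) :
  linear_rel rho -> (forall x, exists y, rho x y) ->
  (forall y, rho 0 y -> y = 0) ->
  exists f : {linear M -> N}, forall x y, rho x y <-> y = f x.
Proof.
move=> rl rt r0; have /choice [f fP] := rt.
have fE x y : rho x y <-> y = f x.
  split=> [xy|-> //]; apply/eqP; rewrite -subr_eq0; apply/eqP/r0.
  by rewrite -(subrr x); apply: linear_relB.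
have fl : linear f by move=> r x y; apply/esym/fE; apply: rl.2.
by exists (linear_of fl).
Qed.

Lemma linear_funP (M N : lmodType R) (f : {linear M -> N}) x y :
  f x = f y <-> f (x - y) = 0.
Proof.
rewrite linearB; split=> [->|/eqP]; first by rewrite subrr.
by rewrite subr_eq0 => /eqP.
Qed.

Lemma linear_inj (M N : lmodType R) (f : {linear M -> N}) :
  (forall x, f x = 0 -> x = 0) -> injective f.
Proof.
move=> f0 x y /linear_funP/f0/eqP; by rewrite subr_eq0 => /eqP.
Qed.

Lemma linear_bijective (M N : lmodType R) (f : {linear M -> N}) :
  (forall x, f x = 0 -> x = 0) -> (forall y, exists x, f x = y) ->
  bijective f.
Proof.
move=> f0 /choice [g gK]; exists g => // x.
by apply: (linear_inj f0); rewrite gK.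
Qed.

Lemma linear_bij (M N : lmodType R) (f : {linear M -> N}) :
  (forall x, f x = 0 -> x = 0) -> (forall y, exists x, f x = y) ->
  mod_iso M N.
Proof. by move=> f0 fs; exists f; apply: linear_bijective. Qed.

Lemma linear_inverse (M N : lmodType R) : mod_iso M N ->
  exists (f : {linear M -> N}) (g : {linear N -> M}), cancel f g /\ cancel g f.
Proof.
move=> [f [g fK gK]].
have gl : linear g by move=> r x y; apply: (can_inj fK); rewrite linearP !gK.
by exists f, (linear_of gl).
Qed.

Lemma mod_iso_sym (M N : lmodType R) : mod_iso M N -> mod_iso N M.
Proof. by move=> /linear_inverse [f [g [fK gK]]]; exists g, f. Qed.

Lemma mod_iso_trans (M N L : lmodType R) :
  mod_iso M N -> mod_iso N L -> mod_iso M L.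
Proof. by move=> [f bf] [g bg]; exists (g \o f : {linear _ -> _}); apply: bij_comp. Qed.

Lemma subm_linE (M : lmodType R) (N : submodule M) r (x y : subm N) :
  val (r *: x + y) = r *: val x + val y.
Proof. by []. Qed.

Lemma subm_scaleE (M : lmodType R) (N : submodule M) r (x : subm N) :
  val (r *: x) = r *: val x.
Proof. by []. Qed.

Definition val_lin (M : lmodType R) (N : submodule M) : {linear subm N -> M} :=
  @linear_of R (subm N) M val (fun _ _ _ => erefl).

(** Injectivity of E is applied to the inclusion of the image of [u], on which [g] is well defined
    because it kills the kernel of [u]. This gives factorizations through maps that are not
    injective, such as differentials or multiplication by x. *)
Lemma inj_factor (E A B : lmodType R) (u : {linear A -> B})
  (g : {linear A -> E}) :
  injective_mod E -> (forall a, u a = 0 -> g a = 0) ->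
  exists h : {linear B -> E}, forall a, h (u a) = g a.
Proof.
move=> E_inj ug.
have im_lin : linear_pred (fun b => exists a, u a = b).
  split; first by exists 0; rewrite linear0.
  by move=> r _ _ [a <-] [a' <-]; exists (r *: a + a'); rewrite linearP.
pose Im := mk_submodule im_lin.
have [f fP] : exists f : {linear subm Im -> E},
    forall b e, (exists a, u a = val b /\ g a = e) <-> e = f b.
  apply: linear_choice.
  - split; first by exists 0; rewrite !linear0.
    move=> r x x' y y' [a [ax <-]] [a' [ax' <-]]; exists (r *: a + a').
    by rewrite !linearP ax ax'.
  - by move=> b; have [a ab] := submP b; exists (g a), a.
  - by move=> e [a [/ug -> <-]].
have [h hP] := E_inj _ _ (val_lin Im) f (@val_inj _ _ _).
exists h => a.
have Imu : Im (u a) by exists a.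
rewrite -[LHS]/(h (val_lin Im (mk_subm Imu))) hP.
by apply/esym/fP; exists a.
Qed.

Lemma inj_extend (E B : lmodType R) (N : submodule B)
  (g : {linear subm N -> E}) : injective_mod E ->
  exists h : {linear B -> E}, forall v : subm N, h (val v) = g v.
Proof.
move=> E_inj; have [|h hP] := @inj_factor E _ _ (val_lin N) g E_inj.
  by move=> v v0; rewrite (_ : v = 0) ?linear0 //; apply: val_inj.
by exists h => v; rewrite -hP.
Qed.

End LinearRelations.

Section HomEvaluation.
Variables (R : comNzRingType) (M N : lmodType R).
Implicit Types f g : hom_mod M N.

Lemma hom_linE r f g x : hom_fun (r *: f + g) x = r *: hom_fun f x + hom_fun g x.
Proof. by []. Qed.

Lemma hom_scaleE r f x : hom_fun (r *: f) x = r *: hom_fun f x.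
Proof. by []. Qed.

Lemma hom_subE f g x : hom_fun (f - g) x = hom_fun f x - hom_fun g x.
Proof. by []. Qed.

Lemma hom_zeroE x : hom_fun (0 : hom_mod M N) x = 0.
Proof. by []. Qed.

Lemma hom_ofE (f : {linear M -> N}) x : hom_fun (hom_of f) x = f x.
Proof. by []. Qed.

Lemma hom_modP f g : (forall x, hom_fun f x = hom_fun g x) -> f = g.
Proof. by move=> fg; apply: val_inj; apply: funext. Qed.

End HomEvaluation.

(** * Noetherian subquotients *)

Section Noetherian.
Variable R : comNzRingType.

(** Noetherianity of Z / B, phrased inside the ambient module so that no quotient is formed: every N
    between B and Z is generated by B and finitely many of its elements. *)
Definition noethq (M : lmodType R) (Z B : submodule M) : Prop :=
  forall N : submodule M, B `<=` N -> N `<=` Z ->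
  exists s : seq M, (forall x, x \in s -> N x) /\
    forall N' : submodule M, B `<=` N' -> (forall x, x \in s -> N' x) ->
      N `<=` N'.

(** The middle term of an exact sequence Z1/B1 -> Z/B -> Z2/B2 is Noetherian when the outer ones
    are. Both arrows are only relations, which covers maps defined by lifting and partially defined
    maps. *)
Lemma noethq_ext (M M1 M2 : lmodType R) (Z B : submodule M)
  (Z1 B1 : submodule M1) (Z2 B2 : submodule M2)
  (sigma : M -> M2 -> Prop) (rho : M1 -> M -> Prop) :
  linear_rel sigma -> linear_rel rho ->
  noethq Z1 B1 -> noethq Z2 B2 -> B1 `<=` Z1 -> B2 `<=` Z2 ->
  (forall z, Z z -> exists2 c, Z2 c & sigma z c) ->
  (forall z c, Z z -> B2 c -> sigma z c -> exists2 x, Z1 x & rho x z) ->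
  (forall x z, B1 x -> Z z -> rho x z -> B z) ->
  noethq Z B.
Proof.
move=> sl rl n1 n2 BZ1 BZ2 sZ sB rB N BN NZ.
have sl' := linear_rel_sym sl; have rl' := linear_rel_sym rl.
pose N2 := mk_submodule (linear_pred_and (submod_linear Z2)
  (linear_pred_image sl (submod_linear N) (submod_linear B2))).
pose N1 := mk_submodule (linear_pred_and (submod_linear Z1)
  (linear_pred_image rl' (submod_linear N) (submod_linear B1))).
have [|z [] //|s2 [s2N s2P]] := n2 N2.
  move=> b Bb; split; first exact: BZ2.
  by exists 0, b; split; rewrite ?subrr//; [exact: submod0 | exact: sl.1].
have [|z [] //|s1 [s1N s1P]] := n1 N1.
  move=> b Bb; split; first exact: BZ1.
  by exists 0, b; split; rewrite ?subrr//; [exact: submod0 | exact: rl.1].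
have /choice [f2 f2P] : forall c, exists z, c \in s2 ->
    exists b, [/\ N z, B2 b & sigma z (c - b)].
  move=> c; have [/s2N [_ [z [b h]]]|cs] := boolP (c \in s2); last by exists 0.
  by exists z => _; exists b.
have /choice [f1 f1P] : forall c, exists z, c \in s1 ->
    exists b, [/\ N z, B1 b & rho (c - b) z].
  move=> c; have [/s1N [_ [z [b h]]]|cs] := boolP (c \in s1); last by exists 0.
  by exists z => _; exists b.
(* Generators of N: lifts of generators of its image in Z2/B2, together with images of generators of
   its preimage in Z1/B1. *)
exists (map f2 s2 ++ map f1 s1); split=> [x|N' BN' sN'].
  rewrite mem_cat => /orP [] /mapP [c cs ->].
    by have [b []] := f2P c cs.
  by have [b []] := f1P c cs.
have NN'_lin := linear_pred_and (submod_linear N) (submod_linear N').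
pose N2' := mk_submodule (linear_pred_image sl NN'_lin (submod_linear B2)).
pose N1' := mk_submodule (linear_pred_image rl' NN'_lin (submod_linear B1)).
move=> z Nz; have [c Zc zc] := sZ z (NZ z Nz).
have : N2' c.
  apply: (s2P N2').
  - move=> b Bb; exists 0, b; rewrite subrr; split=> //; last exact: sl.1.
    by split; exact: submod0.
  - move=> x xs; have [b [Nx Bb xb]] := f2P x xs; exists (f2 x), b; split=> //.
    by split=> //; apply: sN'; rewrite mem_cat map_f.
  - split=> //; exists z, 0; rewrite subr0; split=> //; exact: submod0.
move=> [z2 [b2 [[Nz2 N'z2] Bb2 z2c]]].
have Nz3 : N (z - z2) by apply: submodB.
have [|x Zx xz3] := sB (z - z2) b2 (NZ _ Nz3) Bb2.
  by rewrite -[b2](subKr c); apply: linear_relB.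
have : N1' x.
  apply: (s1P N1').
  - move=> b Bb; exists 0, b; rewrite subrr; split=> //; last exact: rl.1.
    by split; exact: submod0.
  - move=> y ys; have [b [Nx Bb xb]] := f1P y ys; exists (f1 y), b; split=> //.
    by split=> //; apply: sN'; rewrite mem_cat map_f // orbT.
  - split=> //; exists (z - z2), 0; rewrite subr0; split=> //; exact: submod0.
move=> [z1 [b1 [[Nz1 N'z1] Bb1 z1x]]].
have Bz : B (z - z2 - z1).
  apply: (rB b1) => //; first by apply: NZ; apply: submodB.
  by rewrite -[b1](subKr x); apply: linear_relB.
by rewrite -(subrK z2 z) -(subrK z1 (z - z2)); do 2!apply: submodD => //; exact: BN'.
Qed.

Lemma noethq_sub (M : lmodType R) (Z Z' B : submodule M) :
  noethq Z B -> Z' `<=` Z -> noethq Z' B.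
Proof. by move=> nZ ZZ N BN NZ; apply: nZ => // x /NZ /ZZ. Qed.

Lemma noethq_triv (M : lmodType R) (B : submodule M) : noethq B B.
Proof. by move=> N BN NB; exists [::]; split=> // N' BN' _ x /NB /BN'. Qed.

Lemma noethq_fg (M : lmodType R) (Z B : submodule M) : noethq Z B -> B `<=` Z ->
  exists s : seq M, (forall x, x \in s -> Z x) /\
    forall N' : submodule M, B `<=` N' -> (forall x, x \in s -> N' x) ->
      Z `<=` N'.
Proof. by move=> nZ BZ; apply: nZ. Qed.

Lemma fg_submP (M : lmodType R) (N : submodule M) : fg_subm N <->
  exists s : seq M, (forall x, x \in s -> N x) /\
    forall N' : submodule M, (forall x, x \in s -> N' x) -> N `<=` N'.
Proof.
split=> [[s sE]|[s [sN sP]]]; exists s.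
  split=> [x xs|N' sN' x].
    by change (submod_set N x); rewrite sE => N' /(_ x); apply.
  by rewrite sE; apply => y; apply: sN'.
apply/seteqP; split=> x.
  by move=> Nx N' sN'; apply: sP Nx => y ys; apply: sN'.
by apply=> y; apply: sN.
Qed.

(** Modulo the span of [t], the span of [x :: t] is a quotient of R. Relating z to every r with z -
    r x in the span of [t] avoids choosing a coefficient. *)
Lemma noethq_span : noetherian_ring R ->
  forall (M : lmodType R) (s : seq M),
  noethq (span_subm [set x | x \in s]) (zero_subm M).
Proof.
move=> R_noeth M; elim=> [|x t IHt].
  apply: (@noethq_sub _ (zero_subm M)); first exact: noethq_triv.
  move=> z; apply=> y.
  by rewrite /= in_nil.
have nR : noethq (full_subm R^o) (zero_subm R^o).
  move=> N _ _; have /fg_submP [l [lN lP]] := R_noeth N.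
  by exists l; split=> // N' _; exact: lP.
pose S := span_subm [set z | z \in t].
apply: (@noethq_ext _ _ _ _ _ S (zero_subm M) (full_subm R^o)
   (zero_subm R^o) (fun z r => S (z - r *: x)) (fun y z => y = z) _ _ IHt nR).
- split; first by rewrite scale0r subr0; exact: submod0.
  move=> r z z' c c' zc zc'; rewrite scalerDl opprD addrACA -scalerA -scalerBr.
  by apply: submodD => //; apply: submodZ.
- by split=> // r y y' z z' -> ->.
- by move=> z -> ; exact: submod0.
- by [].
- move=> z zx.
  have lp : @linear_pred R M (fun z => exists r : R^o, S (z - r *: x)).
    split; first by exists 0; rewrite scale0r subr0; exact: submod0.
    move=> r u v [c uc] [c' vc']; exists (r * c + c').
    rewrite scalerDl opprD addrACA -scalerA -scalerBr.
    by apply: submodD => //; apply: submodZ.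
  have [|r zr] := zx (mk_submodule lp); last by exists r.
  move=> y; rewrite /= in_cons => /orP [/eqP ->|yt].
    by exists 1; change (S (x - 1 *: x)); rewrite scale1r subrr; exact: (submod0 S).
  by exists 0; rewrite scale0r subr0 => N; apply.
- by move=> z c _ -> ; rewrite scale0r subr0 => Sz; exists z.
- by move=> y z -> _ <-.
Qed.
End Noetherian.

(** * Noetherian local rings *)

Section IdealTheory.
Variable R : comNzRingType.
Implicit Types (a b : ideal R) (p q : spec R).

Lemma ideal_mull a (r x : R) : a x -> a (r * x).
Proof. exact: (@submodZ R R^o a r x). Qed.

Lemma ideal_mulr a (r x : R) : a x -> a (x * r).
Proof. by rewrite mulrC; apply: ideal_mull. Qed.

Definition ideal_add (a : ideal R) (x : R) : ideal R.
Proof.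
apply: (@mk_submodule R R^o (fun z : R => exists2 y : R, a y & exists r, z = y + r * x)).
split; first by exists 0; [exact: submod0 | exists 0; rewrite mul0r addr0].
move=> r _ _ [y ay [s ->]] [y' ay' [s' ->]].
exists (r * y + y'); first by apply: submodD => //; exact: ideal_mull.
by exists (r * s + s'); rewrite /GRing.scale /=; ring.
Defined.

Lemma ideal_add_sub a x : a `<=` ideal_add a x.
Proof. by move=> y ay; exists y => //; exists 0; rewrite mul0r addr0. Qed.

Lemma ideal_add_mem a x : ideal_add a x x.
Proof. by exists 0; [exact: submod0 | exists 1; rewrite mul1r add0r]. Qed.

(** Otherwise every failing ideal lies strictly inside another failing one; the union of the
    resulting chain is finitely generated, hence equal to one of its terms, which contradicts
    strictness. *)
Lemma noetherian_ind (Q : ideal R -> Prop) : noetherian_ring R ->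
  (forall a, (forall b, a `<=` b -> ~ b `<=` a -> Q b) -> Q a) ->
  forall a, Q a.
Proof.
move=> R_noeth QI a0; apply: contrapT => nQ0.
pose bad := {a | ~ Q a}.
have step (u : bad) : exists v : bad, sval u `<=` sval v /\
    ~ (sval v `<=` sval u).
  apply: contrapT => nv; apply: (svalP u); apply: QI => b ub bu.
  by apply: contrapT => nQb; apply: nv; exists (exist _ b nQb).
have /choice [f fP] := step.
pose c n := sval (iter n f (exist _ a0 nQ0)).
have c_le i j : (i <= j)%N -> c i `<=` c j.
  move=> /subnK <-; elim: (j - i)%N => [//|k IHk] x /IHk.
  by rewrite addSn; apply: (fP _).1.
have Ul : @linear_pred R R^o (fun x => exists i, c i x).
  split; first by exists 0%N; exact: submod0.
  move=> r x y [i ix] [j jy]; exists (i + j)%N; apply: submodD.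
    by apply: submodZ; apply: c_le ix; exact: leq_addr.
  by apply: c_le jy; exact: leq_addl.
have /fg_submP [s [sU sP]] := R_noeth (mk_submodule Ul).
have [n ns] : exists n, forall x, x \in s -> c n x.
  elim: s sU {sP} => [|x s IHs] sU; first by exists 0%N.
  have [y ys|n nP] := IHs; first by apply: sU; rewrite in_cons ys orbT.
  have [|i ix] := sU x; first by rewrite in_cons eqxx.
  exists (i + n)%N => y; rewrite in_cons => /orP [/eqP ->|/nP ny].
    by apply: c_le ix; exact: leq_addr.
  by apply: c_le ny; exact: leq_addl.
apply: (fP (iter n f (exist _ a0 nQ0))).2 => x x1.
by apply: (sP (c n) ns); exists n.+1.
Qed.

(* [Q] holds for all products of a family of elements of the primes in [ps]. *)
Fixpoint prod_in (ps : seq (spec R)) (Q : R -> Prop) : Prop :=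
  if ps is p :: ps' then forall r : R, p r -> prod_in ps' (fun x => Q (r * x))
  else Q 1.

Lemma prod_in_mono ps (Q Q' : R -> Prop) :
  (forall x, Q x -> Q' x) -> prod_in ps Q -> prod_in ps Q'.
Proof.
elim: ps Q Q' => [|p ps IHps] Q Q' QQ' /=; first exact: QQ'.
by move=> pQ r pr; apply: IHps (pQ r pr) => x; apply: QQ'.
Qed.

Lemma prod_in_cat ps qs (Q : R -> Prop) :
  prod_in ps (fun x => prod_in qs (fun y => Q (x * y))) ->
  prod_in (ps ++ qs) Q.
Proof.
elim: ps Q => [|p ps IHps] Q /=.
  by apply: prod_in_mono => x; rewrite mul1r.
move=> pQ r pr; apply: IHps; apply: prod_in_mono (pQ r pr) => x.
by apply: prod_in_mono => y; rewrite mulrA.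
Qed.

(** If a is not prime, pick b and c outside a with bc in a; the product of a + (b) and a + (c) lies
    in a, so the two lists of primes can be concatenated. This list plays the part of the finite set
    of minimal primes over a. *)
Lemma exists_prod_in a : noetherian_ring R ->
  exists2 ps : seq (spec R), (forall p, List.In p ps -> a `<=` p) &
    prod_in ps a.
Proof.
move=> R_noeth; move: a; apply: noetherian_ind => // a IHa.
have [a1|na1] := pselect (a 1); first by exists [::].
have [a_pr|na_pr] := pselect (prime_ideal a).
  exists [:: Spec a_pr] => [p [<- //|[]]|r ar /=].
  by rewrite mulr1.
have [b [c [abc nab nac]]] : exists b c : R, [/\ a (b * c), ~ a b & ~ a c].
  apply: contrapT => nbc; apply: na_pr; split=> // b c abc.
  have [?|nab] := pselect (a b); first by left.
  have [?|nac] := pselect (a c); first by right.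
  by case: nbc; exists b, c.
have [ps psa psP] := IHa _ (@ideal_add_sub a b)
  (fun ba => nab (ba _ (ideal_add_mem a b))).
have [qs qsa qsP] := IHa _ (@ideal_add_sub a c)
  (fun ca => nac (ca _ (ideal_add_mem a c))).
exists (ps ++ qs).
  move=> p pin x ax; have [/psa|/qsa] := List.in_app_or _ _ _ pin; apply.
    exact: ideal_add_sub.
  exact: ideal_add_sub.
apply: prod_in_cat; apply: prod_in_mono psP => _ [x ax [r ->]].
apply: prod_in_mono qsP => _ [y ay [s ->]].
rewrite mulrDr mulrDl mulrDl; apply: submodD.
  by apply: submodD; [apply: ideal_mulr | apply: ideal_mull].
apply: submodD; first exact: ideal_mulr.
by rewrite mulrACA; apply: ideal_mull.
Qed.

Lemma prod_in_prime ps q : prod_in ps q ->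
  exists2 p, List.In p ps & p `<=` q.
Proof.
move=> psq; apply: contrapT => np.
have np' p : List.In p ps -> exists2 r : R, p r & ~ q r.
  move=> pps; apply: contrapT => nr; apply: np; exists p => // r pr.
  by apply: contrapT => nqr; apply: nr; exists r.
suff gen : forall Q : R -> Prop, prod_in ps Q -> exists2 x, Q x & ~ q x.
  by have [x] := gen _ psq.
elim: ps np' {psq np} => [_ Q Q1|p ps IHps np Q /= pQ].
  by exists 1 => //; exact: (spec_prime q).1.
have [r pr nqr] := np p (or_introl (erefl _)).
have [|x Qx nqx] := IHps _ _ (pQ r pr).
  by move=> p' p'ps; apply: np; right.
by exists (r * x) => // /(spec_prime q).2 [].
Qed.

Lemma prod_in_pow (m : ideal R) ps a : (forall p, List.In p ps -> m `<=` p) ->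
  prod_in ps a -> ideal_pow m (size ps) `<=` a.
Proof.
elim: ps a => [|p ps IHps] a mps /=.
  by move=> a1 x _; rewrite -[x]mulr1; exact: ideal_mull.
move=> psa; apply: (_ : forall x, _ -> a x) => x; apply=> _ [r [y [mr my ->]]].
have al : @linear_pred R R^o (fun x => a (r * x)).
  split; first by rewrite mulr0; exact: submod0.
  move=> s z z' az az'; rewrite mulrDr; apply: submodD => //.
  by rewrite mulrCA; exact: ideal_mull.
apply: (IHps (mk_submodule al)) => //; first by move=> q qps; apply: mps; right.
by apply: psa; apply: (mps p (or_introl (erefl _))).
Qed.

Lemma exists_separating (m : ideal R) ps p : ~ (m `<=` p) ->
  exists y : R, [/\ m y, ~ p y
    & forall q, List.In q ps -> ~ (q `<=` p) -> q y].
Proof.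
move=> mp; elim: ps => [|q ps [y [my npy psy]]].
  apply: contrapT => ny; apply: mp => y my; apply: contrapT => npy.
  by apply: ny; exists y.
have [qp|nqp] := pselect (q `<=` p).
  by exists y; split=> // q' [<- //|]; exact: psy.
have [z qz npz] : exists2 z : R, q z & ~ p z.
  apply: contrapT => nz; apply: nqp => z qz; apply: contrapT => npz.
  by apply: nz; exists z.
exists (z * y); split.
- exact: ideal_mull.
- by move=> /(spec_prime p).2 [].
- move=> q' [<- _|q'ps nq'p]; first exact: ideal_mulr.
  by apply: ideal_mull; apply: psy.
Qed.

(** When x falls into p, add an element y of m outside p that lies in every listed q not contained
    in p. For q inside p the sum avoids q because it avoids p; for the other q the sum is congruent
    to x modulo q. *)
Lemma prime_avoidance (m : ideal R) (ps : seq (spec R)) :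
  exists x : R, m x /\ forall p, List.In p ps -> ~ (m `<=` p) -> ~ p x.
Proof.
elim: ps => [|p ps [x [mx psx]]]; first by exists 0; split=> //; exact: submod0.
have [mp|nmp] := pselect (m `<=` p).
  by exists x; split=> // q [<- //|]; exact: psx.
have [px|npx] := pselect (p x); last first.
  by exists x; split=> // q [<- //|]; exact: psx.
have [y [my npy psy]] := exists_separating ps nmp.
have npxy : ~ p (x + y).
  by move=> pxy; apply: npy; rewrite -[y](addKr x) addrC; apply: submodB.
exists (x + y); split; first exact: submodD.
move=> q [<- //|qps nmq qxy].
have [qp|nqp] := pselect (q `<=` p); first exact/npxy/qp.
apply: (psx q qps nmq); rewrite -(addrK y x); apply: submodB => //.
exact: psy.
Qed.

(* When [m] is the maximal ideal of a local ring, this says dim R/a <= 1. *)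
Definition dim_le1 (m a : ideal R) : Prop :=
  forall p q, a `<=` p -> p `<=` q -> ~ (q `<=` p) -> m `<=` q.

(** Let x avoid those primes p of a product inside a that do not contain m. A prime q over a + (x)
    contains one of these p; either p contains m, or q is strictly larger than p and the dimension
    bound puts m inside q. So a product of primes containing m lies in a + (x). *)
Lemma exists_parameter (m a : ideal R) : noetherian_ring R -> dim_le1 m a ->
  exists x : R, m x /\ exists l, ideal_pow m l `<=` ideal_add a x.
Proof.
move=> R_noeth a_dim; have [ps psa psP] := exists_prod_in a R_noeth.
have [x [mx xps]] := prime_avoidance m ps; exists x; split=> //.
have [qs qsa qsP] := exists_prod_in (ideal_add a x) R_noeth.
exists (size qs); apply: prod_in_pow qsP => q /qsa aq.
have [|p pps pq] := @prod_in_prime ps q.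
  by apply: prod_in_mono psP => y ay; apply/aq/ideal_add_sub.
have [mp|nmp] := pselect (m `<=` p); first by move=> y /mp /pq.
apply: (a_dim p) => //; first exact: psa.
by move=> qp; apply: (xps p pps nmp); apply/qp/aq/ideal_add_mem.
Qed.

(** Powers of m are iterated spans, whose elements are not visibly products; this principle lets an
    inclusion of m^(n+k) be tested on products alone. *)
Lemma ideal_powD (m : ideal R) n k a :
  (forall r s : R, ideal_pow m n r -> ideal_pow m k s -> a (r * s)) ->
  ideal_pow m (n + k) `<=` a.
Proof.
elim: n a => [|n IHn] a nka.
  by move=> s ks; rewrite -[s]mul1r; apply: nka.
rewrite addSn => x /=; apply=> _ [r [y [mr my ->]]].
have al : @linear_pred R R^o (fun x => a (r * x)).
  split; first by rewrite mulr0; exact: submod0.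
  move=> s z z' az az'; rewrite mulrDr; apply: submodD => //.
  by rewrite mulrCA; exact: ideal_mull.
apply: (IHn (mk_submodule al)) my => s t ns kt /=.
rewrite mulrA; apply: nka => // N; apply; exists r, s; split=> //.
Qed.

Lemma ideal_pow_parameter (m a : ideal R) x l n :
  ideal_pow m l `<=` ideal_add a x ->
  ideal_pow m (l * n) `<=` ideal_add a (x ^+ n).
Proof.
move=> lx; elim: n => [|n IHn].
  move=> r _; exists 0; first exact: submod0.
  by exists r; rewrite expr0 mulr1 add0r.
rewrite mulnS; apply: ideal_powD => r s /lx [y ay [c ->]] /IHn [z az [e ->]].
exists (y * (z + e * x ^+ n) + c * x * z).
  by apply: submodD; [exact: ideal_mulr | exact: ideal_mull].
by exists (c * e); rewrite exprS; ring.
Qed.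

Lemma ideal_pow_exp (m : ideal R) x n : m x -> ideal_pow m n (x ^+ n).
Proof.
move=> mx; elim: n => [//|n IHn]; rewrite exprS => N; apply.
by exists x, (x ^+ n).
Qed.

End IdealTheory.

Section LocalRing.
Variables (R : comNzRingType) (m : ideal R).
Hypotheses (R_noeth : noetherian_ring R) (R_local : local_ring_with m).
Implicit Types (a b : ideal R) (p q : spec R).

Lemma maximal_prime : prime_ideal m.
Proof.
have [nm1 m_max] := R_local.1; split=> // x y mxy.
have [mx|nmx] := pselect (m x); [by left | right].
have [[u mu [r rE]]|n1] := pselect (ideal_add m x 1); last first.
  by case: nmx; apply: (m_max _ n1 (@ideal_add_sub _ m x)); exact: ideal_add_mem.
rewrite -[y]mul1r rE mulrDl -mulrA; apply: submodD; first exact: ideal_mulr.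
exact: ideal_mull.
Qed.

Definition max_spec : spec R := Spec maximal_prime.

Lemma proper_sub_max a : ~ a 1 -> a `<=` m.
Proof.
move: a; apply: noetherian_ind => // a IHa na1.
have [a_max|na_max] := pselect (maximal_ideal a).
  by rewrite (R_local.2 a a_max).
have [b [nb1 ab nba]] : exists b, [/\ ~ b 1, a `<=` b & ~ b `<=` a].
  apply: contrapT => nb; apply: na_max; split=> // b nb1 ab.
  by apply: contrapT => nba; apply: nb; exists b.
by move=> x /ab; apply: IHa.
Qed.

Lemma spec_sub_max p : p `<=` m.
Proof. exact: (proper_sub_max (spec_prime p).1). Qed.

Lemma quot_dim_inj a n k : quot_dim a n -> quot_dim a k -> n = k.
Proof.
by move=> [cn nP] [ck kP]; apply/eqP; rewrite eqn_leq (nP _ ck) (kP _ cn).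
Qed.

Lemma quot_dim0_max p : quot_dim p 0 -> m `<=` p.
Proof.
move=> [_ p0]; apply: contrapT => nmp.
suff /p0 : prime_chain p 1 by [].
exists (fun i => if i is 0%N then p else max_spec); split=> // -[|//] _.
by split=> //; exact: spec_sub_max.
Qed.

Lemma quot_dim1_max p : quot_dim p 1 -> ~ (m `<=` p).
Proof.
move=> [[c [pc cP]] _] mp; apply: (cP 0%N isT).2 => x /spec_sub_max mx.
exact/pc/mp.
Qed.

Lemma max_quot_dim0 : quot_dim m 0.
Proof.
split; first by exists (fun=> max_spec); split=> //.
move=> [//|k [c [mc cP]]]; have [_ nc] := cP 0%N isT.
by case: nc => x /spec_sub_max /mc.
Qed.

Lemma dim_le1_sub a : (forall p, a `<=` p -> dim_le1_locus R p) -> dim_le1 m a.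
Proof.
move=> aW p q ap pq nqp; apply: contrapT => nmq.
have [n [_ nP] n1] := aW p ap.
(* If m were not inside q, then p, q, m would be a strict chain of length 2. *)
suff /nP : prime_chain p 2 by move=> n2; move: (leq_trans n2 n1).
exists (fun i => match i with 0 => p | 1 => q | _ => max_spec end)%N.
by split=> // -[|[|//]] _; split=> //; exact: spec_sub_max.
Qed.

Lemma quot_dim_locus p n : quot_dim p n.+2 -> ~ dim_le1_locus R p.
Proof. by move=> pn [k /(quot_dim_inj pn) <-]. Qed.

(** The summands of D^i are indexed by records, so selecting the one at m requires equality of
    records and not only of the underlying sets. *)
Lemma spec_eq p q : p `<=` q -> q `<=` p -> p = q.
Proof.
move=> pq qp.
suff : spec_ideal p = spec_ideal q.
  case: p q {pq qp} => a a_pr [b b_pr] /= ab; case: b / ab b_pr => b_pr.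
  by congr Spec; apply: Prop_irrelevance.
case: (spec_ideal p) (spec_ideal q) pq qp => [P P0 PD PZ] [Q Q0 QD QZ] /= pq qp.
have PQ : P = Q.
  apply: funext => x; apply: propext; split; [exact: pq | exact: qp].
by case: Q / PQ Q0 QD QZ {pq qp} => *; congr Submodule; apply: Prop_irrelevance.
Qed.

End LocalRing.

(** * Injective hulls and torsion *)

Section InjectiveHulls.
Variable R : comNzRingType.

Definition ideal_pred (P : R -> Prop) : Prop :=
  P 0 /\ forall r x y, P x -> P y -> P (r * x + y).

Definition mk_ideal (P : R -> Prop) (P_lin : ideal_pred P) : ideal R :=
  @mk_submodule R R^o P P_lin.

Lemma scale_fact (M : lmodType R) (b c a : R) (y : M) :
  a = b * c -> a *: y = b *: (c *: y).
Proof. by move=> ->; rewrite scalerA. Qed.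

Lemma hull_unique (M E E' : lmodType R) :
  is_injective_hull M E -> is_injective_hull M E' -> mod_iso E E'.
Proof.
move=> [E_inj [f [f_inj f_ess]]] [E'_inj [f' [f'_inj f'_ess]]].
have [h hf] := E'_inj _ _ f f' f_inj.
have h0 y : h y = 0 -> y = 0.
  apply: (f_ess (mk_submodule (linear_pred_preim h (submod_linear (zero_subm _))))).
  by move=> x /=; rewrite hf -(linear0 f') => /f'_inj.
have [r rh] := E_inj _ _ h (idfun : {linear E -> E}) (linear_inj h0).
apply: (linear_bij (f := h)) => // y; exists (r y); apply/eqP.
rewrite -subr_eq0; apply/eqP.
pose K := mk_submodule (linear_pred_preim r (submod_linear (zero_subm _))).
have ess : forall y, K y -> y = 0.
  apply: f'_ess => x /=; rewrite -hf rh /= -(linear0 f); exact: f_inj.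
by apply: ess; rewrite /= linearB rh subrr.
Qed.

(** The kernel of s on E(R/p) meets R/p in 0, since p is prime, and so vanishes by essentiality. *)
Lemma hull_regular (p : spec R) (E : lmodType R) (s : R) :
  is_injective_hull (quot p) E -> ~ p s -> forall y : E, s *: y = 0 -> y = 0.
Proof.
move=> [_ [f [f_inj f_ess]]] ps y sy.
have Kl : linear_pred (fun y : E => s *: y = 0).
  split; first exact: scaler0.
  by move=> r u v su sv; rewrite scalerDr sv addr0 scalerA mulrC -scalerA su scaler0.
apply: (f_ess (mk_submodule Kl)) sy => x /=.
rewrite -linearZZ -(linear0 f) => /f_inj.
rewrite -[x](@pm_reprK R (quot_premodule p)).
set x' : R := pm_repr x.
rewrite -[pm_pi _]/(quot_pi p x') -linearZZ -(linear0 (quot_pi p)).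
move=> /quot_piP; rewrite subr0 => /(spec_prime p).2 [//|px].
by apply/quot_piP; rewrite subr0.
Qed.

(** The ideal of all r with x^k r y = 0 for some k is finitely generated, so one k serves every r.
    The span of x^k y then meets R/m trivially: if r x^k y lies in R/m, it is killed by x, so
    x^(k+1) r y = 0 and already x^k r y = 0. Essentiality gives x^k y = 0. *)
Lemma hull_torsion (m : ideal R) (E : lmodType R) (x : R) :
  noetherian_ring R -> is_injective_hull (quot m) E -> m x ->
  forall y : E, exists k, x ^+ k *: y = 0.
Proof.
move=> R_noeth [_ [f [f_inj f_ess]]] mx y.
have xl : ideal_pred (fun r => exists k, (x ^+ k * r) *: y = 0).
  split; first by exists 0%N; rewrite mulr0 scale0r.
  move=> r u v [k uk] [l vl]; exists (k + l)%N.
  rewrite mulrDr scalerDl (@scale_fact _ (r * x ^+ l) (x ^+ k * u)).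
    rewrite (@scale_fact _ (x ^+ k) (x ^+ l * v) (x ^+ (k + l) * v)).
      by rewrite uk vl !scaler0 addr0.
    by rewrite exprD mulrA.
  by rewrite exprD; ring.
have /fg_submP [s [sN sP]] := R_noeth (mk_ideal xl).
have [k ks] : exists k, forall r : R, r \in s -> (x ^+ k * r) *: y = 0.
  elim: s sN {sP} => [|r s IHs] sN; first by exists 0%N.
  have [z zs|k kP] := IHs; first by apply: sN; rewrite in_cons zs orbT.
  have [|l rl] := sN r; first by rewrite in_cons eqxx.
  exists (k + l)%N => z; rewrite in_cons => /orP [/eqP ->|/kP zk].
    by rewrite exprD -mulrA -scalerA rl scaler0.
  by rewrite exprD mulrAC mulrC -scalerA zk scaler0.
have kP (r : R) n : (x ^+ n * r) *: y = 0 -> (x ^+ k * r) *: y = 0.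
  have kl : ideal_pred (fun r => (x ^+ k * r) *: y = 0).
    split; first by rewrite mulr0 scale0r.
    move=> c u v uk vk; rewrite mulrDr scalerDl vk addr0.
    by rewrite mulrCA -scalerA uk scaler0.
  by move=> rn; apply: (sP (mk_ideal kl) ks); exists n.
exists k.
pose Y := span_subm [set x ^+ k *: y].
apply: (f_ess Y); last by move=> N; apply.
move=> z zY.
have [r zE] : exists r : R, r *: (x ^+ k *: y) = f z.
  have l : linear_pred (fun z : E => exists r : R, r *: (x ^+ k *: y) = z).
    split; first by exists 0; rewrite scale0r.
    move=> c u v [a <-] [b <-]; exists (c * a + b).
    by rewrite scalerDl -scalerA.
  by apply: (zY (mk_submodule l)) => _ ->; exists 1; rewrite scale1r.
have xz : x *: z = 0.
  rewrite -[z](@pm_reprK R (quot_premodule m)).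
  set z' : R := pm_repr z.
  rewrite -[pm_pi _]/(quot_pi m z') -linearZZ -(linear0 (quot_pi m)).
  by apply/quot_piP; rewrite subr0; exact: ideal_mulr.
have /kP : (x ^+ k.+1 * r) *: y = 0.
  rewrite (@scale_fact _ x (r * x ^+ k)); last by rewrite exprS; ring.
  by rewrite -scalerA zE -linearZZ xz linear0.
rewrite mulrC -scalerA zE -(linear0 f); exact: f_inj.
Qed.

End InjectiveHulls.

(** * Torsion submodules and parameters *)

Section Torsion.
Variables (R : comNzRingType) (m : ideal R).
Hypothesis R_noeth : noetherian_ring R.

Definition ann_ideal (M : lmodType R) : ideal R.
Proof.
apply: (@mk_ideal R (fun r => forall y : M, r *: y = 0)).
split; first by move=> y; rewrite scale0r.
by move=> r a b a0 b0 y; rewrite scalerDl -scalerA a0 b0 scaler0 addr0.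
Defined.

Lemma noethq_full (M : lmodType R) : fg_mod M ->
  noethq (full_subm M) (zero_subm M).
Proof.
move=> /fg_submP [s [_ sP]].
apply: (@noethq_sub _ _ (span_subm [set x | x \in s])).
  exact: noethq_span.
by move=> x _ N sN; apply: sP.
Qed.

Lemma noethq_gens (M : lmodType R) (N : submodule M) : fg_mod M ->
  exists s : seq M, (forall x, x \in s -> N x) /\
    forall N' : submodule M, (forall x, x \in s -> N' x) -> N `<=` N'.
Proof.
move=> M_fg; have [||s [sN sP]] := noethq_full M_fg (N := N).
- by move=> x ->; exact: submod0.
- by [].
exists s; split=> // N' sN'; apply: sP => // x ->; exact: submod0.
Qed.

Lemma torsion_bounded (M : lmodType R) : fg_mod M ->
  exists k, forall r (t : M), ideal_pow m k r -> torsion_subm m M t -> r *: t = 0.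
Proof.
move=> M_fg; have [s [sT sP]] := noethq_gens (torsion_subm m M) M_fg.
have [k ks] : exists k, forall t, t \in s ->
    forall r : R, ideal_pow m k r -> r *: t = 0.
  elim: s sT {sP} => [|t s IHs] sT; first by exists 0%N.
  have [z zs|k kP] := IHs; first by apply: sT; rewrite in_cons zs orbT.
  have [|l rl] := sT t; first by rewrite in_cons eqxx.
  exists (k + l)%N => z; rewrite in_cons => /orP [/eqP ->|/kP zk] r.
    by move=> /(ideal_pow_le (leq_addl k l)) /rl.
  by move=> /(ideal_pow_le (leq_addr l k)) /zk.
exists k => r t rk; suff kl : linear_pred (fun t : M => r *: t = 0).
  by apply: (sP (mk_submodule kl)) => z /ks; apply.
split; first exact: scaler0.
by move=> c u v u0 v0; rewrite scalerDr v0 addr0 scalerA mulrC -scalerA u0 scaler0.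
Qed.

Variable M : lmodType R.
Variables (x : R) (l : nat).
Hypothesis xl : ideal_pow m l `<=` ideal_add (ann_ideal M) x.

(** Here m^(l n) lies in ann M + (x^n), whose first summand kills y. The element lives in a second
    module because the lemma is applied to values of maps defined on M. *)
Lemma parameter_torsion (N : lmodType R) (y : N) n k :
  (forall r, ann_ideal M r -> r *: y = 0) ->
  (forall r, ideal_pow m k r -> r *: (x ^+ n *: y) = 0) ->
  torsion_subm m N y.
Proof.
move=> ay ky; exists (l * n + k)%N => t.
have tl : ideal_pred (fun t => t *: y = 0).
  split; first by rewrite scale0r.
  by move=> c u v u0 v0; rewrite scalerDl -scalerA u0 v0 scaler0 addr0.
apply: (ideal_powD (a := mk_ideal tl)) => r s.
move=> /(ideal_pow_parameter (n := n) xl) [a aM [c ->]] sk /=.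
rewrite mulrC -scalerA scalerDl ay // add0r -scalerA scalerA mulrC -scalerA.
by rewrite ky // scaler0.
Qed.

Lemma parameter_regular n (y : M) :
  torsion_subm m M (x ^+ n *: y) -> torsion_subm m M y.
Proof. by move=> [k yk]; apply: (@parameter_torsion _ _ n k) => // r; apply. Qed.

Lemma parameter_regular0 n (y : M) : x ^+ n *: y = 0 -> torsion_subm m M y.
Proof. by move=> y0; apply: (@parameter_regular n); rewrite y0; exact: submod0. Qed.

End Torsion.

Section DirectSum.
Variables (R : comNzRingType) (I : Type) (M : I -> lmodType R).

Lemma dsum_eq0 (u : dsum M) : (forall i, val u i = 0) -> u = 0.
Proof. by move=> u0; apply: val_inj; apply: functional_extensionality_dep. Qed.

Lemma dsum_single (i : I) : (forall j, j = i) -> mod_iso (dsum M) (M i).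
Proof.
move=> Ii; have fl : linear (fun u : dsum M => val u i) by [].
apply: (linear_bij (f := linear_of fl)) => [u u0|y].
  by apply: dsum_eq0 => j; rewrite (Ii j).
pose v : prodm M := fun j => ecast k (M k) (esym (Ii j)) y.
have fin : dsum_subm M v.
  apply: (@sub_finite_set _ _ [set i]); last exact: finite_set1.
  by move=> j _; exact: Ii.
exists (mk_subm (fin)); rewrite [LHS](_ : _ = v i) // /v.
by rewrite (Prop_irrelevance (esym (Ii i)) erefl).
Qed.

End DirectSum.

(** * Extension modules *)

Section FreeModules.
Variable R : comNzRingType.

(* The free module of rank [k], as the sequences vanishing from [k] on: all
   free modules then live in one ambient module, which avoids dependent types. *)
Definition free_subm (k : nat) : submodule (nat -> R^o).
Proof.
apply: (@mk_submodule R _ (fun v : nat -> R^o => forall i, (k <= i)%N -> v i = 0)).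
split=> // r v w v0 w0 i ki.
by rewrite [LHS](_ : _ = r *: v i + w i) // v0 // w0 // scaler0 addr0.
Defined.

Lemma free_linE k a (u v : subm (free_subm k)) j :
  (val (a *: u + v) j : R) = a * (val u j : R) + (val v j : R).
Proof. by rewrite subm_linE. Qed.

Lemma free_scaleE k a (u : subm (free_subm k)) j :
  (val (a *: u) j : R) = a * (val u j : R).
Proof. by rewrite subm_scaleE. Qed.

Definition free_basis (i : nat) : nat -> R^o := fun j => (j == i)%:R.

Lemma free_basis_mem k i : (i < k)%N -> free_subm k (free_basis i).
Proof. by move=> ik j kj; rewrite /free_basis gtn_eqF // (leq_trans ik kj). Qed.

Section Comb.
Variables (M : lmodType R) (k : nat) (y : nat -> M).

Definition comb_fun (v : nat -> R^o) : M := \sum_(i < k) (v i : R) *: y i.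

Fact comb_linear : linear comb_fun.
Proof.
move=> r v w; rewrite /comb_fun scaler_sumr -big_split /=.
by apply: eq_bigr => i _; rewrite scalerA -scalerDl.
Qed.

Definition comb : {linear (nat -> R^o) -> M} := linear_of comb_linear.

Lemma comb_basis i : (i < k)%N -> comb (free_basis i) = y i.
Proof.
move=> ik; rewrite [LHS](bigD1 (Ordinal ik)) //= big1 => [|j ji].
  by rewrite /free_basis eqxx scale1r addr0.
rewrite /free_basis; case: eqP => [jiE|_]; last by rewrite scale0r.
by case/eqP: ji; apply: val_inj.
Qed.

Lemma comb_mem (N : submodule M) v : (forall i, (i < k)%N -> N (y i)) ->
  N (comb v).
Proof.
move=> Ny; rewrite /= /comb_fun; apply: (big_ind (fun x => N x)).
- exact: submod0.
- exact: submodD.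
- by move=> i _; apply/submodZ/Ny.
Qed.

End Comb.

Lemma free_comb k v : free_subm k v -> v = comb k free_basis v.
Proof.
move=> vk; apply: funext => j; rewrite /= /comb_fun.
have -> : forall (I : finType) (F : I -> nat -> R^o), (\sum_(i : I) F i) j = \sum_i F i j.
  move=> I F; apply: (big_ind2 (fun (f : nat -> R^o) a => f j = a)) => //.
  by move=> f a g b <- <-.
have [jk|kj] := ltnP j k; last first.
  rewrite vk // big1 // => i _; rewrite /GRing.scale /= /free_basis.
  rewrite gtn_eqF ?[LHS]mulr0 //; exact: leq_trans (ltn_ord i) kj.
rewrite (bigD1 (Ordinal jk)) //= big1 => [|i ij].
  by rewrite /free_basis addr0 /GRing.scale /= eqxx [RHS]mulr1.
rewrite /GRing.scale /= /free_basis; case: eqP => [jiE|_]; last by rewrite [LHS]mulr0.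
by case/eqP: ij; apply: val_inj.
Qed.

Lemma free_gen k (N : submodule (nat -> R^o)) :
  (forall i, (i < k)%N -> N (free_basis i)) -> free_subm k `<=` N.
Proof. by move=> Nb v /free_comb ->; apply: comb_mem. Qed.

Lemma free_noeth k : noetherian_ring R ->
  noethq (free_subm k) (zero_subm (nat -> R^o)).
Proof.
move=> R_noeth.
apply: (@noethq_sub _ _ (span_subm [set x | x \in map free_basis (iota 0 k)])).
  exact: noethq_span.
apply: free_gen => i ik N; apply; rewrite /= map_f // mem_iota; exact: ik.
Qed.

Lemma fg_subm_mod (M : lmodType R) (Z : submodule M) :
  noethq Z (zero_subm M) -> fg_mod (subm Z).
Proof.
move=> nZ; apply/fg_submP.
have [|//|s [sZ sP]] := nZ Z; first by move=> _ ->; exact: submod0.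
exists [seq odflt 0 (insub x) | x <- s]; split=> // N' sN' z _.
pose Nv := mk_submodule (linear_pred_image (linear_rel_fun (val_lin Z))
  (submod_linear N') (submod_linear (zero_subm M))).
have [_ -> //|x xs|z' [_ [N'z' -> /=]]] := sP Nv _ _ (val z) (submP z).
- exact: submod0.
- have xZ : submod_pred Z x by apply/asboolP/sZ.
  exists (odflt 0 (insub x)), 0; split=> //.
    by apply: sN'; apply: map_f.
  by rewrite subr0 insubT.
by rewrite subr0 => /val_inj ->.
Qed.

End FreeModules.

(** * Cocycles, coboundaries and representatives of classes *)

Section Cohomology.
Variables (R : comNzRingType) (X : complex R).

(** Both degrees are parameters, so that equalities such as n - 1 + 1 = n are handled by rewriting
    indices instead of transporting elements. *)
Definition cyc (i j : int) : submodule (X i) :=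
  mk_submodule (linear_pred_preim (cdiff X i j)
    (submod_linear (zero_subm (X j)))).

Fact bnd_linear i j : linear_pred (fun x : X j => exists y, cdiff X i j y = x).
Proof.
split; first by exists 0; rewrite linear0.
by move=> r _ _ [y <-] [z <-]; exists (r *: y + z); rewrite linearP.
Qed.

Definition bnd (i j : int) : submodule (X j) := mk_submodule (bnd_linear i j).

(** A relation instead of the projection: the latter is defined on the submodule of cocycles only
    and would carry membership proofs through every computation. *)
Definition reps (n : int) (x : X n) (w : cohomology X n) : Prop :=
  exists xc : cycles X n x, w = quot_pi (boundaries X n) (mk_subm xc).

Lemma reps_linear n : linear_rel (@reps n).
Proof.
split; first by exists (submod0 _); rewrite -[LHS](linear0 (quot_pi (boundaries X n)));
  congr (quot_pi _ _); apply: val_inj.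
move=> r x x' w w' [xc ->] [xc' ->].
exists ((submod_linear (cycles X n)).2 r _ _ xc xc').
by rewrite -linearP; congr (quot_pi _ _); apply: val_inj.
Qed.

Lemma repsE n x : cyc n (n + 1) x -> exists w, @reps n x w.
Proof. by move=> xc; exists (quot_pi (boundaries X n) (mk_subm (xc : cycles X n x))), xc. Qed.

Lemma reps_ex n w : exists2 x, @reps n x w & cyc n (n + 1) x.
Proof.
rewrite -(pm_reprK w); set z := pm_repr w; exists (val z); last exact: (submP z).
by exists (submP z); congr (quot_pi _ _); apply: val_inj.
Qed.

Lemma reps_cyc n x w : @reps n x w -> cyc n (n + 1) x.
Proof. by case. Qed.

Lemma reps0 n x w : @reps n x w -> (w = 0 <-> bnd (n - 1) n x).
Proof.
move=> [xc ->]; rewrite -(linear0 (quot_pi (boundaries X n))).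
split=> [/quot_piP|xb]; first by rewrite subr0 => -[y yE]; exists y.
by apply/quot_piP; rewrite subr0; case: xb => y yE; exists y.
Qed.

Lemma bnd_cyc i j k x : bnd i j x -> cyc j k x.
Proof. by move=> [y <-]; exact: cdiff_comp. Qed.

Lemma cohomology_noeth n : noetherian_ring R -> fg_mod (cohomology X n) ->
  noethq (cyc n (n + 1)) (bnd (n - 1) n).
Proof.
move=> R_noeth /(noethq_full R_noeth) H_noeth.
apply: (@noethq_ext _ _ R^o _ _ _ (zero_subm R^o) (zero_subm R^o) _ _
  (@reps n) (fun x z => x = 0 /\ bnd (n - 1) n z) (@reps_linear n) _ _ H_noeth) => //.
- split; first by split=> //; exact: submod0.
  move=> r x x' y y' [-> yb] [-> yb']; rewrite scaler0 addr0; split=> //.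
  exact: (submod_linear (bnd (n - 1) n)).2.
- exact: noethq_triv.
- by move=> z /repsE [w zw]; exists w.
- by move=> z c zc -> z0; exists 0 => //; split=> //; apply/(reps0 z0).
- by move=> x z _ _ [].
Qed.

End Cohomology.

(** * Finite generation of Ext^j(M, D) *)

Section ExtModules.
Variables (R : comNzRingType) (D : complex R).
Hypothesis R_noeth : noetherian_ring R.
Hypothesis D_inj : forall n, injective_mod (D n).

Definition ext_cyc (M : lmodType R) (i j : int) : submodule (hom_mod M (D i)).
Proof.
apply: (@mk_submodule R _ (fun f => forall x, cdiff D i j (hom_fun f x) = 0)).
split=> [x|r f g f0 g0 x]; first by rewrite hom_zeroE linear0.
by rewrite hom_linE linearP f0 g0 scaler0 addr0.
Defined.

Definition ext_bnd (M : lmodType R) (i j : int) : submodule (hom_mod M (D j)).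
Proof.
apply: (@mk_submodule R _ (fun f => exists g : hom_mod M (D i),
  forall x, hom_fun f x = cdiff D i j (hom_fun g x))).
split=> [|r f g [f' fE] [g' gE]]; first by exists 0 => x; rewrite linear0.
by exists (r *: f' + g') => x; rewrite !hom_linE linearP fE gE.
Defined.

Lemma ext_bnd_cyc M i j l : ext_bnd M i j `<=` ext_cyc M j l.
Proof. by move=> f [g fE] x; rewrite fE cdiff_comp. Qed.

Section DimensionShift.
Variables (j : int) (M : lmodType R) (k : nat) (e : nat -> M).
Hypothesis e_gen : forall x, exists2 v, free_subm R k v & comb k e v = x.
Hypothesis Dj_fg : fg_mod (cohomology D j).
Hypothesis IH : forall M : lmodType R, fg_mod M ->
  noethq (ext_cyc M (j - 1) j) (ext_bnd M (j - 1 - 1) (j - 1)).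

Fact eval_bnd_linear n : linear_pred (fun f : hom_mod M (D j) =>
  forall i, (n <= i < k)%N -> bnd D (j - 1) j (hom_fun f (e i))).
Proof.
split=> [x _|r f g fb gb i ik]; first exact: submod0.
by rewrite hom_linE; exact: (submod_linear (bnd D (j - 1) j)).2 (fb i ik) (gb i ik).
Qed.

(** A filtration of the cocycles: the first n generators are unconstrained. Evaluation at [e n]
    embeds the step from n to n + 1 into H^j(D), and n = 0 is the part reached by dimension
    shifting. *)
Definition eval_bnd n : submodule (hom_mod M (D j)) :=
  mk_submodule (linear_pred_and (submod_linear (ext_cyc M j (j + 1)))
    (eval_bnd_linear n)).

(* Dimension shifting along [0 -> K -> R^k -> M -> 0]: if [f] sends the
   generators to coboundaries then [f] lifts to [R^k -> D^(j-1)], whose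
   restriction to [K] is a cocycle. *)
Lemma eval_bnd0_noeth : noethq (eval_bnd 0) (ext_bnd M (j - 1) j).
Proof.
pose K := mk_submodule (linear_pred_and (submod_linear (free_subm R k))
   (linear_pred_preim (comb k e) (submod_linear (zero_subm M)))).
have K_fg : fg_mod (subm K).
  apply: fg_subm_mod; apply: (@noethq_sub _ _ (free_subm R k)).
    exact: free_noeth.
  by move=> v [].
pose rho (g : hom_mod (subm K) (D (j - 1))) (f : hom_mod M (D j)) :=
  exists h : hom_mod (nat -> R^o) (D (j - 1)),
    (forall v, free_subm R k v ->
       cdiff D (j - 1) j (hom_fun h v) = hom_fun f (comb k e v)) /\
    (forall v, hom_fun g v = hom_fun h (val v)).
have rho_lin : linear_rel rho.
  split; first by exists 0; split=> // v _; rewrite linear0.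
  move=> r g g' f f' [h [h1 h2]] [h' [h1' h2']]; exists (r *: h + h').
  split=> v; last by rewrite !hom_linE h2 h2'.
  by move=> vk; rewrite !hom_linE linearP h1 // h1'.
apply: (@noethq_ext _ _ _ R^o _ _ _ _ (zero_subm R^o) (zero_subm R^o)
  (fun _ c => c = 0) rho _ rho_lin (IH K_fg)) => //.
- by split=> // r f f' c c' -> ->; rewrite scaler0 addr0.
- exact: noethq_triv.
- exact: ext_bnd_cyc.
- by move=> f _; exists 0.
- move=> f c [fc fe] _ _.
  have /choice [a aE] : forall i, exists a, (i < k)%N -> cdiff D (j - 1) j a = hom_fun f (e i).
    move=> i; have [ik|ki] := ltnP i k; last by exists 0.
    by have [a aE] := fe i ik; exists a.
  have h1 v : free_subm R k v ->
      cdiff D (j - 1) j (comb k a v) = hom_fun f (comb k e v).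
    move=> vk; pose Q := mk_submodule (linear_pred_preim
      ((cdiff D (j - 1) j \o comb k a) \- (hom_fun f \o comb k e) : {linear _ -> _})
      (submod_linear (zero_subm (D j)))).
    suff : Q v by rewrite /= => /eqP; rewrite subr_eq0 => /eqP.
    apply: (@free_gen R k Q) vk => i ik.
    change (cdiff D (j - 1) j (comb k a (free_basis R i)) -
            hom_fun f (comb k e (free_basis R i)) = 0).
    by rewrite !comb_basis // aE // subrr.
  exists (hom_of (comb k a \o val_lin K : {linear _ -> _})).
    move=> v; have [vk v0] := submP v.
    change (cdiff D (j - 1) j (comb k a (val v)) = 0).
    by rewrite h1 // [comb k e _]v0 linear0.
  by exists (hom_of (comb k a)).
- move=> g f [mu gE] [fc fe] [h [h1 h2]].
  (* On K the lift h is the coboundary of mu. Once mu is extended to the ambient module, h - d mu'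
     vanishes on K, hence factors through M, and it has the same differential as h. *)
  have [mu' mu'E] := inj_extend (hom_fun mu) (@D_inj _).
  pose h' := hom_fun h \- (cdiff D (j - 1 - 1) (j - 1) \o mu') : {linear _ -> _}.
  have [v|chi chiE] := @inj_factor R (D (j - 1)) _ _
    (comb k e \o val_lin (free_subm R k) : {linear _ -> _})
    (h' \o val_lin (free_subm R k) : {linear _ -> _}) (@D_inj _).
    move=> v0; have vK : K (val v) by split; [exact: submP | exact: v0].
    change (hom_fun h (val (mk_subm vK))
      - cdiff D (j - 1 - 1) (j - 1) (mu' (val (mk_subm vK))) = 0).
    by rewrite -h2 gE mu'E subrr.
  exists (hom_of chi) => x; have [v vk <-] := e_gen x.
  rewrite -h1 // -[in RHS]/(val (mk_subm vk)).
  rewrite -[hom_fun (hom_of chi) _]/(chi (comb k e (val_lin _ (mk_subm vk)))).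
  rewrite [chi _]chiE /= linearB cdiff_comp subr0.
  by [].
Qed.

Lemma ext_noeth_step : noethq (ext_cyc M j (j + 1)) (ext_bnd M (j - 1) j).
Proof.
apply: (@noethq_sub _ _ (eval_bnd k)); last first.
  by move=> f fc; split=> // i /andP [ki /(leq_ltn_trans ki)]; rewrite ltnn.
suff H n : (n <= k)%N -> noethq (eval_bnd n) (ext_bnd M (j - 1) j) by exact: H.
elim: n => [|n IHn] nk; first exact: eval_bnd0_noeth.
have ev_lin : linear (fun f : hom_mod M (D j) => hom_fun f (e n)) by [].
apply: (@noethq_ext _ _ _ _ _ _ _ _ _ _ _ (fun f g => f = g)
  (linear_rel_fun (linear_of ev_lin)) _ (IHn (ltnW nk))
  (cohomology_noeth R_noeth Dj_fg)).
- by split=> // r f f' g g' -> ->.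
- move=> f fb; split; first exact: ext_bnd_cyc fb.
  by move=> i ik; case: fb => g ->; exists (hom_fun g (e i)).
- by move=> x; exact: bnd_cyc.
- by move=> f [fc fe]; exists (hom_fun f (e n)).
- move=> f c [fc fe] cb cE; exists f => //; split=> // i /andP [ni ik].
  have [<-|ne] := eqVneq n i; first by rewrite -[hom_fun f _]/(linear_of ev_lin f) -cE.
  by apply: fe; rewrite ltn_neqAle ne ni.
- by move=> f g fb _ <-.
Qed.

End DimensionShift.

Hypothesis D_fg : forall n, fg_mod (cohomology D n).
Hypothesis D_neg : forall n, n < 0 -> is_zero_mod (D n).

Lemma fg_comb (M : lmodType R) : fg_mod M -> exists k (e : nat -> M),
  forall x, exists2 v, free_subm R k v & comb k e v = x.
Proof.
move=> /fg_submP [s [_ sP]]; exists (size s), (nth 0 s) => x.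
have Il : linear_pred (fun x : M =>
    exists2 v, free_subm R (size s) v & comb (size s) (nth 0 s) v = x).
  split; first by exists 0; [exact: submod0 | rewrite linear0].
  move=> r _ _ [v vs <-] [w ws <-]; exists (r *: v + w); last by rewrite linearP.
  exact: (submod_linear (free_subm R (size s))).2.
apply: (sP (mk_submodule Il)) => // y /(nthP 0) [i ik <-].
by exists (free_basis R i); [exact: free_basis_mem | rewrite comb_basis].
Qed.

(** The bound n turns descent on the integer j into ordinary induction; below degree 0 every cocycle
    vanishes with D^j. *)
Lemma ext_noeth (n : nat) (j : int) (M : lmodType R) : j < n%:Z -> fg_mod M ->
  noethq (ext_cyc M j (j + 1)) (ext_bnd M (j - 1) j).
Proof.
elim: n j M => [|n IHn] j M jn M_fg.
  apply: (@noethq_sub _ _ (ext_bnd M (j - 1) j)); first exact: noethq_triv.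
  move=> f _; exists 0 => x; rewrite linear0; exact: D_neg.
have [k [e eP]] := fg_comb M_fg.
apply: (ext_noeth_step eP (D_fg j)) => M' M'_fg.
have := IHn (j - 1) M' _ M'_fg; rewrite subrK; apply.
move: jn; lia.
Qed.

End ExtModules.

(** * The dualizing complex *)

Section NormalizedDualizing.
Variables (R : comNzRingType) (m : ideal R) (d : nat) (D : complex R).
Hypotheses (R_noeth : noetherian_ring R) (R_local : local_ring_with m).
Hypothesis D_dual : normalized_dualizing_complex d D.

Lemma dualizing_inj n : injective_mod (D n).
Proof. by have [[_ + _ _] _ _] := D_dual; apply. Qed.

Lemma dualizing_fg n : fg_mod (cohomology D n).
Proof. by have [[_ _ + _] _ _] := D_dual; apply. Qed.

Lemma dualizing_neg n : n < 0 -> is_zero_mod (D n).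
Proof. by move=> n0; have [_ + _] := D_dual; apply; left. Qed.

Lemma dualizing_big n : d%:Z < n -> is_zero_mod (D n).
Proof. by move=> n0; have [_ + _] := D_dual; apply; right. Qed.

(** D^i is a direct sum of hulls E(R/p), and each component may be tested with its own s, which acts
    injectively on that hull. *)
Lemma dualizing_eq0 (i : nat) (y : D i%:Z) : (i <= d)%N ->
  (forall p, quot_dim (spec_ideal p) (d - i) -> exists2 s, ~ p s & s *: y = 0) ->
  y = 0.
Proof.
move=> id sy; have [_ _ [E' E'_hull /(_ i id) [f f_bij]]] := D_dual.
apply: (bij_inj f_bij); rewrite linear0.
apply: dsum_eq0 => -[p pd]; have [s ps s0] := sy p pd.
apply: (hull_regular (E'_hull p) ps).
by rewrite -[LHS]/(val (s *: f y) (exist _ p pd)) -linearZZ s0 linear0.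
Qed.

Lemma dualizing_top (E : lmodType R) : is_injective_hull (quot m) E ->
  mod_iso (D d%:Z) E.
Proof.
move=> E_hull; have [_ _ [E' E'_hull /(_ d (leqnn d)) Dd]] := D_dual.
have m_spec := max_quot_dim0 R_noeth R_local.
rewrite -(subnn d) in m_spec.
pose mm : {p : spec R | quot_dim p (d - d)} := exist _ (max_spec R_local) m_spec.
apply: (mod_iso_trans Dd).
apply: (mod_iso_trans (dsum_single (fun p => E' (sval p)) (i := mm) _)).
  move=> [p pd]; apply: eq_exist; apply: spec_eq.
    exact: (spec_sub_max R_noeth R_local).
  by apply: (quot_dim0_max R_noeth R_local); rewrite -(subnn d).
exact: (hull_unique (E'_hull (max_spec R_local)) E_hull).
Qed.

(** For each summand E(R/p) of D^(d-1) one has dim R/p = 1, so some s in m lies outside p and its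
    powers act injectively there. If d = 0 the module is D^(-1) = 0. *)
Lemma dualizing_pre_torsion (y : D (d%:Z - 1)) : torsion_subm m (D (d%:Z - 1)) y ->
  y = 0.
Proof.
move=> [k ky]; have [d0|d0] := posnP d.
  by apply: dualizing_neg; rewrite d0.
have dE : d%:Z - 1 = d.-1%:Z by lia.
move: y ky; rewrite dE => y ky; apply: dualizing_eq0; first exact: leq_pred.
rewrite (_ : d - d.-1 = 1)%N; last by lia.
move=> p p1; have [s ms ps] : exists2 s : R, m s & ~ p s.
  apply: contrapT => ns; apply: (quot_dim1_max R_noeth R_local p1) => s ms.
  by apply: contrapT => ps; apply: ns; exists s.
exists (s ^+ k); last exact/ky/ideal_pow_exp.
elim: k {ky} => [|k IHk]; first exact: (spec_prime p).1.
by rewrite exprS => /(spec_prime p).2 [].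
Qed.

(** For finitely generated M this says that M localizes to 0 at all primes with dim R/p > 1. Stated
    through annihilators, it also applies to the values of any map out of M. *)
Definition small_mod (M : lmodType R) : Prop :=
  forall p, ~ dim_le1_locus R p -> exists2 s, ~ p s & ann_ideal M s.

Lemma small_dim_le1 M : small_mod M -> dim_le1 m (ann_ideal M).
Proof.
move=> M_small; apply: (dim_le1_sub R_noeth R_local) => p aMp.
by apply: contrapT => /M_small [s ps /aMp].
Qed.

Lemma hom_small0 (M : lmodType R) (j : int) (f : {linear M -> D j}) :
  small_mod M -> j < d%:Z - 1 -> forall z, f z = 0.
Proof.
move=> M_small jd z; have [j0|j0] := ltP j 0; first exact: dualizing_neg.
case: j j0 f jd => [i|//] _ f jd.
apply: dualizing_eq0 => [|p]; first by lia.
rewrite (_ : d - i = (d - i - 2).+2)%N; last by lia.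
move=> /quot_dim_locus /M_small [s ps sM]; exists s => //.
by rewrite -linearZZ sM linear0.
Qed.

Section Lifting.
Variables (M : lmodType R) (x : R) (l : nat).
Hypothesis M_fg : fg_mod M.
Hypothesis xl : ideal_pow m l `<=` ideal_add (ann_ideal M) x.
Hypothesis x_tors : forall y : D d%:Z, exists k, x ^+ k *: y = 0.

Lemma hom_bounded (f : hom_mod M (D d%:Z)) : exists k, x ^+ k *: f = 0.
Proof.
have kl k : linear_pred (fun y : M => x ^+ k *: hom_fun f y = 0).
  split; first by rewrite linear0 scaler0.
  by move=> r u v u0 v0; rewrite linearP scalerDr v0 addr0 scalerA mulrC -scalerA u0 scaler0.
have /fg_submP [s [_ sP]] := M_fg.
have [k ks] : exists k, forall y, y \in s -> x ^+ k *: hom_fun f y = 0.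
  elim: s {sP} => [|y s [k kP]]; first by exists 0%N.
  have [n yn] := x_tors (hom_fun f y).
  exists (k + n)%N => z; rewrite in_cons => /orP [/eqP ->|/kP zk].
    by rewrite exprD -scalerA yn scaler0.
  by rewrite exprD mulrC -scalerA zk scaler0.
exists k; apply: hom_modP => y.
by apply: (sP (mk_submodule (kl k))).
Qed.

(* [x ^+ k] kills [Ext^d(M, D)], which is finitely generated, while every map
   killing the torsion is [x ^+ k] times another one. *)
Lemma lift_torsion_free (f : {linear M -> D d%:Z}) :
  (forall t, torsion_subm m M t -> f t = 0) ->
  exists g : {linear M -> D (d%:Z - 1)},
    forall z, f z = cdiff D (d%:Z - 1) d%:Z (g z).
Proof.
move=> fT.
have ext_fg : noethq (ext_cyc D M d%:Z (d%:Z + 1)) (ext_bnd D M (d%:Z - 1) d%:Z).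
  have dd : d%:Z < d.+1%:Z by lia.
  exact: (@ext_noeth R D R_noeth dualizing_inj dualizing_fg dualizing_neg d.+1 _ M dd M_fg).
have [s [_ sP]] := noethq_fg ext_fg (@ext_bnd_cyc _ _ _ _ _ _).
have kl k : linear_pred (fun h : hom_mod M (D d%:Z) =>
    ext_bnd D M (d%:Z - 1) d%:Z (x ^+ k *: h)).
  split; first by rewrite scaler0; exact: submod0.
  move=> r u v ub vb; rewrite scalerDr scalerA mulrC -scalerA.
  exact: (submod_linear (ext_bnd D M (d%:Z - 1) d%:Z)).2.
have [k ks] : exists k, forall h, h \in s ->
    ext_bnd D M (d%:Z - 1) d%:Z (x ^+ k *: h).
  elim: s {sP} => [|h s [k kP]]; first by exists 0%N.
  have [n hn] := hom_bounded h.
  exists (k + n)%N => z; rewrite in_cons => /orP [/eqP ->|/kP zk].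
    by rewrite exprD -scalerA hn scaler0; exact: submod0.
  by rewrite exprD mulrC -scalerA; apply: submodZ.
have xk_lin : linear (fun z : M => x ^+ k *: z).
  by move=> r y z; rewrite scalerDr !scalerA mulrC.
have [|f' f'E] := inj_factor (u := linear_of xk_lin) (g := f) (dualizing_inj (n := d%:Z)).
  by move=> z /(parameter_regular0 xl) /fT.
have [||g gE] := sP (mk_submodule (kl k)) _ ks (hom_of f') _.
- by move=> h hb; apply: submodZ.
- by move=> z; apply: dualizing_big; rewrite ltzD1.
exists (hom_fun g) => z; rewrite -gE -f'E.
by rewrite -[RHS]/(x ^+ k *: f' z) -linearZZ.
Qed.

End Lifting.
End NormalizedDualizing.

(** * The dagger complex *)

Section CohomologyLift.
Variables (R : comNzRingType) (X : complex R).

Lemma coh_lift (n : int) (L : lmodType R) (g : {linear X n -> L}) :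
  (forall x, bnd X (n - 1) n x -> g x = 0) ->
  exists h : {linear cohomology X n -> L},
    forall z c, @reps R X n z c -> h c = g z.
Proof.
move=> gb.
have g0 z : boundaries X n z -> (g \o val_lin (cycles X n) : {linear _ -> _}) z = 0.
  by move=> [y yE]; apply: gb; exists y.
by exists (quot_lift g0) => z c [zc ->]; rewrite quot_liftE.
Qed.

Lemma coh_extend (n : int) (E : lmodType R) (h : {linear cohomology X n -> E}) :
  injective_mod E -> exists g : {linear X n -> E},
    (forall z c, @reps R X n z c -> g z = h c) /\
    (forall x, bnd X (n - 1) n x -> g x = 0).
Proof.
move=> E_inj.
have [g gP] := inj_extend (h \o quot_pi (boundaries X n) : {linear _ -> _}) E_inj.
have gE z c : @reps R X n z c -> g z = h c by move=> [zc ->]; exact: (gP (mk_subm zc)).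
exists g; split=> // x xb; have [w xw] := repsE (bnd_cyc (n + 1) xb).
by rewrite (gE _ _ xw) (reps0 xw).2 ?linear0.
Qed.

End CohomologyLift.

Section HomComplexValues.
Variables (R : comNzRingType) (X Y : complex R).

Definition hv n (f : hom_complex X Y n) (p q : int) : {linear X p -> Y q} :=
  hom_fun (val f (p, q)).

Definition sg (n : int) : R := (-1) ^+ absz n.

Lemma sgK n : sg n * sg n = 1.
Proof. by rewrite /sg -exprMn mulN1r opprK expr1n. Qed.

Lemma sg_scaleK (M : lmodType R) n (y : M) : sg n *: (sg n *: y) = y.
Proof. by rewrite scalerA sgK scale1r. Qed.

Lemma hvP n r (f g : hom_complex X Y n) p q x :
  hv (r *: f + g) p q x = r *: hv f p q x + hv g p q x.
Proof. by []. Qed.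

Lemma hvD n (f g : hom_complex X Y n) p q x :
  hv (f + g) p q x = hv f p q x + hv g p q x.
Proof. by []. Qed.

Lemma hvB n (f g : hom_complex X Y n) p q x :
  hv (f - g) p q x = hv f p q x - hv g p q x.
Proof. by []. Qed.

Lemma hv0 n p q x : hv (0 : hom_complex X Y n) p q x = 0.
Proof. by []. Qed.

Lemma hv_supp n (f : hom_complex X Y n) p q x : q <> p + n -> hv f p q x = 0.
Proof. by move=> pq; rewrite /hv (submP f). Qed.

Lemma hv_eq n (f g : hom_complex X Y n) :
  (forall p q x, q = p + n -> hv f p q x = hv g p q x) -> f = g.
Proof.
move=> fg; apply: val_inj; apply: functional_extensionality_dep => -[p q].
apply: hom_modP => x; have [pq|/eqP pq] := eqVneq q (p + n); first exact: fg.
by rewrite -![LHS]/(hv f p q x) -![RHS]/(hv g p q x) !hv_supp.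
Qed.

Lemma hv_diff n n' (f : hom_complex X Y n) p p' q q' x :
  n' = n + 1 -> p' = p + 1 -> q = q' + 1 ->
  hv (cdiff (hom_complex X Y) n n' f) p q x =
  cdiff Y q' q (hv f p q' x) - sg n *: hv f p' q (cdiff X p p' x).
Proof.
move=> -> -> qE; have -> : q' = q - 1 by rewrite qE addrK.
by rewrite /hv [val _]/= eqxx.
Qed.

Lemma hom_cyc n (f : hom_complex X Y n) :
  (forall p p' q q' x, p' = p + 1 -> q = q' + 1 -> q = p' + n ->
    cdiff Y q' q (hv f p q' x) = sg n *: hv f p' q (cdiff X p p' x)) ->
  cyc (hom_complex X Y) n (n + 1) f.
Proof.
move=> fc; apply: hv_eq => p q x pq; rewrite hv0.
rewrite (hv_diff f (p' := p + 1) (q' := q - 1)) ?subrK //.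
by rewrite (fc p (p + 1)) ?subrK ?subrr // pq; lia.
Qed.

Lemma cyc_hom n (f : hom_complex X Y n) p p' q q' x :
  cyc (hom_complex X Y) n (n + 1) f -> p' = p + 1 -> q = q' + 1 ->
  cdiff Y q' q (hv f p q' x) = sg n *: hv f p' q (cdiff X p p' x).
Proof.
move=> fc pE qE; apply/eqP; rewrite -subr_eq0 -(hv_diff (n' := n + 1)) //.
by rewrite [cdiff _ _ _ _]fc hv0.
Qed.

Lemma hom_single n p0 q0 (u : {linear X p0 -> Y q0}) : q0 = p0 + n ->
  exists f : hom_complex X Y n, (forall x, hv f p0 q0 x = u x) /\
    forall p q x, q <> q0 -> hv f p q x = 0.
Proof.
move=> q0E.
pose F : hom_family X Y := fun pq => if pq =P (p0, q0) is ReflectT e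
  then ecast pq (hom_mod (X pq.1) (Y pq.2)) (esym e) (hom_of u) else 0.
have F0 p q : (p, q) <> (p0, q0) -> F (p, q) = 0.
  by rewrite /F; case: eqP.
have Fs : hom_complex_subm X Y n F.
  by move=> p q pq; apply: F0 => -[pE qE]; apply: pq; rewrite pE qE.
exists (mk_subm Fs); split=> [x|p q x qq0].
  rewrite /hv [val _]/= /F; case: eqP => // e.
  by rewrite (eq_irrelevance (esym e) erefl).
by rewrite /hv [val _]/= F0 // => -[_].
Qed.

End HomComplexValues.

(** * H^n(Hom(X, D)) as an extension *)

Section Dagger.
Variables (R : comNzRingType) (m : ideal R) (D X : complex R).
Variables (a b n e e1 : int).
Hypotheses (aE : a = b + 1) (eE : e = e1 + 1) (nE : e = a + n).
Hypothesis D_inj : forall q, injective_mod (D q).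
Hypothesis D_neg : forall q, q < 0 -> is_zero_mod (D q).
Hypothesis D_big : forall q, e < q -> is_zero_mod (D q).
Hypothesis hom0 : forall p q (f : {linear cohomology X p -> D q}),
  p < 0 -> q < e1 -> forall c, f c = 0.
Hypothesis e1_torsion : forall y, torsion_subm m (D e1) y -> y = 0.
Hypothesis lift : forall f : {linear cohomology X a -> D e},
  (forall t, torsion_subm m (cohomology X a) t -> f t = 0) ->
  exists g : {linear cohomology X a -> D e1},
    forall z, f z = cdiff D e1 e (g z).

Local Notation H := (dagger D X).
Local Notation hv := (@hv R X D _).

Definition normal k (f : H k) := forall p q x, q < e1 -> hv f p q x = 0.

(** The components into D^t are removed one t at a time. With D^(t-1) already cleared, the component
    on X^p kills coboundaries, so it induces a map H^p(X) -> D^t, which is 0 by [hom0]; it therefore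
    factors through the differential of X and can be subtracted as a coboundary. Only the
    differential of f has to be normal, so that the lemma also applies to a cochain whose coboundary
    is a normal cocycle. *)
Lemma normalize k (f : H k) : e1 <= k ->
  normal (cdiff H k (k + 1) f) ->
  exists g : H (k - 1), normal (f - cdiff H (k - 1) k g).
Proof.
move=> ek df.
suff main (t : nat) : t%:Z <= e1 -> exists g : H (k - 1),
    forall p q x, q < t%:Z -> hv (f - cdiff H (k - 1) k g) p q x = 0.
  have [e1_neg|e1_pos] := ltP e1 0.
    by exists 0 => p q x qe; apply: D_neg; apply: lt_trans qe e1_neg.
  have [|g gP] := main `|e1|%N; first by rewrite gez0_abs.
  by exists g => p q x qe; apply: gP; rewrite gez0_abs.
elim: t => [|t IHt] te.
  by exists 0 => p q x q0; apply: D_neg.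
have [|g gP] := IHt; first by lia.
pose f' := f - cdiff H (k - 1) k g; pose p := t%:Z - k.
have uE x : hv f' p t%:Z (cdiff X (p - 1) p x) = 0.
  have : hv (cdiff H k (k + 1) f') (p - 1) t%:Z x = 0.
    by rewrite /f' linearB cdiff_comp subr0; apply: df; lia.
  rewrite (hv_diff f' (p' := p) (q' := t%:Z - 1)) ?subrK //.
  rewrite gP ?linear0 ?sub0r; last by lia.
  move/eqP; rewrite oppr_eq0 => /eqP s0.
  by rewrite -[LHS](sg_scaleK k) s0 scaler0.
have [h hE] := coh_lift (g := hv f' p t%:Z) (fun x '(ex_intro y yE) =>
  etrans (congr1 _ (esym yE)) (uE y)).
have [z zc|w wE] := inj_factor (u := cdiff X p (p + 1)) (g := hv f' p t%:Z) (@D_inj _).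
  have [c zc'] := repsE zc; rewrite -(hE _ _ zc') hom0 //; rewrite /p; lia.
(* The sign makes the component of d g' on X^p equal to w composed with the differential of X, that
   is, to f'. All other components into D^q with q <= t are unaffected. *)
have [|g' [g'E g'0]] := @hom_single R X D (k - 1) (p + 1) t%:Z
  (- sg R (k - 1) \*: w : {linear _ -> _}); first by rewrite /p; lia.
exists (g + g') => p' q x qt.
rewrite linearD opprD addrA -/f' hvB.
rewrite (hv_diff g' (p' := p' + 1) (q' := q - 1)) ?subrK // g'0; last by lia.
rewrite linear0 sub0r opprK.
have [qE|/eqP qE] := eqVneq q t%:Z; last first.
  by rewrite g'0 // scaler0 addr0 gP //; lia.
rewrite qE; have [pE|/eqP pE] := eqVneq p' p; last first.
  by rewrite !hv_supp ?scaler0 ?addr0 //; rewrite /p in pE; lia.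
move: x; rewrite pE => x; rewrite g'E /= wE scaleNr scalerN sg_scaleK subrr //.
Qed.

Let T := subm (torsion_subm m (cohomology X a)).

Hypothesis e1n : e1 < n.

Lemma cocycle_kills_bnd (f : H n) p q : cyc H n (n + 1) f ->
  (forall x, hv f (p - 1) (q - 1) x = 0) ->
  forall x, bnd X (p - 1) p x -> hv f p q x = 0.
Proof.
move=> fc f0 _ [y <-].
have := cyc_hom (p := p - 1) (p' := p) (q := q) (q' := q - 1) y fc.
rewrite !subrK f0 linear0 => /(_ erefl erefl)/esym s0.
by rewrite -[LHS](sg_scaleK n) s0 scaler0.
Qed.

Lemma reps_normalize (w : cohomology H n) :
  exists2 f : H n, reps f w & normal f.
Proof.
have [f fw fc] := reps_ex w.
have [||g gn] := @normalize n f; first exact: ltW.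
  by move=> p q x _; rewrite [cdiff _ _ _ _]fc.
exists (f - cdiff H (n - 1) n g) => //.
have gb : bnd H (n - 1) n (cdiff H (n - 1) n g) by exists g.
have [w' gw] := repsE (bnd_cyc (n + 1) gb).
have -> : w = w - w' by rewrite ((reps0 gw).2 gb) subr0.
exact: linear_relB (reps_linear H n) fw gw.
Qed.

Lemma normal_bnd (f : H n) : normal f -> bnd H (n - 1) n f ->
  exists2 g : H (n - 1), normal g & cdiff H (n - 1) n g = f.
Proof.
move=> fn [g gf].
have [||h hn] := @normalize (n - 1) g; first by lia.
  by rewrite subrK gf.
by exists (g - cdiff H (n - 1 - 1) (n - 1) h) => //; rewrite linearB cdiff_comp subr0.
Qed.

Lemma hv_diff1 (g : H (n - 1)) p p' q q' x : p' = p + 1 -> q = q' + 1 ->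
  hv (cdiff H (n - 1) n g) p q x =
  cdiff D q' q (hv g p q' x) - sg R (n - 1) *: hv g p' q (cdiff X p p' x).
Proof. by move=> pE qE; apply: hv_diff => //; rewrite subrK. Qed.

(* The edge map to [Hom(H^b(X), D^e1)], read off a cocycle with vanishing
   components in [D^q] for [q < e1]. *)
Definition edge_rel (w : cohomology H n) (k : hom_mod (cohomology X b) (D e1)) :=
  exists f : H n, [/\ reps f w, normal f
    & forall z c, @reps R X b z c -> hom_fun k c = hv f b e1 z].

Lemma edge_rel_linear : linear_rel edge_rel.
Proof.
split.
  exists 0; split=> //; first exact: (reps_linear H n).1.
move=> r w w' k k' [f [fw fn fk]] [f' [fw' fn' fk']].
exists (r *: f + f'); split.
- exact: (reps_linear H n).2.
- by move=> p q x qe; rewrite hvP fn // fn' // scaler0 addr0.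
- by move=> z c zc; rewrite hvP -(fk _ _ zc) -(fk' _ _ zc).
Qed.

Lemma edge_rel_total w : exists k, edge_rel w k.
Proof.
have [f fw fn] := reps_normalize w.
have [x xb|k kE] := coh_lift (g := hv f b e1) _.
  apply: (cocycle_kills_bnd (reps_cyc fw)) xb => y; apply: fn; lia.
by exists (hom_of k), f; split=> // z c /kE.
Qed.

(** A normal coboundary is the coboundary of a normal g. On a cocycle z of X the differential of g
    has only the contribution through D^(e1 - 1), where g vanishes. *)
Lemma edge_rel_fun k : edge_rel 0 k -> k = 0.
Proof.
move=> [f [fw fn fk]]; have [g gn gf] := normal_bnd fn ((reps0 fw).1 erefl).
apply: hom_modP => c; have [z zc zcyc] := reps_ex c.
rewrite (fk _ _ zc) -gf (hv_diff1 g (p' := a) (q' := e1 - 1)) ?subrK //.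
rewrite gn ?linear0; last by lia.
by rewrite aE [cdiff _ _ _ z]zcyc linear0 scaler0 subr0.
Qed.

Lemma edge_rel_cyc w k : edge_rel w k ->
  forall c, cdiff D e1 e (hom_fun k c) = 0.
Proof.
move=> [f [fw fn fk]] c; have [z zc zcyc] := reps_ex c.
rewrite (fk _ _ zc) (cyc_hom (p' := a) _ (reps_cyc fw)) //.
by rewrite aE [cdiff _ _ _ z]zcyc linear0 scaler0.
Qed.

(** Extend k to g on X^b. Its composite with the differential of D kills cocycles, hence factors
    through X^b -> X^a as h. The pair formed by g and h, up to sign, is a cocycle because D vanishes
    above e. *)
Lemma edge_rel_surj k : (forall c, cdiff D e1 e (hom_fun k c) = 0) ->
  exists w, edge_rel w k.
Proof.
move=> kc; have [g [gE g0]] := coh_extend (hom_fun k) (@D_inj e1).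
have [z zc|h hE] := inj_factor (u := cdiff X b a)
    (g := cdiff D e1 e \o g : {linear _ -> _}) (@D_inj e).
  rewrite aE in zc; have [c zc'] := repsE zc.
  by rewrite /= (gE _ _ zc') kc.
have [|f1 [f1E f10]] := @hom_single R X D n b e1 g; first by lia.
have [|f2 [f2E f20]] := @hom_single R X D n a e (sg R n \*: h : {linear _ -> _}).
  by lia.
pose f := f1 + f2.
have fb x : hv f b e1 x = g x by rewrite hvD f1E f20 ?addr0 //; lia.
have fa x : hv f a e x = sg R n *: h x by rewrite hvD f2E f10 ?add0r //; lia.
have f0 p q x : q <> e1 -> q <> e -> hv f p q x = 0.
  by move=> qe1 qe; rewrite hvD f10 // f20 // addr0.
have fc : cyc H n (n + 1) f.
  apply: hom_cyc => p p' q q' x pE qE pq.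
  have [qe|/eqP qe] := eqVneq q e.
    have [pb pa qe1] : [/\ p = b, p' = a & q' = e1] by split; lia.
    move: x; rewrite pb pa qe1 qe => x.
    by rewrite fb fa hE sg_scaleK.
  have [qe1|/eqP qe1] := eqVneq q e1.
    have [pb pb1] : p' = b /\ p = b - 1 by split; lia.
    move: x; rewrite pb pb1 qe1 => x.
    rewrite f0 ?linear0; [|lia|lia]; rewrite fb g0 ?scaler0 //.
    by exists x.
  rewrite [hv f p' q _]f0 // scaler0.
  have [qe'|/eqP qe'] := eqVneq q' e; last by rewrite f0 ?linear0 //; lia.
  by apply: D_big; lia.
have [w fw] := repsE fc; exists w, f; split=> //.
  by move=> p q x qe; rewrite f0 //; lia.
by move=> z c zc; rewrite fb (gE _ _ zc).
Qed.


(* The class in [H^n] of a map [T -> D^e] on the torsion [T] of [H^a(X)]. *)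
Definition top_rel (k : hom_mod T (D e)) (w : cohomology H n) :=
  exists f : H n, [/\ reps f w, forall p q x, q <> e -> hv f p q x = 0
    & forall z t, @reps R X a z (val t) -> hom_fun k t = hv f a e z].

Lemma top_rel_linear : linear_rel top_rel.
Proof.
split.
  exists 0; split=> //; first exact: (reps_linear H n).1.
move=> r k k' w w' [f [fw fn fk]] [f' [fw' fn' fk']].
exists (r *: f + f'); split.
- exact: (reps_linear H n).2.
- by move=> p q x qe; rewrite hvP fn // fn' // scaler0 addr0.
- by move=> z c zc; rewrite hvP -(fk _ _ zc) -(fk' _ _ zc).
Qed.

Lemma top_rel_total k : exists w, top_rel k w.
Proof.
have [k' k'E] := inj_extend (hom_fun k) (@D_inj e).
have [g [gE g0]] := coh_extend k' (@D_inj e).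
have [|f [fE f0]] := @hom_single R X D n a e g; first by lia.
have fc : cyc H n (n + 1) f.
  apply: hom_cyc => p p' q q' x pE qE pq.
  have [qe|/eqP qe] := eqVneq q e.
    have [pa pa1] : p' = a /\ p = a - 1 by split; lia.
    move: x; rewrite pa pa1 qe => x.
    rewrite f0 ?linear0; last by lia.
    by rewrite fE g0 ?scaler0 //; exists x.
  rewrite [hv f p' q _]f0 // scaler0.
  have [qe'|/eqP qe'] := eqVneq q' e; last by rewrite f0 ?linear0 //; lia.
  by apply: D_big; lia.
have [w fw] := repsE fc; exists w, f; split=> //.
by move=> z t zt; rewrite fE (gE _ _ zt) k'E.
Qed.

(** A cocycle concentrated in D^e and killing T induces a map on H^a(X) that lifts to D^e1 by
    [lift]. The lift, extended to X^a, and a correction on X^(a+1) form a cochain with coboundary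
    f. *)
Lemma top_rel_fun w : top_rel 0 w -> w = 0.
Proof.
move=> [f [fw f0 fk]]; apply/(reps0 fw).
have fc := reps_cyc fw.
have [x xb|k kE] := coh_lift (g := hv f a e) _.
  by apply: (cocycle_kills_bnd fc) xb => y; apply: f0; lia.
have [t tT|psi psiE] := lift (f := k).
  have [z zt _] := reps_ex t; rewrite (kE _ _ zt).
  by rewrite -(fk z (mk_subm (tT : torsion_subm m _ t)) zt).
have [h [hE h0]] := coh_extend psi (@D_inj e1).
have [z zc|h' h'E] := inj_factor (u := cdiff X a (a + 1))
    (g := hv f a e \- (cdiff D e1 e \o h) : {linear _ -> _}) (@D_inj e).
  have [c zc'] := repsE zc.
  by rewrite /= (hE _ _ zc') -psiE (kE _ _ zc') subrr.
have [|g1 [g1E g10]] := @hom_single R X D (n - 1) a e1 h; first by lia.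
have [|g2 [g2E g20]] := @hom_single R X D (n - 1) (a + 1) e
  (- sg R (n - 1) \*: h' : {linear _ -> _}); first by lia.
exists (g1 + g2); apply: hv_eq => p q x pq.
rewrite (hv_diff1 _ (p' := p + 1) (q' := q - 1)) ?subrK // !hvD.
have [qe|/eqP qe] := eqVneq q e.
  have [pa qe1] : p = a /\ q - 1 = e1 by split; lia.
  move: x; rewrite qe1 pa qe => x.
  rewrite g1E g20 ?addr0; last by lia.
  rewrite [hv g1 _ _ _]g10 ?add0r; last by lia.
  by rewrite g2E /= h'E scaleNr scalerN sg_scaleK opprK /= addrC subrK.
rewrite [RHS]f0 // [hv g2 (p + 1) q _]g20 // addr0.
have [qe1|/eqP qe1] := eqVneq q e1.
  have pa : p + 1 = a by lia.
  have pa1 : p = a - 1 by lia.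
  move: x; rewrite pa pa1 qe1 => x.
  rewrite g10 ?g20 ?add0r ?linear0; [|lia|lia].
  by rewrite g1E h0 ?scaler0 ?subr0 //; exists x.
rewrite [hv g1 (p + 1) q _]g10 // scaler0 subr0.
have [qe'|/eqP qe'] := eqVneq (q - 1) e; first by apply: D_big; lia.
by rewrite g10 ?g20 ?add0r ?linear0 //; lia.
Qed.

(** If f is a coboundary, then on cocycles of X^a it factors through a map H^a(X) -> D^e1, and such
    a map kills T because D^e1 has no m-torsion. *)
Lemma top_rel_inj k : top_rel k 0 -> k = 0.
Proof.
move=> [f [fw f0 fk]].
have fn : normal f by move=> p q x qe; apply: f0; lia.
have [g gn gf] := normal_bnd fn ((reps0 fw).1 erefl).
have gb x : bnd X (a - 1) a x -> hv g a e1 x = 0.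
  have -> : a - 1 = b by lia.
  move=> [y <-].
  have : hv (cdiff H (n - 1) n g) b e1 y = 0 by rewrite gf f0 //; lia.
  rewrite (hv_diff1 g (p' := a) (q' := e1 - 1)) ?subrK // gn; last by lia.
  rewrite linear0 sub0r => /eqP; rewrite oppr_eq0 => /eqP s0.
  by rewrite -[LHS](sg_scaleK (n - 1)) s0 scaler0.
have [h hE] := coh_lift gb.
apply: hom_modP => t; have [z zt zc] := reps_ex (val t).
rewrite (fk _ _ zt) -gf (hv_diff1 g (p' := a + 1) (q' := e1)) //.
rewrite [cdiff X _ _ z]zc linear0 scaler0 subr0 -(hE _ _ zt).
rewrite (_ : h (val t) = 0) ?linear0 //; apply: e1_torsion.
have [k0 k0P] := submP t; by exists k0 => r rk; rewrite -linearZZ k0P // linear0.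
Qed.

Lemma top_edge k w : top_rel k w -> edge_rel w 0.
Proof.
move=> [f [fw f0 fk]]; exists f; split=> //.
  by move=> p q x qe; apply: f0; lia.
by move=> z c zc; rewrite f0 //; lia.
Qed.

(** With zero edge the component on X^b kills cocycles, so it extends through the differential X^b
    -> X^a; subtracting the coboundary of that extension leaves a cocycle concentrated in D^e. *)
Lemma edge_top w : edge_rel w 0 -> exists k, top_rel k w.
Proof.
move=> [f [fw fn fk]].
have [z zc|h hE] := inj_factor (u := cdiff X b a) (g := hv f b e1) (@D_inj e1).
  rewrite aE in zc; have [c zc'] := repsE zc.
  by rewrite -(fk _ _ zc').
have [|g [gE g0]] := @hom_single R X D (n - 1) a e1
  (- sg R (n - 1) \*: h : {linear _ -> _}); first by lia.
pose f' := f - cdiff H (n - 1) n g.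
have gb : bnd H (n - 1) n (cdiff H (n - 1) n g) by exists g.
have [w' gw] := repsE (bnd_cyc (n + 1) gb).
have fw' : reps f' w.
  have -> : w = w - w' by rewrite ((reps0 gw).2 gb) subr0.
  exact: linear_relB (reps_linear H n) fw gw.
have f'0 p q x : q <> e -> hv f' p q x = 0.
  move=> qe; have [pq|pq] := pselect (q = p + n); last by rewrite hv_supp.
  rewrite hvB (hv_diff1 g (p' := p + 1) (q' := q - 1)) ?subrK //.
  have [eq|qe'] := ltP e q; first by apply: D_big.
  rewrite [hv g p _ _]g0 ?linear0 ?sub0r ?opprK; last by lia.
  have [qe1|/eqP qe1] := eqVneq q e1; last first.
    by rewrite g0 // scaler0 addr0 fn //; lia.
  have [pb pa] : p = b /\ p + 1 = a by split; lia.
  move: x; rewrite pa pb qe1 => x.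
  by rewrite gE /= hE scaleNr scalerN sg_scaleK subrr.
have [x xb|k kE] := coh_lift (g := hv f' a e) _.
  by apply: (cocycle_kills_bnd (reps_cyc fw')) xb => y; apply: f'0; lia.
exists (hom_of (k \o val_lin (torsion_subm m _) : {linear _ -> _})), f'.
by split=> // z t zt; rewrite -(kE _ _ zt).
Qed.

Lemma dagger_exact :
  exists (iota : {linear hom_mod T (D e) -> cohomology H n})
         (pi : {linear cohomology H n -> hom_mod (cohomology X b) (D e1)}),
    [/\ forall k, iota k = 0 -> k = 0,
        forall w, pi w = 0 <-> exists k, iota k = w
      & forall k, (exists w, pi w = k) <->
          forall c, cdiff D e1 e (hom_fun k c) = 0].
Proof.
have [iota iotaP] := linear_choice top_rel_linear top_rel_total top_rel_fun.
have [pi piP] := linear_choice edge_rel_linear edge_rel_total edge_rel_fun.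
exists iota, pi; split.
- by move=> k k0; apply: top_rel_inj; apply/iotaP.
- move=> w; split=> [w0|[k kw]].
    by have [|k /iotaP ->] := @edge_top w; [apply/piP | exists k].
  by apply/esym/piP/top_edge/iotaP/esym/kw.
- move=> k; split=> [[w wk]|kc]; first by apply: (@edge_rel_cyc w); apply/piP.
  by have [w /piP ->] := edge_rel_surj kc; exists w.
Qed.

End Dagger.

(** * Local cohomology and duality *)

Section Resolutions.
Variable R : comNzRingType.

Lemma reps_map (X Y : complex R) (f : chain_map X Y) n z c :
  @reps R X n z c -> reps (f n z) (cohomology_map f n c).
Proof.
move=> [zc ->]; exists (cycles_map f zc); rewrite quot_liftE /=.
by congr (quot_pi _ _); apply: val_inj.
Qed.

Lemma torsion_map (m : ideal R) (M N : lmodType R) (f : {linear M -> N}) y :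
  torsion_subm m M y -> torsion_subm m N (f y).
Proof. by move=> [k yk]; exists k => r /yk ry; rewrite -linearZZ ry linear0. Qed.

Definition stalk_elt (M : lmodType R) (z : M) : stalk M 0 :=
  mk_subm ((fun h => match h erefl with end) : stalk_subm M 0 z).

Fact stalk_elt_linear M : linear (@stalk_elt M).
Proof. by move=> r y z; apply: val_inj. Qed.

Lemma stalk_elt_reps (M : lmodType R) (z : M) : exists c, reps (stalk_elt z) c.
Proof. by apply: repsE. Qed.

Section Augmentation.
Variables (M : lmodType R) (J : complex R).
Hypothesis J_res : injective_resolution M J.

Lemma resolution_aug : exists aug : {linear M -> J 0},
  [/\ forall z, aug z = 0 -> z = 0,
      forall y, cdiff J 0 1 y = 0 <-> exists z, aug z = y
    & forall c, cdiff J 1 (1 + 1) c = 0 -> exists y, cdiff J 0 1 y = c].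
Proof.
have [J_inj J_neg [f f_qi]] := J_res.
exists (f 0 \o linear_of (@stalk_elt_linear M) : {linear _ -> _}); split.
- move=> z fz0; have [c zc] := stalk_elt_reps z.
  have c0 : c = 0.
    apply: (bij_inj (f_qi 0)); rewrite linear0.
    by apply/(reps0 (reps_map f zc)); exists 0; rewrite linear0; apply/esym/fz0.
  have [y /(congr1 val) /= <-] := (reps0 zc).1 c0.
  by [].
- move=> y; split=> [y0|[z <-]]; last by rewrite /= -cmap_comm [cdiff _ _ _ _](_ : _ = 0) ?linear0.
  have [w yw] : exists w, @reps R J 0 y w by apply: repsE.
  have [g _ gK] := f_qi 0; have [s sc _] := reps_ex (g w).
  have := linear_relB (reps_linear J 0) yw (reps_map f sc).
  rewrite gK subrr => /reps0 [/(_ erefl) [u uE] _].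
  exists (val s); move: uE; rewrite [u]J_neg // linear0 => /esym/eqP.
  rewrite subr_eq0 => /eqP ->; congr (f 0 _); exact: val_inj.
- move=> c c0; have [w cw] : exists w, @reps R J 1 c w by apply: repsE.
  have [g _ gK] := f_qi 1; have [s sc _] := reps_ex (g w).
  have s0 : s = 0 by apply: val_inj; apply: (submP s).
  have w0 : w = 0.
    by rewrite -(gK w) (_ : g w = 0) ?linear0 //; apply/(reps0 sc); rewrite s0; exact: submod0.
  by have [y yE] := (reps0 cw).1 w0; exists y.
Qed.

End Augmentation.

Lemma local_cohomology0 (m : ideal R) (M A : lmodType R) :
  is_local_cohomology m 0 M A -> mod_iso A (subm (torsion_subm m M)).
Proof.
move=> [J J_res A_iso]; apply: mod_iso_trans A_iso _; apply: mod_iso_sym.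
have [aug [aug0 augK _]] := resolution_aug J_res.
have [_ J_neg _] := J_res.
pose rel (t : subm (torsion_subm m M)) (w : cohomology (torsion_complex m J) 0) :=
  exists2 c, reps c w & val c = aug (val t).
have rel_lin : linear_rel rel.
  split; first by exists 0; [exact: (reps_linear _ 0).1 | rewrite !linear0].
  move=> r t t' w w' [c cw ct] [c' cw' ct']; exists (r *: c + c').
    exact: (reps_linear _ 0).2.
  by rewrite /= ct ct' -linearP.
have rel_inj t : rel t 0 -> t = 0.
  move=> [c cw ct]; have [u uE] := (reps0 cw).1 erefl.
  apply: val_inj; apply: aug0; rewrite -ct -uE.
  by rewrite [u](_ : _ = 0) ?linear0 //; apply: val_inj; apply: J_neg.
have rel_total t : exists w, rel t w.
  have tT := torsion_map aug (submP t).
  have [|w cw] := @repsE R (torsion_complex m J) 0 (mk_subm tT).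
    by apply: val_inj => /=; apply/augK; exists (val t).
  by exists w, (mk_subm tT).
have rel_fun w : rel 0 w -> w = 0.
  move=> [c cw c0]; apply/(reps0 cw); rewrite (_ : c = 0); first exact: submod0.
  by apply: val_inj; rewrite c0 linear0.
have [h hP] := linear_choice rel_lin rel_total rel_fun.
apply: (linear_bij (f := h)) => [t t0|w]; first by apply/rel_inj/hP.
have [c cw cc] := reps_ex w.
have [z zE] := (augK (val c)).1 (congr1 val cc).
have zT : torsion_subm m M z.
  have [k kc] := submP c; exists k => r rk; apply: aug0.
  by rewrite linearZZ zE kc.
by exists (mk_subm zT); apply/esym/hP; exists c.
Qed.

(** The preimage in J of the m-torsion of J / aug(M). *)
Definition sat_subm (m : ideal R) (M J : lmodType R) (aug : {linear M -> J}) :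
  submodule J.
Proof.
apply: (@mk_submodule R J (fun y => exists k, forall r, ideal_pow m k r ->
  exists z, r *: y = aug z)).
split; first by exists 0%N => r _; exists 0; rewrite scaler0 linear0.
move=> s y y' [k ky] [k' ky']; exists (k + k')%N => r rk.
have [z zE] := ky r (ideal_pow_le (leq_addr k' k) rk).
have [z' zE'] := ky' r (ideal_pow_le (leq_addl k k') rk).
exists (s *: z + z'); rewrite linearP -zE -zE' scalerDr !scalerA.
by rewrite mulrC.
Defined.

(** A torsion cocycle of J^1 is d y for some y in J^0, and d y is torsion exactly when a power of m
    carries y into M. Torsion coboundaries come from the torsion of J^0, so H^1_m(M) is the
    saturation of M modulo M plus torsion. *)
Lemma local_cohomology1 (m : ideal R) (M B : lmodType R) :
  is_local_cohomology m 1 M B ->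
  exists (J : lmodType R) (aug : {linear M -> J})
         (la : {linear subm (sat_subm m aug) -> B}),
    [/\ injective_mod J, forall z, aug z = 0 -> z = 0,
        forall b, exists y, la y = b
      & forall y, la y = 0 <-> exists z t, torsion_subm m J t /\ val y = aug z + t].
Proof.
move=> [J J_res [th [th' thK th'K]]].
have [aug [aug0 augK J1]] := resolution_aug J_res.
have [J_inj _ _] := J_res.
pose rel (y : subm (sat_subm m aug)) (b : B) :=
  exists2 c, @reps R (torsion_complex m J) 1 c (th b) & val c = cdiff J 0 1 (val y).
have th0 b : th b = 0 -> b = 0.
  by move=> b0; rewrite -(thK b) b0 -(linear0 th) thK.
have rel_lin : linear_rel rel.
  split.
    by exists 0; [rewrite linear0; exact: (reps_linear _ 1).1 | rewrite !linear0].
  move=> r y y' b b' [c cw cy] [c' cw' cy']; exists (r *: c + c').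
    by rewrite linearP; exact: (reps_linear _ 1).2.
  by rewrite /= cy cy' -linearP.
have rel_total y : exists b, rel y b.
  have yT : torsion_subm m (J 1) (cdiff J 0 1 (val y)).
    have [k ky] := submP y; exists k => r /ky [z zE].
    by rewrite -linearZZ zE; apply/augK; exists z.
  have [|w cw] := @repsE R (torsion_complex m J) 1 (mk_subm yT).
    by apply: val_inj; exact: cdiff_comp.
  by exists (th' w), (mk_subm yT); rewrite ?th'K.
have rel_fun b : rel 0 b -> b = 0.
  move=> [c cw c0]; apply: th0; apply/(reps0 cw).
  rewrite (_ : c = 0); first exact: submod0.
  by apply: val_inj; rewrite c0 linear0.
have [la laP] := linear_choice rel_lin rel_total rel_fun.
exists (J 0), aug, la; split=> // [b|y].
  have [c cw cc] := reps_ex (th b).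
  have [y yE] := J1 (val c) (congr1 val cc).
  have yL : sat_subm m aug y.
    have [k kc] := submP c; exists k => r rk.
    have [|z zE] := (augK (r *: y)).1; first by rewrite linearZZ yE kc.
    by exists z.
  by exists (mk_subm yL); apply/esym/laP; exists c.
split=> [y0|[z [t [tT yE]]]].
  have /laP [c cw cy] := esym y0.
  have [t tE] := (reps0 cw).1 (linear0 th).
  have [|z zE] := (augK (val y - val t)).1.
    by rewrite linearB -cy -tE subrr.
  by exists z, (val t); split; [exact: (submP t) | rewrite zE subrK].
apply/esym/laP; have tT' := torsion_map (cdiff J 0 1) tT.
have cb : bnd (torsion_complex m J) (1 - 1) 1 (mk_subm tT').
  by exists (mk_subm tT); apply: val_inj.
have [w cw] := repsE (bnd_cyc (1 + 1) cb).
exists (mk_subm tT'); first by rewrite linear0 -((reps0 cw).2 cb).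
rewrite yE linearD [X in _ = X + _](_ : _ = 0) ?add0r //.
by apply/augK; exists z.
Qed.

End Resolutions.

(** * Pairing of Ker(Hom(N, F) -> Hom(N, G)) with H^1_m(N) *)

Section LocalDuality.
Variables (R : comNzRingType) (m : ideal R) (N F G : lmodType R).
Variables (delta : {linear F -> G}) (x : R) (l : nat).
Hypothesis R_noeth : noetherian_ring R.
Hypothesis N_fg : fg_mod N.
Hypothesis mx : m x.
Hypothesis xl : ideal_pow m l `<=` ideal_add (ann_ideal N) x.
Hypothesis F_inj : injective_mod F.
Hypothesis G_inj : injective_mod G.
Hypothesis F_torsion : forall y, torsion_subm m F y -> y = 0.
Hypothesis lift : forall f : {linear N -> G},
  (forall t, torsion_subm m N t -> f t = 0) ->
  exists g : {linear N -> F}, forall z, f z = delta (g z).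

Variables (J B : lmodType R) (aug : {linear N -> J}).
Local Notation L := (sat_subm m aug).
Variable la : {linear subm L -> B}.
Hypothesis J_inj : injective_mod J.
Hypothesis aug0 : forall z, aug z = 0 -> z = 0.
Hypothesis la_surj : forall b, exists y, la y = b.
Hypothesis la0 : forall y, la y = 0 <->
  exists z t, torsion_subm m J t /\ val y = aug z + t.

Fact hom_kernel_linear :
  linear_pred (fun k : hom_mod N F => forall z, delta (hom_fun k z) = 0).
Proof.
split=> [z|r k k' k0 k'0 z]; first by rewrite hom_zeroE linear0.
by rewrite hom_linE linearP k0 k'0 scaler0 addr0.
Qed.

Definition hom_kernel : submodule (hom_mod N F) := mk_submodule hom_kernel_linear.

Definition pairing_rel (k : subm hom_kernel) (q : hom_mod B G) :=
  exists k' : hom_mod J F, (forall z, hom_fun k' (aug z) = hom_fun (val k) z) /\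
    forall y, hom_fun q (la y) = delta (hom_fun k' (val y)).

(** Two extensions of k to J differ by a map killing N. It sends the saturation into the m-torsion
    of F, which is 0, so the pairing does not depend on the extension. *)
Lemma pairing_exists : exists P : {linear subm hom_kernel -> hom_mod B G},
  forall k q, pairing_rel k q <-> q = P k.
Proof.
apply: linear_choice.
- split; first by exists 0; split=> // y; rewrite !hom_zeroE linear0.
  move=> r k k' q q' [f [fk fq]] [f' [fk' fq']]; exists (r *: f + f'); split=> z.
    by rewrite subm_linE !hom_linE fk fk'.
  by rewrite !hom_linE linearP -fq -fq'.
- move=> k; have [z /aug0 ->|f fE] := inj_factor (u := aug) (g := hom_fun (val k)) F_inj.
    by rewrite linear0.
  have [y /la0 [z [t [tT yE]]]|q qE] := inj_factor (u := la)
      (g := delta \o (f \o val_lin L) : {linear _ -> _}) G_inj.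
    rewrite /= yE linearD fE (F_torsion (torsion_map f tT)) addr0.
    exact: (submP k).
  by exists (hom_of q), (hom_of f).
- move=> q [f [f0 fq]]; apply: hom_modP => b; have [y <-] := la_surj b.
  rewrite fq (_ : hom_fun f (val y) = 0) ?linear0 //; apply: F_torsion.
  have [k ky] := submP y; exists k => r /ky [z zE].
  by rewrite -linearZZ zE f0.
Qed.

(* Division by [x ^+ n] from [N] into its saturation in [J], modulo torsion. *)
Lemma division (n : nat) : exists rho : {linear N -> subm L},
  (forall z, exists2 t, torsion_subm m J t & x ^+ n *: val (rho z) = aug z + t) /\
  (forall z, torsion_subm m N z -> la (rho z) = 0).
Proof.
have [a aT] := torsion_bounded m R_noeth N_fg.
have mulx_lin k : linear (fun z : N => x ^+ k *: z).
  by move=> r y z; rewrite scalerDr !scalerA mulrC.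
(* Since x need not be regular on N, division by x^n is prescribed only after multiplication by x^a:
   x^(a+n) z goes to x^a z, which is well defined because x^a kills the torsion. The error in J is
   then torsion. *)
have [z /(parameter_regular0 xl) zT|h hE] := inj_factor
    (u := linear_of (mulx_lin (a + n)%N))
    (g := aug \o linear_of (mulx_lin a) : {linear _ -> _}) J_inj.
  by rewrite /= aT ?linear0 //; exact: ideal_pow_exp.
have {}hE z : x ^+ a *: (x ^+ n *: h z) = x ^+ a *: aug z.
  by rewrite scalerA -exprD -!linearZZ -[RHS]hE.
have h_ann z r : ann_ideal N r -> r *: h z = 0.
  by move=> rN; rewrite -linearZZ rN linear0.
have hT z : torsion_subm m J (x ^+ n *: h z - aug z).
  apply: (@parameter_torsion _ m N x l xl J _ a 0) => r rN.
    by rewrite scalerBr scalerA mulrC -scalerA h_ann // scaler0 -linearZZ rN linear0 subrr.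
  by rewrite scalerBr hE subrr scaler0.
have hL z : L (h z).
  exists (l * (a + n))%N => r /(ideal_pow_parameter (n := (a + n)%N) xl).
  move=> [s sN [c ->]]; exists (c *: (x ^+ a *: z)).
  rewrite scalerDl h_ann // add0r -scalerA [aug _]linearZZ [aug (_ *: z)]linearZZ.
  by rewrite -hE exprD (scalerA (x ^+ a)).
have rho_lin : linear (fun z => mk_subm (hL z) : subm L).
  by move=> r y z; apply: val_inj; rewrite /= linearP.
exists (linear_of rho_lin); split=> z.
  by exists (x ^+ n *: h z - aug z) => //; rewrite addrC subrK.
move=> zT; apply/la0; exists 0, (h z); rewrite linear0 add0r; split=> //.
have [k kz] : torsion_subm m J (x ^+ n *: h z).
  rewrite -(subrK (aug z) (x ^+ n *: h z)); apply: submodD => //.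
  exact: torsion_map.
by apply: (@parameter_torsion _ m N x l xl J _ n k) => // r; exact: h_ann.
Qed.

(** An element of the saturation need not be killed by ann N, so it is first moved into N by a power
    of m; there x is regular modulo torsion, and m^a kills the torsion. *)
Lemma sat_torsion (u : J) n : L u -> torsion_subm m J (x ^+ n *: u) ->
  torsion_subm m J u.
Proof.
move=> [k ku] uT; have [a aT] := torsion_bounded m R_noeth N_fg.
exists (a + k)%N => t.
have tl : ideal_pred (fun t => t *: u = 0).
  split; first by rewrite scale0r.
  by move=> c v w v0 w0; rewrite scalerDl -scalerA v0 w0 scaler0 addr0.
apply: (ideal_powD (a := mk_ideal tl)) => r s ra sk.
have [z zE] := ku s sk.
rewrite /= -scalerA zE -linearZZ aT ?linear0 //.
apply: (parameter_regular (n := n) xl); have [j ju] := uT.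
exists j => c /ju cu; apply: aug0.
have -> : aug (c *: (x ^+ n *: z)) = s *: (c *: (x ^+ n *: u)).
  rewrite [LHS]linearZZ [aug _]linearZZ -zE !scalerA; congr (_ *: _); ring.
by rewrite cu scaler0.
Qed.

Lemma local_duality : exists P : {linear subm hom_kernel -> hom_mod B G}, forall n,
  (forall q : hom_mod B G, exists k, forall b, x ^+ n *: b = 0 ->
     hom_fun (P k) b = hom_fun q b) /\
  (forall k, (forall b, x ^+ n *: b = 0 -> hom_fun (P k) b = 0) ->
     exists k', k = x ^+ n *: k').
Proof.
have [P PP] := pairing_exists; exists P => n.
have [rho [rhoE rhoT]] := division n.
have la_x y : x ^+ n *: la y = 0 -> exists z t,
    torsion_subm m J t /\ x ^+ n *: val y = aug z + t.
  by rewrite -linearZZ => /la0 [z [t [tT yE]]]; exists z, t.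
have la_rho z : x ^+ n *: la (rho z) = 0.
  rewrite -linearZZ; apply/la0; have [t tT tE] := rhoE z.
  by exists z, t.
split=> [q|k k0].
(* Pulling q back along division by x^n gives a map N -> G that kills torsion and so lifts to psi :
   N -> F. The preimage of q is x^n psi, which delta kills because the divided classes are
   x^n-torsion. *)
- have [z zT|psi psiE] := lift (f := hom_fun q \o (la \o rho) : {linear _ -> _}).
    by transitivity (hom_fun q (la (rho z))) => //; rewrite rhoT // linear0.
  have {}psiE z : hom_fun q (la (rho z)) = delta (psi z) by exact: psiE.
  have kP : hom_kernel (x ^+ n *: hom_of psi).
    move=> z; rewrite hom_scaleE hom_ofE linearZZ -psiE.
    by rewrite -[LHS](linearZZ (hom_fun q)) la_rho linear0.
  exists (mk_subm kP) => b; have [y <-] := la_surj b => /la_x [z [t [tT yE]]].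
  have [w /aug0 ->|psi' psi'E] := inj_factor (u := aug) (g := psi) F_inj.
    by rewrite linear0.
  have [w /aug0 ->|f fE] := inj_factor (u := aug)
      (g := hom_fun (val (mk_subm kP))) F_inj.
    by rewrite linear0.
  have xlin : linear (fun z : J => x ^+ n *: psi' z).
    by move=> r u v; rewrite linearP scalerDr !scalerA mulrC.
  pose q' := P (mk_subm kP).
  have /PP [f' [f'E f'q]] : q' = P (mk_subm kP) by [].
  rewrite -/q' f'q.
  (* f' and x^n psi' both extend x^n psi, so they agree on the saturation. *)
  have -> : hom_fun f' (val y) = x ^+ n *: psi' (val y).
    apply/eqP; rewrite -subr_eq0; apply/eqP/F_torsion.
    have [k ky] := submP y; exists k => r /ky [w wE].
    have e : r *: (x ^+ n *: psi' (val y)) = x ^+ n *: psi w.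
      by rewrite scalerA mulrC -scalerA -(linearZZ psi') wE psi'E.
    rewrite scalerBr e -(linearZZ (hom_fun f')) wE f'E.
    by rewrite hom_scaleE hom_ofE subrr.
  rewrite -linearZZ yE linearD psi'E (F_torsion (torsion_map psi' tT)) addr0.
  rewrite -psiE; apply/eqP; rewrite -subr_eq0 -!linearB; apply/eqP.
  rewrite (_ : la _ = 0) ?linear0 //; apply/la0.
  exists 0, (val (rho z) - val y); rewrite linear0 add0r; split=> //.
  apply: (@sat_torsion _ n).
    by apply: submodB; [exact: (submP (rho z)) | exact: (submP y)].
  have [t' t'T t'E] := rhoE z.
  rewrite scalerBr yE t'E opprD addrACA subrr add0r; exact: submodB.
- have /PP [f [fE fq]] : P k = P k by [].
  (* The quotient of k by x^n is f composed with division; it lies in the kernel because P k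
     vanishes on the divided classes. *)
  have kP : hom_kernel (hom_of (hom_fun f \o (val_lin L \o rho) : {linear _ -> _})).
    by move=> z; rewrite hom_ofE -[delta _]fq; exact: k0.
  exists (mk_subm kP); apply: val_inj; apply: hom_modP => z.
  transitivity (x ^+ n *: hom_fun f (val (rho z))); last by [].
  rewrite -linearZZ; have [t tT ->] := rhoE z.
  by rewrite linearD (F_torsion (torsion_map (hom_fun f) tT)) addr0 fE.
Qed.

Lemma local_cohomology1_torsion (b : B) :
  exists k, forall r, ideal_pow m k r -> r *: b = 0.
Proof.
have [y <-] := la_surj b; have [k ky] := submP y.
exists k => r /ky [z zE]; rewrite -linearZZ; apply/la0; exists z, 0.
by rewrite addr0; split; [exact: submod0 | exact: zE].
Qed.

End LocalDuality.

(** * Completion *)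

Section Completion.
Variables (R : comNzRingType) (m : ideal R) (x : R) (a : nat).
Variables (V W B G : lmodType R).
Variables (iota : {linear V -> W}) (Psi : {linear W -> hom_mod B G}).
Hypothesis mx : m x.
Hypothesis iota0 : forall v, iota v = 0 -> v = 0.
Hypothesis Psi_iota : forall v, Psi (iota v) = 0.
Hypothesis Psi_surj : forall n (q : hom_mod B G), exists w, forall b,
  x ^+ n *: b = 0 -> hom_fun (Psi w) b = hom_fun q b.
Hypothesis Psi_ker : forall n w,
  (forall b, x ^+ n *: b = 0 -> hom_fun (Psi w) b = 0) ->
  exists w' v, w = x ^+ n *: w' + iota v.
Hypothesis iota_sep : forall w v, x ^+ a *: w = iota v -> v = 0.
Local Notation mW k := (ideal_smul (ideal_pow m k) (full_subm W)).
Hypothesis x_adic : forall n, exists k, forall w, mW k w ->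
  exists w', w = x ^+ n *: w'.
Hypothesis B_torsion : forall b : B,
  exists k, forall r, ideal_pow m k r -> r *: b = 0.

Lemma mW_exp n w : mW n (x ^+ n *: w).
Proof. by move=> N; apply; exists (x ^+ n), w; split=> //; exact: ideal_pow_exp. Qed.

Lemma mW_le k n : (k <= n)%N -> mW n `<=` mW k.
Proof.
move=> kn w; apply=> _ [r [y [rn _ ->]]] N; apply.
by exists r, y; split=> //; exact: ideal_pow_le rn.
Qed.

Lemma mW_exp_le k n w : (k <= n)%N -> mW k (x ^+ n *: w).
Proof. by move=> kn; apply: (mW_le kn); exact: mW_exp. Qed.

Lemma Psi_exp n w b : x ^+ n *: b = 0 -> hom_fun (Psi (x ^+ n *: w)) b = 0.
Proof.
move=> xb; rewrite linearZZ hom_scaleE.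
by rewrite -linearZZ xb linear0.
Qed.

Lemma Psi_mW k w b : mW k w -> (forall r, ideal_pow m k r -> r *: b = 0) ->
  hom_fun (Psi w) b = 0.
Proof.
move=> wk kb.
have Pl : linear_pred (fun w => hom_fun (Psi w) b = 0).
  split; first by rewrite linear0.
  move=> r u v u0 v0; rewrite linearP.
  by rewrite hom_linE u0 v0 scaler0 addr0.
apply: (wk (mk_submodule Pl)) => _ [r [y [rk _ ->]]].
change (hom_fun (Psi (r *: y)) b = 0); rewrite linearZZ.
by rewrite hom_scaleE -linearZZ kb // linear0.
Qed.

Lemma completion_lifts (u : completion m W) : exists w : nat -> W,
  (forall k, val u k = quot_pi (mW k) (w k)) /\
  forall k n, (k <= n)%N -> mW k (w n - w k).
Proof.
have /choice [w wE] : forall k, exists w, val u k = quot_pi (mW k) w.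
  by move=> k; exists (pm_repr (val u k)); rewrite -[LHS]pm_reprK.
exists w; split=> // k n /subnK <-; elim: (n - k)%N => [|i IHi].
  by rewrite add0n subrr; exact: submod0.
rewrite addSn -(subrK (w (i + k)%N) (w _)) -addrA; apply: submodD => //.
have [y [y1 y0]] := submP u (i + k)%N.
move: y1 y0; rewrite !wE => /quot_piP y1 /quot_piP y0.
rewrite -(subrK y (w _)) -addrA -[y - _]opprB; apply: submodB.
  by apply: mW_le y1; rewrite leqW // leq_addl.
by apply: mW_le y0; rewrite leq_addl.
Qed.

(** The value at b may be read at any level k with m^k b = 0; there a change of representative
    modulo m^k W is invisible. *)
Definition limit_rel (u : completion m W) (q : hom_mod B G) := forall b k w,
  (forall r, ideal_pow m k r -> r *: b = 0) -> val u k = quot_pi (mW k) w ->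
  hom_fun q b = hom_fun (Psi w) b.

Lemma limit_exists : exists P : {linear completion m W -> hom_mod B G},
  forall u q, limit_rel u q <-> q = P u.
Proof.
apply: linear_choice.
- split=> [b k w kb wE|r u u' q q' uq uq' b k w kb wE].
    have /quot_piP : quot_pi (mW k) w = quot_pi (mW k) 0 by rewrite linear0 -wE.
    by rewrite subr0 => wk; rewrite (Psi_mW wk kb).
  rewrite hom_linE.
  have [v [vE _]] := completion_lifts u; have [v' [vE' _]] := completion_lifts u'.
  rewrite (uq b k (v k) kb (vE k)) (uq' b k (v' k) kb (vE' k)).
  have /quot_piP wk : quot_pi (mW k) (r *: v k + v' k) = quot_pi (mW k) w.
    by rewrite linearP -vE -vE' -wE.
  apply/eqP; rewrite -subr_eq0; apply/eqP; rewrite -(Psi_mW wk kb) linearB linearP.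
  by [].
- move=> u; have [w [wE wC]] := completion_lifts u.
  pose brel b g := exists2 k, forall r, ideal_pow m k r -> r *: b = 0 &
    g = hom_fun (Psi (w k)) b.
  have brel_ge b k n : (k <= n)%N -> (forall r, ideal_pow m k r -> r *: b = 0) ->
      hom_fun (Psi (w n)) b = hom_fun (Psi (w k)) b.
    move=> kn kb; apply/eqP; rewrite -subr_eq0; apply/eqP.
    by rewrite -(Psi_mW (wC k n kn) kb) linearB.
  have brel_lin : linear_rel brel.
    split; first by exists 0%N; [move=> r _; rewrite scaler0 | rewrite linear0].
    move=> r b b' g g' [k kb ->] [k' kb' ->]; exists (k + k')%N.
      move=> s sk; rewrite scalerDr scalerA mulrC -scalerA kb ?kb' ?scaler0 ?addr0 //.
        by apply: ideal_pow_le sk; exact: leq_addl.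
      by apply: ideal_pow_le sk; exact: leq_addr.
    rewrite linearP (brel_ge b k) ?leq_addr // (brel_ge b' k') ?leq_addl //.
  have [q qP] : exists q : {linear B -> G}, forall b g, brel b g <-> g = q b.
    apply: linear_choice => // [b|g [k _ ->]]; last by rewrite linear0.
    by have [k kb] := B_torsion b; exists (hom_fun (Psi (w k)) b), k.
  exists (hom_of q) => b k y kb yE.
  have -> : hom_fun (hom_of q) b = hom_fun (Psi (w k)) b.
    by apply/esym/qP; exists k.
  move: yE; rewrite wE => /quot_piP wy; apply/eqP; rewrite -subr_eq0; apply/eqP.
  by rewrite -(Psi_mW wy kb) linearB.
- move=> q q0; apply: hom_modP => b; have [k kb] := B_torsion b.
  by rewrite (q0 b k 0 kb) ?linear0.
Qed.

Fact const_completion_subproof (v : V) : completion_subm m W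
  (fun n => quot_pi (mW n) (iota v)).
Proof. by move=> n; exists (iota v). Qed.

Definition const_completion (v : V) : completion m W :=
  mk_subm (const_completion_subproof v).

Fact const_completion_linear : linear const_completion.
Proof.
move=> r v v'; apply: val_inj; apply: functional_extensionality_dep => n.
rewrite -[RHS]/(r *: quot_pi (mW n) (iota v) + quot_pi (mW n) (iota v')).
by rewrite -!linearP.
Qed.

Lemma limit_const v : limit_rel (const_completion v) 0.
Proof.
move=> b k w kb /quot_piP wk; apply/esym/eqP; rewrite -oppr_eq0; apply/eqP.
by rewrite -(Psi_mW wk kb) linearB Psi_iota sub0r.
Qed.

(** At each deep level the representative splits as a multiple of x^n plus an element of V. The
    V-part is determined modulo x^a W, and V meets x^a W in 0, so it is the same at all these
    levels. *)
Lemma limit_ker u : limit_rel u 0 -> exists v, const_completion v = u.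
Proof.
move=> u0; have [w [wE wC]] := completion_lifts u.
have /choice [L LP] := x_adic.
have split_w n k : (L n <= k)%N -> exists v y, w k = x ^+ n *: y + iota v.
  move=> nk; have [b xb|y [v wkE]] := @Psi_ker n (w k); last by exists v, y.
  have [j jb] := B_torsion b; pose i := (j + k)%N.
  have jb' r : ideal_pow m i r -> r *: b = 0.
    by move=> /(ideal_pow_le (leq_addr k j)); exact: jb.
  have [|y yE] := LP n (w i - w k).
    by apply: (mW_le nk); apply: wC; exact: leq_addl.
  have := Psi_exp y xb; rewrite -yE linearB.
  by rewrite hom_subE -(u0 b i (w i) jb' (wE i)) sub0r => /eqP; rewrite oppr_eq0 => /eqP.
have [v0 [y0 v0E]] := split_w a (L a) (leqnn _).
exists v0; apply: val_inj; apply: functional_extensionality_dep => j.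
rewrite wE /=; apply/quot_piP.
(* The summand a of n makes x^n y invisible to [iota_sep], and j puts it into m^j W. The three
   summands of k give, in order, the splitting at n, agreement with level L a modulo x^a W, and
   agreement with level j modulo m^j W. *)
pose n := (a + j)%N; pose k := (L n + L a + j)%N.
have [v [y vE]] : exists v y, w k = x ^+ n *: y + iota v.
  by apply: split_w; rewrite /k -addnA leq_addr.
have [|z zE] := LP a (w k - w (L a)).
  by apply: wC; rewrite /k addnAC leq_addl.
have v_eq : v0 = v.
  apply/eqP; rewrite -subr_eq0; apply/eqP/(@iota_sep (x ^+ j *: y - y0 - z)).
  have yE : x ^+ n *: y = w k - iota v by rewrite vE addrK.
  have y0E : x ^+ a *: y0 = w (L a) - iota v0 by rewrite v0E addrK.
  rewrite !scalerBr -zE scalerA -exprD yE y0E [RHS]linearB.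
  by rewrite !opprB -addrA subrKA addrC subrKA.
rewrite v_eq -(subrK (w k) (iota v)) -addrA; apply: submodD.
  rewrite vE opprD addrC subrK -scalerN.
  by apply: mW_exp_le; exact: leq_addl.
by apply: wC; exact: leq_addl.
Qed.

Lemma limit_surj q : exists u, limit_rel u q.
Proof.
have /choice [y yP] := fun n => Psi_surj n q.
have /choice [v vP] : forall n, exists v,
    exists z, y n.+1 - y n - iota v = x ^+ n *: z.
  move=> n; have [b xb|z [v zE]] := @Psi_ker n (y n.+1 - y n).
    rewrite linearB hom_subE.
    by rewrite !yP ?subrr // exprS -scalerA xb scaler0.
  by exists v, z; rewrite zE addrK.
(* Consecutive approximations differ by a multiple of x^n plus an element of V, on which Psi
   vanishes; removing the accumulated V-parts makes the sequence Cauchy. *)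
pose w n := y n - iota (\sum_(i < n) v i).
have wS n : exists z, w n.+1 - w n = x ^+ n *: z.
  have [z zE] := vP n; exists z; rewrite -zE /w big_ord_recr /= linearD.
  by rewrite opprD opprB [X in _ + X + _]addrC !addrA subrK addrAC.
have u_sub : completion_subm m W (fun n => quot_pi (mW n) (w n)).
  move=> n; exists (w n.+1); split=> //; apply/esym/quot_piP.
  by have [z ->] := wS n; exact: mW_exp.
exists (mk_subm u_sub) => b k z kb /quot_piP wz.
transitivity (hom_fun (Psi (w k)) b).
  rewrite /w linearB Psi_iota subr0 yP //; apply: kb; exact: ideal_pow_exp.
apply/eqP; rewrite -subr_eq0; apply/eqP.
by rewrite -(Psi_mW wz kb) [in RHS]linearB.
Qed.

Lemma completion_exact : short_exact V (completion m W) (hom_mod B G).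
Proof.
have [P PP] := limit_exists.
exists (linear_of const_completion_linear), P; split.
- apply: linear_inj => v v0.
  have [k kP] := x_adic a; have [|w wE] := kP (iota v).
    have /quot_piP : quot_pi (mW k) (iota v) = quot_pi (mW k) 0.
      by rewrite linear0 -[LHS]/(val (const_completion v) k) [const_completion v]v0.
    by rewrite subr0.
  exact: (@iota_sep w).
- move=> u; split=> [u0|[v <-]]; last exact/esym/PP/limit_const.
  by apply: limit_ker; apply/PP.
- by move=> q; have [u /PP ->] := limit_surj q; exists u.
Qed.

End Completion.

(** * Free resolutions and the small support *)

(** Recursion on the negative integers with a constant start [t0] in degrees >= 0. The type of the
    stages must not depend on the degree, so data living in a degree is stored in a product over all
    degrees. *)
Lemma int_down_choice (T : Type) (Inv : int -> T -> Prop)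
  (Q : int -> T -> T -> Prop) (t0 : T) :
  (forall n, 0 <= n -> Inv n t0) ->
  (forall n t, n <= 0 -> Inv n t -> exists t', Q n t t' /\ Inv (n - 1) t') ->
  (forall n, 0 < n -> Q n t0 t0) ->
  exists st : int -> T, (forall n, 0 <= n -> st n = t0) /\
    forall n, Q n (st n) (st (n - 1)).
Proof.
move=> Inv0 step Q0.
have /choice [g gP] : forall kt : nat * T, exists t', Inv (- kt.1%:Z) kt.2 ->
    Q (- kt.1%:Z) kt.2 t' /\ Inv (- kt.1.+1%:Z) t'.
  move=> [k t] /=; have [it|nit] := pselect (Inv (- k%:Z) t); last by exists t0.
  have [|t' [qt it']] := step _ _ _ it; first by lia.
  exists t' => _; split=> //; move: it'; congr Inv; lia.
pose s := fix s k := if k is k'.+1 then g (k', s k') else t0.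
have sI k : Inv (- k%:Z) (s k).
  elim: k => [|k IHk]; first exact: Inv0.
  by have [] := gP (k, s k) IHk.
exists (fun n => s (if 0 <= n then 0%N else `|n|%N)).
split=> [n ->|n] //; have [n0|n0] := ltP 0 n.
  by rewrite (ltW n0) (_ : 0 <= n - 1) /=; [exact: Q0 | lia].
have -> : 0 <= n - 1 = false by apply/negbTE; lia.
have nE : n = - `|n|%N%:Z by lia.
have n1E : `|n - 1|%N = `|n|%N.+1 by lia.
have [q _] := gP (`|n|%N, s `|n|%N) (sI _).
rewrite n1E /=; move: q; rewrite /= -nE.
by have [n0'|] := leP 0 n => //; have -> : n = 0 by lia.
Qed.

Lemma prodm_with (R : comNzRingType) (I : Type) (M : I -> lmodType R) (i : I)
  (x : M i) : exists f : prodm M, f i = x.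
Proof.
exists (fun j => if pselect (i = j) is left e then ecast k (M k) e x else 0).
case: pselect => // e; by rewrite (Prop_irrelevance e erefl).
Qed.

Section HomFamily.
Variables (R : comNzRingType) (X Y : complex R).

Lemma hom_of_family n (F : forall p q, {linear X p -> Y q}) :
  exists f : hom_complex X Y n, forall p q x, q = p + n -> hv f p q x = F p q x.
Proof.
pose G : hom_family X Y := fun pq =>
  if pq.2 == pq.1 + n then hom_of (F pq.1 pq.2) else 0.
have Gs : hom_complex_subm X Y n G.
  by move=> p q /eqP/negbTE pq; rewrite /G /= pq.
exists (mk_subm Gs) => p q x /eqP pq.
by rewrite /hv [val _]/= /G /= pq.
Qed.

End HomFamily.

Section FreeExt.
Variable R : comNzRingType.

Definition free_elt k i : subm (free_subm R k) := odflt 0 (insub (free_basis R i)).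

Lemma val_free_elt k i : (i < k)%N -> val (free_elt k i) = free_basis R i.
Proof.
move=> ik; rewrite /free_elt insubT //; apply/asboolP; exact: free_basis_mem.
Qed.

Lemma free_ext k (M : lmodType R) (f g : {linear subm (free_subm R k) -> M}) :
  (forall i, (i < k)%N -> f (free_elt k i) = g (free_elt k i)) ->
  forall v, f v = g v.
Proof.
move=> fg v; pose N := mk_submodule (linear_pred_im (val_lin (free_subm R k))
  (linear_pred_preim (f \- g : {linear _ -> _}) (submod_linear (zero_subm M)))).
have [i ik|u u0 /val_inj <-] := @free_gen R k N _ (val v) (submP v).
  exists (free_elt k i); first by rewrite /= fg // subrr.
  exact: val_free_elt.
by apply/eqP; rewrite -subr_eq0; apply/eqP; exact: u0.
Qed.

Lemma comb_free_elt (M : lmodType R) k (y : nat -> M) i : (i < k)%N ->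
  comb k y (val (free_elt k i)) = y i.
Proof. by move=> ik; rewrite val_free_elt // comb_basis. Qed.

End FreeExt.

Section Resolution.
Variables (R : comNzRingType) (Y : complex R).
Hypothesis R_noeth : noetherian_ring R.
Hypothesis Y_top : forall n, 0 <= n -> is_zero_mod (Y n).
Hypothesis Y_fg : forall n, fg_mod (cohomology Y n).

(* One degree of a free resolution of [Y]: the rank, and the images of the
   basis elements in the next degree and in [Y]. *)
Record stage := Stage {
  rk : nat;
  zb : nat -> (nat -> R^o);
  yb : nat -> prodm Y }.

Definition sd (s : stage) : {linear (nat -> R^o) -> (nat -> R^o)} := comb (rk s) (zb s).
Definition sf (s : stage) n : {linear (nat -> R^o) -> Y n} :=
  comb (rk s) (fun i => yb s i n).

(** The second clause is injectivity on cohomology in degree n, the third surjectivity in degree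
    n'. *)
Definition stage_step (n n' : int) (s s' : stage) : Prop :=
  [/\ forall i, (i < rk s')%N -> [/\ free_subm R (rk s) (zb s' i),
        sd s (zb s' i) = 0 & sf s n (zb s' i) = cdiff Y n' n (yb s' i n')],
      forall v, free_subm R (rk s) v -> sd s v = 0 -> bnd Y n' n (sf s n v) ->
        exists2 u, free_subm R (rk s') u & sd s' u = v
    & forall c, cyc Y n' n c -> exists u, [/\ free_subm R (rk s') u, sd s' u = 0
        & bnd Y (n' - 1) n' (sf s' n' u - c)]].

Lemma stage_exists n s : exists s', stage_step n (n - 1) s s'.
Proof.
pose K := mk_submodule (linear_pred_and (submod_linear (free_subm R (rk s)))
  (linear_pred_and (linear_pred_preim (sd s) (submod_linear (zero_subm _)))
     (linear_pred_preim (sf s n) (submod_linear (bnd Y (n - 1) n))))).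
have nK : noethq K (zero_subm (nat -> R^o)).
  by apply: (@noethq_sub _ _ (free_subm R (rk s))) => [|v [] //]; exact: free_noeth.
have [zs [zsK zsP]] := noethq_fg nK (fun v v0 => eq_ind_r K (submod0 K) v0).
have := cohomology_noeth R_noeth (@Y_fg (n - 1)); rewrite subrK => nC.
have [cs [csC csP]] := noethq_fg nC (@bnd_cyc _ _ _ _ _).
pose a := size zs; pose r' := (a + size cs)%N.
have /choice [yb' yb'P] : forall i, exists y : prodm Y,
    ((i < a)%N -> sf s n (nth 0 zs i) = cdiff Y (n - 1) n (y (n - 1))) /\
    ((a <= i)%N -> y (n - 1) = nth 0 cs (i - a)).
  move=> i; have [ia|ai] := ltnP i a.
    have [_ [_ [y yE]]] := zsK _ (mem_nth 0 ia).
    have [f fE] := prodm_with y; exists f; split=> //.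
    by move=> _; rewrite fE yE.
  by have [f fE] := prodm_with (nth 0 cs (i - a) : Y (n - 1)); exists f.
(* The first basis elements kill the cocycles whose image is already a coboundary; the remaining
   ones supply the classes of Y and have differential 0, the default value of [nth]. *)
pose s' := Stage r' (nth 0 zs) yb'.
have s'_basis i : (i < r')%N -> sd s' (free_basis R i) = nth 0 zs i.
  by move=> ir; rewrite /sd comb_basis.
have s'_y i : (i < r')%N -> sf s' (n - 1) (free_basis R i) = yb' i (n - 1).
  by move=> ir; rewrite /sf comb_basis.
exists s'; split.
- move=> i ir; change [/\ free_subm R (rk s) (nth 0 zs i),
    sd s (nth 0 zs i) = 0 &
    sf s n (nth 0 zs i) = cdiff Y (n - 1) n (yb' i (n - 1))].
  have [ia|ai] := ltnP i a.
    have [zf [zd _]] := zsK _ (mem_nth 0 ia).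
    by split=> //; apply: (yb'P i).1.
  rewrite (nth_default 0 ai); split.
  + exact: (submod0 (free_subm R (rk s))).
  + exact: linear0.
  + rewrite linear0 (yb'P i).2 //; apply/esym/csC/mem_nth.
    by rewrite ltn_subLR.
- move=> v vf vd vb.
  apply: (zsP (mk_submodule (linear_pred_im (sd s') (submod_linear (free_subm R r'))))).
  + by move=> _ ->; exact: submod0.
  + move=> z /(nthP 0) [i ia <-].
    have ir : (i < r')%N by rewrite (leq_trans ia) // leq_addr.
    by exists (free_basis R i); [exact: free_basis_mem | exact: s'_basis].
  + by split.
- move=> c cc.
  have Cl : linear_pred (fun c => exists u, [/\ free_subm R r' u, sd s' u = 0
        & bnd Y (n - 1 - 1) (n - 1) (sf s' (n - 1) u - c)]).
    split.
      exists 0; split; [exact: submod0 | exact: linear0 | rewrite subr0 linear0].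
      exact: submod0.
    move=> r u v [u' [uf ud ub]] [v' [vf vd vb]]; exists (r *: u' + v').
    rewrite [sd s' _]linearP [sf s' _ _]linearP ud vd scaler0 addr0.
    rewrite opprD addrACA -scalerBr; split=> //.
      exact: (submod_linear (free_subm R r')).2.
    exact: (submod_linear (bnd Y (n - 1 - 1) (n - 1))).2.
  apply: (csP (mk_submodule Cl)) => // [b bb|y /(nthP 0) [i ia <-]].
    exists 0; split; [exact: submod0 | exact: linear0 | rewrite linear0 sub0r].
    exact: submodN.
  have ir : (a + i < r')%N by rewrite ltn_add2l.
  exists (free_basis R (a + i)); split; first exact: free_basis_mem.
    by rewrite s'_basis // nth_default // leq_addr.
  rewrite s'_y // (yb'P (a + i)%N).2 ?leq_addr // addKn subrr; exact: submod0.
Qed.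

Lemma stages_exist : exists st : int -> stage,
  (forall n, 0 <= n -> rk (st n) = 0%N) /\
  forall n, stage_step (n + 1) n (st (n + 1)) (st n).
Proof.
pose t0 := Stage 0 (fun=> 0) (fun=> 0).
have [//|n t _ _|n n0|st [st0 stP]] := @int_down_choice stage (fun _ _ => True)
  (fun n => stage_step n (n - 1)) t0.
- by have [t' tt'] := stage_exists n t; exists t'.
- split=> // [v v0 _ _|c _].
    by exists 0; [exact: submod0 | rewrite linear0; apply/esym/funext => i; exact: v0].
  exists 0; split; [exact: submod0 | exact: linear0 |].
  have -> : c = 0 by apply: Y_top; lia.
  by rewrite linear0 subr0; exact: submod0.
- exists st; split=> [n /st0 -> //|n].
  by have := stP (n + 1); rewrite addrK.
Qed.

Section Complex.
Variable st : int -> stage.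
Hypothesis st_top : forall n, 0 <= n -> rk (st n) = 0%N.
Hypothesis stP : forall n, stage_step (n + 1) n (st (n + 1)) (st n).

Local Notation r n := (rk (st n)).
Local Notation dP n := (sd (st n)).
Local Notation fP n := (sf (st n) n).

Lemma dP_free n v : free_subm R (r (n + 1)) (dP n v).
Proof. by apply: comb_mem => i ir; have [+ _ _] := stP n; move=> /(_ i ir) []. Qed.

Lemma dPdP n v : dP (n + 1) (dP n v) = 0.
Proof.
apply: (comb_mem (N := mk_submodule
  (linear_pred_preim (dP (n + 1)) (submod_linear (zero_subm _))))).
by move=> i ir; have [+ _ _] := stP n; move=> /(_ i ir) [].
Qed.

Lemma fPdP n v : free_subm R (r n) v -> fP (n + 1) (dP n v) = cdiff Y n (n + 1) (fP n v).
Proof.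
move=> vf; pose N := mk_submodule (linear_pred_preim
  ((fP (n + 1) \o dP n) \- (cdiff Y n (n + 1) \o fP n) : {linear _ -> _})
  (submod_linear (zero_subm _))).
apply/eqP; rewrite -subr_eq0; apply/eqP; apply: (@free_gen R (r n) N _ v vf) => i ir.
change (fP (n + 1) (dP n (free_basis R i))
  - cdiff Y n (n + 1) (fP n (free_basis R i)) = 0).
have [+ _ _] := stP n => /(_ i ir) [_ _].
have -> : dP n (free_basis R i) = zb (st n) i by exact: comb_basis.
have -> : fP n (free_basis R i) = yb (st n) i n by exact: comb_basis ir.
by move=> ->; rewrite subrr.
Qed.

Fact res_diff_subproof i j (v : subm (free_subm R (r i))) :
  free_subm R (r j) (if j == i + 1 then dP i (val v) else 0).
Proof. by case: eqP => [->|_]; [exact: dP_free | exact: submod0]. Qed.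

Fact res_diff_linear i j : linear (fun v => mk_subm (@res_diff_subproof i j v)).
Proof.
move=> a u v; apply: val_inj => /=; case: eqP => _; first exact: (linearP (dP i)).
by rewrite scaler0 addr0.
Qed.

Definition free_res : complex R.
Proof.
refine (@Complex R (fun n => subm (free_subm R (r n)))
  (fun i j => linear_of (@res_diff_linear i j)) _ _).
- by move=> i j x /eqP/negbTE ij; apply: val_inj; rewrite /= ij.
- move=> i j k x; apply: val_inj => /=.
  have [kj|//] := k =P j + 1; have [->|_] := j =P i + 1; [exact: dPdP | exact: (linear0 (dP j))].
Defined.

Lemma free_res_diff i j (v : free_res i) : j = i + 1 ->
  val (cdiff free_res i j v) = dP i (val v).
Proof. by move=> -> /=; rewrite eqxx. Qed.

Fact free_res_map_comm i j (x : free_res i) :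
  (fP j \o val_lin (free_subm R (r j)) : {linear _ -> _}) (cdiff free_res i j x) =
  cdiff Y i j ((fP i \o val_lin (free_subm R (r i)) : {linear _ -> _}) x).
Proof.
have [->|/eqP ij] := eqVneq j (i + 1).
  transitivity (fP (i + 1) (dP i (val x))); first by rewrite -(free_res_diff x erefl).
  exact/fPdP/(submP x).
by rewrite !cdiff_shape // linear0.
Qed.

Definition free_res_map : chain_map free_res Y := ChainMap free_res_map_comm.

Lemma free_res_qi : quasi_iso free_res_map.
Proof.
move=> n; apply: linear_bijective => [c c0|w].
  have [v vc vcyc] := reps_ex c.
  have vb := (reps0 (reps_map free_res_map vc)).1 c0.
  apply/(reps0 vc); have := stP (n - 1); rewrite subrK => -[_ + _].
  move=> /(_ (val v) (submP v)) [||u uf uv].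
  - by rewrite -(free_res_diff v erefl) vcyc.
  - exact: vb.
  - exists (mk_subm uf); apply: val_inj; rewrite free_res_diff ?subrK //.
have [c cw cc] := reps_ex w.
have [_ _ /(_ c cc) [u [uf ud ub]]] := stP n.
have [|k uk] := @repsE R free_res n (mk_subm uf).
  by apply: val_inj; rewrite free_res_diff.
exists k; apply/eqP; rewrite -subr_eq0; apply/eqP.
apply/(reps0 (linear_relB (reps_linear Y n) (reps_map free_res_map uk) cw)).
exact: ub.
Qed.

End Complex.
End Resolution.

Lemma acyclic_bnd (R : comNzRingType) (X : complex R) n n' n'' x : acyclic X ->
  n = n' + 1 -> n'' = n + 1 -> cdiff X n n'' x = 0 -> exists y, cdiff X n' n y = x.
Proof.
move=> X_ac nE -> xc; have [w xw] := @repsE R X n x xc.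
by have [y yE] := (reps0 xw).1 (X_ac n w); rewrite (_ : n' = n - 1); [exists y | lia].
Qed.

(** * K-projectivity of the free resolution *)

Section KProjective.
Variables (R : comNzRingType) (Y : complex R) (st : int -> stage Y).
Hypothesis st_top : forall n, 0 <= n -> rk (st n) = 0%N.
Hypothesis stP : forall n, stage_step (n + 1) n (st (n + 1)) (st n).

Local Notation r n := (rk (st n)).
Local Notation dP n := (sd (st n)).
Local Notation P := (free_res stP).

(** A cocycle F of Hom(P, A) is contracted degree by degree downwards. [Inv] asks only that the
    homotopy solve its equation on cocycles of P^p; this makes the right-hand side for the next
    basis elements a cocycle of A, which acyclicity then solves. *)
Lemma free_res_Kprojective : K_projective P.
Proof.
move=> A A_ac n w; have [F Fw Fc] := reps_ex w; apply/(reps0 Fw).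
pose hc p (h : nat -> prodm A) q : {linear (nat -> R^o) -> A q} :=
  comb (r p) (fun i => h i q).
pose s := sg R (n - 1).
pose Inv p (h : nat -> prodm A) := forall q q' (v : P p), q = p + n -> q = q' + 1 ->
  dP p (val v) = 0 -> cdiff A q' q (hc p h q' (val v)) = hv F p q v.
pose Q p (h h' : nat -> prodm A) := forall p' q q' i, p = p' + 1 -> q = p' + n ->
  q = q' + 1 -> (i < r p')%N ->
  cdiff A q' q (h' i q') =
  hv F p' q (free_elt R (r p') i) + s *: hc p h q (zb (st p') i).
have sgn : sg R n = - s by rewrite /s /sg -Defs.absz_sign subrK.
have Q_ext p h h' p' q q' (v : P p') : Q p h h' -> p = p' + 1 -> q = p' + n ->
    q = q' + 1 -> cdiff A q' q (hc p' h' q' (val v)) =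
      hv F p' q v + s *: hc p h q (dP p' (val v)).
  move=> hh' pE qE q'E.
  have s_lin : linear (fun v : nat -> R^o => s *: hc p h q v).
    by move=> a u u'; rewrite linearP scalerDr !scalerA mulrC.
  pose f : {linear P p' -> A q} := cdiff A q' q \o (hc p' h' q' \o val_lin _).
  pose g : {linear P p' -> A q} :=
    hv F p' q \+ (linear_of s_lin \o (dP p' \o val_lin _)).
  apply: (@free_ext R (r p') _ f g) => i ir.
  change (cdiff A q' q (comb (r p') (fun j => h' j q') (val (free_elt R (r p') i))) =
    hv F p' q (free_elt R (r p') i)
      + s *: hc p h q (comb (r p') (zb (st p')) (val (free_elt R (r p') i)))).
  by rewrite !comb_free_elt // (hh' p').
have [|p h p0 hI|p p0 p' q q' i pE _ _|h [h0 hQ]] :=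
    @int_down_choice (nat -> prodm A) Inv Q (fun=> 0).
- move=> p p0 q q' v _ _ _; have -> : v = 0.
    by apply: val_inj; apply: funext => i; apply: (submP v); rewrite st_top.
  by rewrite !linear0.
- pose p' := p - 1; pose q := p' + n; pose q' := q - 1.
  have pE : p = p' + 1 by rewrite subrK.
  have q'E : q = q' + 1 by rewrite subrK.
  have /choice [h' h'P] : forall i, exists y : prodm A, (i < r p')%N ->
      cdiff A q' q (y q') =
      hv F p' q (free_elt R (r p') i) + s *: hc p h q (zb (st p') i).
    move=> i; have [ir|_] := boolP (i < r p')%N; last by exists 0.
    have := stP p'; rewrite -pE => -[/(_ i ir) [zf zd _] _ _].
    have [|||y yE] := @acyclic_bnd R A q q' (q + 1)
      (hv F p' q (free_elt R (r p') i) + s *: hc p h q (zb (st p') i)) A_ac => //.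
      rewrite linearD linearZZ (cyc_hom (p' := p) _ Fc) // sgn.
      rewrite -[zb _ _]/(val (mk_subm zf)) hI //; last by rewrite /q; lia.
      rewrite (_ : cdiff P p' p _ = mk_subm zf) ?scaleNr ?addNr //.
      apply: val_inj; rewrite free_res_diff //.
      exact: comb_free_elt.
    by have [f fE] := prodm_with y; exists f => _; rewrite fE.
  have hQ : Q p h h'.
    move=> p1 q1 q1' i p1E q1E q1'E.
    have -> : p1 = p' by lia.
    have -> : q1 = q by lia.
    have -> : q1' = q' by lia.
    exact: h'P.
  exists h'; split=> // q1 q1' v q1E q1'E vd.
  by rewrite (Q_ext p h h') // vd linear0 scaler0 addr0.
- by move=> ir; exfalso; move: ir; rewrite st_top //; lia.
have [H HE] := hom_of_family (n - 1)
  (fun p q => hc p (h p) q \o val_lin (free_subm R (r p)) : {linear P p -> A q}).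
exists H; apply: hv_eq => p q x qE.
rewrite (hv_diff _ (p' := p + 1) (q' := q - 1)) ?subrK // !HE; [|lia|lia].
have hQp : Q (p + 1) (h (p + 1)) (h p) by have := hQ (p + 1); rewrite addrK.
have e := Q_ext (p + 1) _ _ p q (q - 1) x hQp erefl qE (esym (subrK _ _)).
rewrite -[in RHS](addrK (s *: hc (p + 1) (h (p + 1)) q (dP p (val x))) (hv F p q x)).
rewrite -e; congr (_ - _ *: hc _ _ _ _).
by rewrite -[LHS]/(val (cdiff P p (p + 1) x)) free_res_diff.
Qed.

End KProjective.

(** * Reduction modulo a prime *)

Section ResidueField.
Variables (R : comNzRingType) (p : spec R).

Lemma spec_mul (s t : R) : ~ p s -> ~ p t -> ~ p (s * t).
Proof. by move=> ps pt /(spec_prime p).2 []. Qed.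

Definition frac (a : R) (s : denom p) : loc p R^o :=
  @pm_pi R (loc_premodule p R^o) (a, s).

Definition kappa1 : residue_field p := quot_pi _ (frac 1 (denom1 p)).

Lemma frac_scale (r a : R) s : r *: frac a s = frac (r * a) s.
Proof. by rewrite /frac -pm_piZ. Qed.

Lemma kappa_frac (c : residue_field p) : exists t a : R, ~ p t /\ t *: c = a *: kappa1.
Proof.
rewrite -[c](@pm_reprK R (quot_premodule _)); set y := pm_repr c.
rewrite -[pm_pi _]/(quot_pi _ (y : loc p R^o)).
rewrite -[y](@pm_reprK R (loc_premodule p R^o)); case: (pm_repr y) => a s.
exists (den s), a; split; first exact: denomP.
rewrite /kappa1 -!linearZZ; congr (quot_pi _ _).
rewrite -[pm_pi _]/(frac a s) !frac_scale; apply/pm_piP; exists (denom1 p) => /=.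
by rewrite /GRing.scale /=; ring.
Qed.

Lemma kappa1_eq0 (r : R) : r *: kappa1 = 0 -> p r.
Proof.
rewrite /kappa1 -linearZZ -(linear0 (quot_pi _)) frac_scale mulr1 => /quot_piP.
rewrite subr0 => rp.
have Pl : linear_pred (fun y : loc p R^o => exists a s, p a /\ y = frac a s).
  split.
    exists 0, (denom1 p); split; first exact: submod0.
    by rewrite -[LHS](scale0r (frac 0 (denom1 p))) frac_scale mul0r.
  move=> c y z [a [s [pa ->]]] [b [t [pb ->]]].
  exists (den t * (c * a) + den s * b), (denomM s t); split.
    apply: submodD; first by do 2!apply: ideal_mull.
    exact: ideal_mull.
  by rewrite frac_scale /frac -pm_piD.
have [_ [r' [y [pr _ ->]]]|a [s [pa /pm_piP [u /= uE]]]] := rp (mk_submodule Pl).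
  rewrite -[y](@pm_reprK R (loc_premodule p R^o)); case: (pm_repr y) => a s.
  by exists (r' * a), s; split; [exact: ideal_mulr | rewrite -frac_scale].
have : p (den u * (den s * r)).
  move: uE; rewrite /GRing.scale /= => ->; apply: ideal_mull; exact: ideal_mull.
by case/(spec_prime p).2 => [/denomP|/(spec_prime p).2 [/denomP|]].
Qed.

(** The bilinear maps (v, c) -> v_j c read off the coordinates of a tensor; clearing the
    denominators of its finitely many coefficients gives a congruence over R. *)
Lemma tensor_boundary (M : lmodType R) (k : nat) (d : {linear M -> subm (free_subm R k)})
  (e : subm (free_subm R k)) (y : tensor M (residue_field p)) :
  tensor_map _ d y = @pm_pi R (tensor_premodule _ _) [:: (e, kappa1)] ->
  exists (t : R) (w : M), ~ p t /\ forall j, p (t * val e j - val (d w) j).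
Proof.
rewrite -[y](@pm_reprK R (tensor_premodule M (residue_field p))).
set s := pm_repr y; rewrite tensor_mapE => /pm_piP es.
have eval_j j : \sum_(u <- s) (val (d u.1) j : R) *: u.2 = (val e j : R) *: kappa1.
  have bl : bilinear_map (fun (v : subm (free_subm R k)) (c : residue_field p) =>
      (val v j : R) *: c).
    split=> [c a u v|v a c c']; last by rewrite /= scalerDr !scalerA mulrC.
    by rewrite free_linE scalerDl -scalerA.
  by have := es _ _ bl; rewrite /tensor_eval big_map big_seq1.
have [t [w [pt wE]]] : exists (t : R) (w : M), ~ p t /\ forall j,
    t *: \sum_(u <- s) (val (d u.1) j : R) *: u.2 = (val (d w) j : R) *: kappa1.
  elim: (s) => [|[w0 c] s' [t [w [pt wE]]]].
    exists 1, 0; split=> [|j]; first exact: (spec_prime p).1.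
    by rewrite big_nil scaler0 linear0 scale0r.
  have [t0 [a [pt0 t0E]]] := kappa_frac c.
  exists (t0 * t), ((t * a) *: w0 + t0 *: w); split; first exact: spec_mul.
  move=> j; rewrite big_cons [(w0, c).1]/= [(w0, c).2]/=.
  rewrite scalerDr -[X in _ + X]scalerA wE [d (_ + _)]linearP.
  rewrite [d (t0 *: w)]linearZZ free_linE free_scaleE scalerDl.
  rewrite -[(t0 * _) *: kappa1]scalerA; congr (_ + _).
  set x := (val (d w0) j : R); rewrite /= scalerA.
  rewrite (_ : t0 * t * x = t * x * t0); last by ring.
  by rewrite -scalerA t0E scalerA; congr (_ *: _); ring.
exists t, w; split=> // j; apply: kappa1_eq0.
by rewrite scalerBl -wE eval_j scalerA subrr.
Qed.

Lemma tensor_kappa1_cycle (M M' : lmodType R) (f : {linear M -> M'}) (e : M) :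
  f e = 0 ->
  tensor_map _ f (@pm_pi R (tensor_premodule M (residue_field p)) [:: (e, kappa1)]) = 0.
Proof.
move=> fe; rewrite tensor_mapE; apply/pm_piP => L b [bl _].
rewrite /tensor_eval /= big_seq1 big_nil /= fe.
exact: (linear0 (linear_of (bl kappa1))).
Qed.

(** Modulo p the matrix is scalar, so its determinant is congruent to c^n. *)
Lemma det_mod_prime n (A : 'M[R]_n) (c : R) : (forall i j, p (A i j)) ->
  ~ p c -> ~ p (\det (c%:M - A)).
Proof.
move=> pA pc pdet.
have cong (s : 'S_n) : p (\prod_i (c%:M - A) i (s i) - \prod_i (c%:M : 'M[R]_n) i (s i)).
  apply: (big_ind2 (fun a b => p (a - b))).
  - by rewrite subrr; exact: submod0.
  - move=> a b a' b' pab pab'.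
    rewrite (_ : a * a' - b * b' = a' * (a - b) + b * (a' - b')); last by ring.
    by apply: submodD; apply: ideal_mull.
  - move=> i _; rewrite !mxE addrAC subrr add0r; exact/submodN/pA.
suff : p (c ^+ n).
  elim: n {A pA pdet cong} => [|n IHn]; first exact: (spec_prime p).1.
  by rewrite exprS => /(spec_prime p).2 [].
rewrite -(det_scalar n c) -(subKr (\det (c%:M - A)) (\det _)); apply: submodB => //.
rewrite /determinant -sumrB; apply: (big_ind (fun a => p a)).
- exact: submod0.
- by move=> a b pa pb; apply: submodD.
- by move=> s _; rewrite -mulrBr; apply: ideal_mull.
Qed.

End ResidueField.

Lemma adj_comb (R : comNzRingType) (V : lmodType R) k (A : 'M[R]_k)
  (x : 'I_k -> V) i :
  \sum_j \adj A i j *: (\sum_l A j l *: x l) = \det A *: x i.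
Proof.
transitivity (\sum_l (\adj A *m A) i l *: x l).
  under eq_bigr => j _ do rewrite scaler_sumr.
  rewrite exchange_big; apply: eq_bigr => l _.
  by rewrite mxE scaler_suml; apply: eq_bigr => j _; rewrite scalerA.
rewrite mul_adj_mx (bigD1 i) //= big1 ?addr0 => [|l li].
  by rewrite mxE eqxx mulr1n.
by rewrite mxE eq_sym (negbTE li) mulr0n scale0r.
Qed.

(** * Splitting the free resolution outside a prime *)

Section PointwiseSupport.
Variables (R : comNzRingType) (Y : complex R) (st : int -> stage Y) (p : spec R).
Hypothesis st_top : forall n, 0 <= n -> rk (st n) = 0%N.
Hypothesis stP : forall n, stage_step (n + 1) n (st (n + 1)) (st n).
Local Notation P := (free_res stP).
Hypothesis P_tensor : acyclic (tensor_complex P (residue_field p)).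
Local Notation r n := (rk (st n)).
Local Notation dP n := (sd (st n)).

(* The differential of [P] leaving degree [n] splits after inverting [s]. *)
Definition splits n : Prop := exists s : R, ~ p s /\
  exists h : {linear (nat -> R^o) -> (nat -> R^o)}, forall v,
    free_subm R (r n) v -> free_subm R (r n) (h (dP n v)) /\
      dP n (h (dP n v)) = s *: dP n v.

Lemma common_denominator k (e : nat -> subm (free_subm R k)) (M : lmodType R)
  (d : {linear M -> subm (free_subm R k)}) l :
  (forall i, (i < l)%N -> exists (t : R) (w : M),
     ~ p t /\ forall j, p (t * val (e i) j - val (d w) j)) ->
  exists t : R, ~ p t /\ forall i, (i < l)%N ->
    exists w : M, forall j, p (t * val (e i) j - val (d w) j).
Proof.
elim: l => [|l IHl] ed; first by exists 1; split=> //; exact: (spec_prime p).1.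
have [i il|t [pt tP]] := IHl; first by apply: ed; rewrite ltnW.
have [t' [w' [pt' wP']]] := ed l (ltnSn l).
exists (t * t'); split; first exact: spec_mul.
have scale_w (c c' : R) w i : (forall j, p (c * val (e i) j - val (d w) j)) ->
    forall j, p (c' * c * val (e i) j - val (d (c' *: w)) j).
  move=> h j; rewrite [d (_ *: w)]linearZZ free_scaleE -mulrA -mulrBr.
  exact: ideal_mull.
move=> i; rewrite ltnS leq_eqVlt => /orP [/eqP ->|/tP [w wP]].
  by exists (t *: w'); exact: scale_w.
by exists (t' *: w); rewrite mulrC; exact: scale_w.
Qed.

(** A Nakayama argument for the cocycles of P^(n+1), which need not be free: the splitting already
    found provides e, an s-fold projection onto them, so they are controlled by the images of a
    basis. *)
Lemma splits_step n : splits (n + 1) ->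
  exists s : R, ~ p s /\ exists h : {linear (nat -> R^o) -> (nat -> R^o)},
    (forall v, free_subm R (r n) (h v)) /\
    forall v, free_subm R (r (n + 1)) v -> dP (n + 1) v = 0 -> dP n (h v) = s *: v.
Proof.
move=> [s [ps [h hP]]].
pose e : {linear (nat -> R^o) -> (nat -> R^o)} :=
  (s \*: idfun) \- (h \o dP (n + 1)).
have eE v : e v = s *: v - h (dP (n + 1) v) by [].
pose k := r (n + 1).
have e_free v : free_subm R k v -> free_subm R k (e v).
  by move=> vk; rewrite eE; apply: submodB; [exact: submodZ | exact: (hP v vk).1].
have e_cyc v : free_subm R k v -> dP (n + 1) (e v) = 0.
  by move=> vk; rewrite eE (linearB (dP (n + 1))) linearZZ (hP v vk).2 subrr.
have e_id v : dP (n + 1) v = 0 -> e v = s *: v.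
  by move=> v0; rewrite eE v0 linear0 subr0.
pose ee i : P (n + 1) := mk_subm (e_free _ (submP (free_elt R k i))).
have ee_val i : (i < k)%N -> val (ee i) = e (free_basis R i).
  by move=> ik; rewrite -[LHS]/(e (val (free_elt R k i))) val_free_elt.
have [i ik|t [pt tP]] := @common_denominator k ee (P n) (cdiff P n (n + 1)) k.
  have [|||y yE] := @acyclic_bnd R (tensor_complex P (residue_field p)) (n + 1) n (n + 1 + 1)
    (@pm_pi R (tensor_premodule (P (n + 1)) (residue_field p)) [:: (ee i, kappa1 p)])
    P_tensor => //.
    apply: tensor_kappa1_cycle; apply: val_inj; rewrite free_res_diff //.
    by apply: e_cyc; exact: submP.
  exact: (tensor_boundary yE).
have /choice [w wP] : forall i, exists w : P n, (i < k)%N ->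
    forall j, p (t * val (ee i) j - val (cdiff P n (n + 1) w) j).
  move=> i; have [ik|_] := boolP (i < k)%N; last by exists 0.
  by have [w wP] := tP i ik; exists w.
(* Acyclicity modulo p makes all entries of A lie in p. *)
pose A : 'M[R]_k := \matrix_(i, j) (t * val (ee i) j - val (cdiff P n (n + 1) (w i)) j).
pose Mx := (t * s)%:M - A.
(* Applying e, which is multiplication by s on cocycles, turns the congruences into a linear system
   for the elements e(b_j) with right-hand sides in the image of the differential; multiplying by
   the adjugate solves it up to det Mx, which is outside p. *)
have MxE (i : 'I_k) : \sum_j Mx i j *: e (free_basis R j) = dP n (s *: val (w i)).
  have : e (t *: val (ee i) - dP n (val (w i))) =
      \sum_j A i j *: e (free_basis R j).
    set v0 := (X in e X).
    have v0f : free_subm R k v0.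
      by apply: (submodB (N := free_subm R k)); [apply/submodZ/submP | exact: dP_free].
    rewrite {1}(free_comb v0f).
    change (e (\sum_(j < k) (v0 j : R) *: free_basis R j) = \sum_j A i j *: e (free_basis R j)).
    rewrite (linear_sum e); apply: eq_bigr => j _; rewrite linearZZ mxE; congr (_ *: _).
    by rewrite (free_res_diff (w i) erefl).
  rewrite linearB linearZZ (e_id (val _)); last by apply: e_cyc; exact: submP.
  rewrite (e_id (dP n _)); last exact: dPdP.
  rewrite ee_val // => AE; rewrite linearZZ.
  transitivity (\sum_j ((t * s)%:M : 'M[R]_k) i j *: e (free_basis R j)
      - \sum_j A i j *: e (free_basis R j)).
    by rewrite -sumrB; apply: eq_bigr => j _; rewrite !mxE -scalerBl.
  rewrite -AE (bigD1 i) // big1 => [|j /andP [_ ji]]; last first.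
    by rewrite !mxE eq_sym (negbTE ji) mulr0n scale0r.
  rewrite mxE eqxx mulr1n [X in X - _](_ : _ = (t * s) *: e (free_basis R i)) ?scalerA ?subKr //.
  exact: addr0.
have pd : ~ p (\det Mx).
  apply: det_mod_prime; last exact: spec_mul.
  by move=> i j; rewrite mxE; apply: wP.
have /choice [u uP] : forall i, exists u, (i < k)%N ->
    free_subm R (r n) u /\ dP n u = \det Mx *: e (free_basis R i).
  move=> i; have [ik|_] := boolP (i < k)%N; last by exists 0.
  exists (\sum_j (\adj Mx) (Ordinal ik) j *: (s *: val (w j))) => _; split.
    apply: (big_ind (fun v => free_subm R (r n) v)).
    - exact: submod0.
    - exact: submodD.
    - by move=> j _; do 2!apply: submodZ; exact: submP.
  rewrite (linear_sum (dP n)).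
  rewrite -(adj_comb Mx (fun l => e (free_basis R l)) (Ordinal ik)).
  by apply: eq_bigr => j _; rewrite linearZZ -MxE.
exists (\det Mx * s); split; first exact: spec_mul.
exists (comb k u); split=> [v|v vk v0].
  by apply: comb_mem => i ik; case: (uP i ik).
suff E : dP n (comb k u v) = \det Mx *: e v by rewrite E (e_id v v0) scalerA.
pose g : {linear (nat -> R^o) -> (nat -> R^o)} :=
  (dP n \o comb k u) \- (\det Mx \*: e).
apply/eqP; rewrite -subr_eq0; apply/eqP.
pose N := mk_submodule (linear_pred_preim g (submod_linear (zero_subm _))).
apply: (@free_gen R k N _ v vk) => i ik.
change (dP n (comb k u (free_basis R i)) - \det Mx *: e (free_basis R i) = 0).
by rewrite comb_basis // (uP i ik).2 subrr.
Qed.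

Lemma all_split n : splits n.
Proof.
have top j : 0 <= j -> splits j.
  move=> j0; exists 1; split; first exact: (spec_prime p).1.
  exists \0 => v vf; have -> : v = 0 by apply: funext => i; apply: vf; rewrite st_top.
  by rewrite !linear0 ?scaler0; split=> //; exact: submod0.
have [/top //|n0] := leP 0 n.
have -> : n = - `|n|%N%:Z by lia.
elim: `|n|%N => [|k IHk]; first exact: top.
have kE : - k%:Z = - k.+1%:Z + 1 by lia.
rewrite kE in IHk; have [s [ps [h [hf hP]]]] := splits_step IHk.
exists s; split=> //; exists h => v vf; split; first exact: hf.
by apply: hP; [exact: dP_free | exact: dPdP].
Qed.

Lemma free_res_killed n : exists s : R, ~ p s /\ forall v : P (n + 1),
  cyc P (n + 1) (n + 1 + 1) v -> bnd P n (n + 1) (s *: v).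
Proof.
have [s [ps [h [hf hP]]]] := splits_step (all_split (n + 1)).
exists s; split=> // v vc; exists (mk_subm (hf (val v))).
apply: val_inj; rewrite free_res_diff // subm_scaleE.
apply: (hP _ (submP v)).
by rewrite -(free_res_diff v erefl) vc.
Qed.

End PointwiseSupport.

(** * From the small support to annihilators of cohomology *)

Section Support.
Variables (R : comNzRingType) (X : complex R).
Hypothesis R_noeth : noetherian_ring R.

Lemma fg_mod_iso (M N : lmodType R) : mod_iso M N -> fg_mod M -> fg_mod N.
Proof.
move=> [f [g fK gK]] /fg_submP [s [_ sP]]; apply/fg_submP.
exists (map f s); split=> // N' sN' y _; rewrite -(gK y).
apply: (sP (mk_submodule (linear_pred_preim f (submod_linear N')))) => // x xs.
exact/sN'/map_f.
Qed.

Lemma trunc_cohomology (k n : int) : n <= k ->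
  mod_iso (cohomology X n) (cohomology (trunc_le k X) n).
Proof.
move=> nk; pose Y := trunc_le k X.
have Ymem (j : int) (x : X j) : j <= k -> cdiff X j (j + 1) x = 0 -> trunc_le_subm k X j x.
  by move=> jk xc; split=> [kj|//]; move: (le_lt_trans jk kj); rewrite ltxx.
pose rel (w : cohomology X n) (w' : cohomology Y n) :=
  exists2 y, @reps R Y n y w' & reps (val y) w.
have rel_lin : linear_rel rel.
  split; first by exists 0; [exact: (reps_linear Y n).1 | exact: (reps_linear X n).1].
  move=> r w w' u u' [y yu yw] [y' yu' yw']; exists (r *: y + y').
    exact: (reps_linear Y n).2.
  by rewrite subm_linE; exact: (reps_linear X n).2.
have rel_total w : exists w', rel w w'.
  have [x xw xc] := reps_ex w; pose y : Y n := mk_subm (Ymem n x nk xc).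
  have [|w' yw'] := @repsE R Y n y; first exact: val_inj.
  by exists w', y.
have bndE (y : Y n) : bnd X (n - 1) n (val y) -> bnd Y (n - 1) n y.
  move=> [u uE]; have uY : trunc_le_subm k X (n - 1) u.
    by split=> h; exfalso; move: h nk; lia.
  by exists (mk_subm uY); apply: val_inj.
have rel_fun w' : rel 0 w' -> w' = 0.
  by move=> [y yw' /reps0 [/(_ erefl) yb _]]; apply/(reps0 yw')/bndE.
have [f fP] := linear_choice rel_lin rel_total rel_fun.
apply: (linear_bij (f := f)) => [w w0|w'].
  have [y yw' yw] : rel w 0 by apply/fP.
  apply/(reps0 yw); have [u uE] := (reps0 yw').1 erefl.
  by exists (val u); rewrite -uE.
have [y yw' yc] := reps_ex w'.
have [|w yw] := @repsE R X n (val y).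
  by have /= := congr1 val yc.
by exists w; apply/esym/fP; exists y.
Qed.

Lemma trunc_top (k n : int) : k < n -> is_zero_mod (trunc_le k X n).
Proof. by move=> kn y; apply: val_inj; exact: (submP y).1. Qed.

Hypothesis X_fg : forall n, fg_mod (cohomology X n).

Lemma support_killed (p : spec R) (n : int) : n < 0 ->
  ~ small_support (trunc_le (- 1) X) p ->
  exists2 s : R, ~ p s & ann_ideal (cohomology X n) s.
Proof.
move=> n0 p_supp; pose Y := trunc_le (- 1) X.
have Y_top j : 0 <= j -> is_zero_mod (Y j) by move=> j0; apply: trunc_top; lia.
have Y_fg j : fg_mod (cohomology Y j).
  have [j1|j1] := lerP j (- 1); first exact: fg_mod_iso (trunc_cohomology j1) (X_fg j).
  apply/fg_submP; exists [::]; split=> // N' _ w _.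
  have [y yw _] := reps_ex w; rewrite (_ : w = 0); first exact: submod0.
  by apply/(reps0 yw); rewrite [y]trunc_top //; exact: submod0.
have [st [st_top stP]] := stages_exist R_noeth Y_top Y_fg.
have P_tensor : acyclic (tensor_complex (free_res stP) (residue_field p)).
  (* Membership in the small support is existential over resolutions, so non-membership gives
     acyclicity for this particular one. *)
  apply: contrapT => nac; apply: p_supp; exists (free_res stP).
  split=> //; first exact: free_res_Kprojective.
  by exists (free_res_map stP); exact: free_res_qi.
have [s [ps sP]] := free_res_killed st_top P_tensor (n - 1).
rewrite subrK in sP; exists s => //.
have [|f [g fK gK]] := @trunc_cohomology (- 1) n; first by lia.
move=> w; apply: (can_inj fK); rewrite linear0 linearZZ.
have [G _ GK] := free_res_qi stP n.
have [v vc vcyc] := reps_ex (G (f w)).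
rewrite -[f w]GK -linearZZ (_ : s *: G (f w) = 0) ?linear0 //.
have vs : reps (s *: v) (s *: G (f w)).
  rewrite -[s *: v]addr0 -[s *: G _]addr0; apply: (reps_linear _ n).2 => //.
  exact: (reps_linear _ n).1.
by apply/(reps0 vs)/sP.
Qed.

End Support.

(** * The theorem *)

Section Transport.
Variable R : comNzRingType.

Lemma mod_iso_refl (M : lmodType R) : mod_iso M M.
Proof. by exists idfun; exists id. Qed.

Lemma hom_mod_iso (A A' E E' : lmodType R) :
  mod_iso A A' -> mod_iso E E' -> mod_iso (hom_mod A E) (hom_mod A' E').
Proof.
move=> /linear_inverse [f [f' [fK f'K]]] /linear_inverse [g [g' [gK g'K]]].
have h_lin : linear (fun k : hom_mod A E => hom_of (g \o (hom_fun k \o f') : {linear A' -> E'})).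
  by move=> r k k'; apply: hom_modP => x; rewrite !(hom_linE, hom_ofE) /= -linearP.
apply: (linear_bij (f := linear_of h_lin)) => [k k0|k].
  apply: hom_modP => x; apply: (can_inj gK).
  have := congr1 (fun k : hom_mod A' E' => hom_fun k (f x)) k0.
  by rewrite !hom_zeroE linear0 hom_ofE => <-; rewrite -[in LHS](fK x).
exists (hom_of (g' \o (hom_fun k \o f) : {linear A -> E})).
by apply: hom_modP => x; rewrite !hom_ofE /= g'K f'K.
Qed.

Lemma short_exact_iso (A A' B C C' : lmodType R) :
  mod_iso A' A -> mod_iso C C' -> short_exact A B C -> short_exact A' B C'.
Proof.
move=> [f f_bij] [g g_bij] [u [v [u_inj uv v_surj]]].
exists (u \o f : {linear _ -> _}), (g \o v : {linear _ -> _}); split.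
- exact: inj_comp u_inj (bij_inj f_bij).
- move=> y /=; split=> [gv0|[x <-]].
    have [|x <-] := (uv y).1.
      by apply: (bij_inj g_bij); rewrite linear0.
    by have [f' _ f'K] := f_bij; exists (f' x); rewrite f'K.
  by rewrite (uv (u (f x))).2 ?linear0 //; exists (f x).
- move=> z; have [g' _ g'K] := g_bij; have [y yE] := v_surj (g' z).
  by exists y; rewrite /= yE g'K.
Qed.

End Transport.

(** * Torsion and topology of the extension *)

Section Assembly.
Variables (R : comNzRingType) (m : ideal R) (x : R) (l : nat).
Variables (N F G V W B : lmodType R) (delta : {linear F -> G}).
Variables (iota : {linear V -> W}) (pi : {linear W -> hom_mod N F}).
Hypothesis mx : m x.
Hypothesis xl : ideal_pow m l `<=` ideal_add (ann_ideal N) x.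
Hypothesis F_torsion : forall y, torsion_subm m F y -> y = 0.
Hypothesis iota0 : forall v, iota v = 0 -> v = 0.
Hypothesis iota_pi : forall w, pi w = 0 <-> exists v, iota v = w.
Hypothesis pi_im : forall k, (exists w, pi w = k) <->
  forall z, delta (hom_fun k z) = 0.
Variable a : nat.
Hypothesis V_killed : forall r (v : V), ideal_pow m a r -> r *: v = 0.

(** V is torsion because m^a kills it, and nothing else is torsion because Hom(N, F) inherits
    torsion-freeness from F. *)
Lemma torsion_iota : mod_iso V (subm (torsion_subm m W)).
Proof.
have iotaT v : torsion_subm m W (iota v).
  by exists a => r ra; rewrite -linearZZ V_killed // linear0.
have f_lin : linear (fun v => mk_subm (iotaT v)).
  by move=> r v v'; apply: val_inj; rewrite subm_linE /= linearP.
apply: (linear_bij (f := linear_of f_lin)) => [v /(congr1 val) /= v0|w].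
  exact: iota0.
have [v vw] : exists v, iota v = val w.
  apply/iota_pi/hom_modP => z; apply: F_torsion.
  have [k kw] := submP w; exists k => r /kw rw.
  by rewrite -hom_scaleE -linearZZ rw linear0.
by exists v; apply: val_inj.
Qed.

Lemma hom_ann r (k : hom_mod N F) : ann_ideal N r -> r *: k = 0.
Proof.
by move=> rN; apply: hom_modP => z; rewrite hom_scaleE -linearZZ rN linear0.
Qed.

Lemma hom_regular n (k : hom_mod N F) : x ^+ n *: k = 0 -> k = 0.
Proof.
move=> k0; apply: hom_modP => z; apply: F_torsion.
apply: (@parameter_torsion _ m N x l xl F _ n 0) => r rN.
  by rewrite -linearZZ rN linear0.
by rewrite -(hom_scaleE _ k) k0 hom_zeroE scaler0.
Qed.

(** If x^a w lies in V, then x^a kills the image of w in Hom(N, F), where x is regular; so w itself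
    lies in V and x^a w = 0. *)
Lemma iota_sep w v : x ^+ a *: w = iota v -> v = 0.
Proof.
move=> wv; have /iota_pi [v' v'E] : pi w = 0.
  apply: (@hom_regular a); rewrite -linearZZ wv; apply/iota_pi.
  by exists v.
apply: iota0; rewrite -wv -v'E -linearZZ V_killed ?linear0 //.
exact: ideal_pow_exp.
Qed.

Lemma W_adic n : exists k, forall w,
  ideal_smul (ideal_pow m k) (full_subm W) w -> exists w', w = x ^+ n *: w'.
Proof.
have x_lin : linear_pred (fun w : W => exists w', w = x ^+ n *: w').
  split; first by exists 0; rewrite scaler0.
  move=> r _ _ [u ->] [v ->]; exists (r *: u + v).
  by rewrite scalerDr !scalerA mulrC.
(* An element of m^(l n) is c x^n modulo ann N, so on W it acts as c x^n up to an error in V; the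
   remaining factor in m^a kills this error. *)
exists (a + l * n)%N => w /(_ (mk_submodule x_lin)); apply.
move=> _ [t [y [+ _ ->]]].
have t_lin : ideal_pred (fun t => exists w', t *: y = x ^+ n *: w').
  split; first by exists 0; rewrite scale0r scaler0.
  move=> r u v [u' uE] [v' vE]; exists (r *: u' + v').
  by rewrite scalerDl -scalerA uE vE scalerDr !scalerA mulrC.
apply: (ideal_powD (a := mk_ideal t_lin)) => r s ra /(ideal_pow_parameter (n := n) xl).
move=> [s' s'N [c sE]].
have /iota_pi [v vE] : pi (s *: y - x ^+ n *: (c *: y)) = 0.
  rewrite linearB [pi (s *: y)]linearZZ [pi (x ^+ n *: _)]linearZZ.
  rewrite [pi (c *: y)]linearZZ sE scalerDl hom_ann // add0r scalerA.
  by rewrite [x ^+ n * c]mulrC subrr.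
exists (r *: (c *: y)) => /=; rewrite -scalerA -(subrK (x ^+ n *: (c *: y)) (s *: y)).
rewrite -vE scalerDr -linearZZ V_killed // linear0 add0r !scalerA.
by congr (_ *: _); ring.
Qed.

Variable P : {linear subm (hom_kernel N delta) -> hom_mod B G}.
Hypothesis P_dual : forall n,
  (forall q : hom_mod B G, exists k, forall b, x ^+ n *: b = 0 ->
     hom_fun (P k) b = hom_fun q b) /\
  (forall k, (forall b, x ^+ n *: b = 0 -> hom_fun (P k) b = 0) ->
     exists k', k = x ^+ n *: k').
Hypothesis B_torsion : forall b : B,
  exists k, forall r, ideal_pow m k r -> r *: b = 0.

Lemma completion_dual : short_exact V (completion m W) (hom_mod B G).
Proof.
have piK w : hom_kernel N delta (pi w) by apply/pi_im; exists w.
have pi_lin : linear (fun w => mk_subm (piK w)).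
  by move=> r w w'; apply: val_inj; rewrite subm_linE /= linearP.
pose pi' := linear_of pi_lin.
apply: (@completion_exact _ m x a V W B G iota (P \o pi' : {linear _ -> _})) => //.
- move=> v; rewrite /= (_ : mk_subm _ = 0) ?linear0 //; apply: val_inj.
  by apply/iota_pi; exists v.
- move=> n q; have [k kq] := (P_dual n).1 q.
  have [w wk] := (pi_im (val k)).2 (submP k); exists w => b /kq <-.
  by rewrite /= (_ : mk_subm _ = k) //; apply: val_inj.
- move=> n w w0; have [k' /(congr1 val) /= kE] := (P_dual n).2 (pi' w) w0.
  have [w' wk] := (pi_im (val k')).2 (submP k').
  have /iota_pi [v vE] : pi (w - x ^+ n *: w') = 0.
    by rewrite linearB linearZZ wk kE subrr.
  by exists w', v; rewrite vE addrC subrK.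
- exact: iota_sep.
- exact: W_adic.
Qed.

End Assembly.

Theorem theorem4p2 (R : comNzRingType) (m : ideal R) (d : nat)
    (D : complex R) (E : lmodType R) (X : complex R)
    (R_noeth : noetherian_ring R) (R_local : local_ring_with m)
    (R_dim : krull_dim R d)
    (D_dual : normalized_dualizing_complex d D)
    (E_hull : is_injective_hull (quot m) E)
    (X_fg : forall n : int, fg_mod (cohomology X n))
    (X_supp : small_support (trunc_le (- 1) X) `<=` dim_le1_locus R)
    (i : nat) (i_gt0 : (0 < i)%N)
    (A B C : lmodType R)
    (A_lc : is_local_cohomology m 0 (cohomology X (- i%:Z)) A)
    (B_lc : is_local_cohomology m 1 (cohomology X (- i%:Z - 1)) B)
    (C_lc : is_local_cohomology m 0 (cohomology (dagger D X) (d%:Z + i%:Z)) C) :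
  short_exact (hom_mod A E)
    (completion m (cohomology (dagger D X) (d%:Z + i%:Z)))
    (hom_mod B E)
  /\ mod_iso (hom_mod A E) C.
Proof.
have small n : n < 0 -> small_mod (cohomology X n).
  move=> n0 p pW.
  exact: (support_killed R_noeth X_fg n0 (fun p_supp => pW (X_supp p p_supp))).
have D_inj := dualizing_inj D_dual.
have DE := dualizing_top R_noeth R_local D_dual E_hull.
have tors x : m x -> forall y : D d%:Z, exists k, x ^+ k *: y = 0.
  move=> mx y; have [f f_bij] := DE.
  have [k fk] := hull_torsion R_noeth E_hull mx (f y).
  by exists k; apply: (bij_inj f_bij); rewrite linearZZ fk linear0.
have F_torsion := dualizing_pre_torsion R_noeth R_local D_dual.
pose a : int := - i%:Z; pose b : int := - i%:Z - 1.
(* Each degree has its own parameter. The lifting is used twice: for H^(-i)(X) in the extension and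
   for H^(-i-1)(X) in the duality. *)
have lift n : n < 0 -> forall f : {linear cohomology X n -> D d%:Z},
    (forall t, torsion_subm m (cohomology X n) t -> f t = 0) ->
    exists g : {linear cohomology X n -> D (d%:Z - 1)},
      forall z, f z = cdiff D (d%:Z - 1) d%:Z (g z).
  move=> n0.
  have [x [mx [l xl]]] := exists_parameter R_noeth
    (small_dim_le1 R_noeth R_local (small n n0)).
  exact: (lift_torsion_free R_noeth D_dual (X_fg n) xl (tors x mx)).
have a0 : a < 0 by rewrite /a; lia.
have b0 : b < 0 by rewrite /b; lia.
have [iota [pi [iota0 iota_pi pi_im]]] : exists
  (iota : {linear hom_mod (subm (torsion_subm m (cohomology X a))) (D d%:Z) ->
     cohomology (dagger D X) (d%:Z + i%:Z)})
  (pi : {linear cohomology (dagger D X) (d%:Z + i%:Z) ->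
     hom_mod (cohomology X b) (D (d%:Z - 1))}),
    [/\ forall k, iota k = 0 -> k = 0,
        forall w, pi w = 0 <-> exists k, iota k = w
      & forall k, (exists w, pi w = k) <->
          forall c, cdiff D (d%:Z - 1) d%:Z (hom_fun k c) = 0].
  apply: dagger_exact => //; rewrite /a /b; try lia.
  - exact: (dualizing_neg D_dual).
  - exact: (dualizing_big D_dual).
  - by move=> p q f p0 qe; apply: (hom_small0 D_dual f (small p p0) qe).
  - exact: lift.
have A_iso := local_cohomology0 A_lc.
have AE := hom_mod_iso A_iso (mod_iso_sym DE).
have [s sT] := torsion_bounded m R_noeth (X_fg a).
have V_killed r (v : hom_mod (subm (torsion_subm m (cohomology X a))) (D d%:Z)) :
    ideal_pow m s r -> r *: v = 0.
  move=> rs; apply: hom_modP => t; rewrite hom_scaleE -linearZZ.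
  rewrite (_ : r *: t = 0) ?linear0 //; apply: val_inj.
  by rewrite subm_scaleE sT //; exact: submP.
(* This parameter belongs to N = H^(-i-1)(X); its powers define the topology in which the limit is
   taken. *)
have [x [mx [l xl]]] := exists_parameter R_noeth
  (small_dim_le1 R_noeth R_local (small b b0)).
split; last first.
  apply: (mod_iso_trans AE).
  apply: mod_iso_trans (mod_iso_sym (local_cohomology0 C_lc)).
  exact: (torsion_iota F_torsion iota0 iota_pi V_killed).
have [J [aug [la [J_inj aug0 la_surj la0]]]] := local_cohomology1 B_lc.
have [P P_dual] := local_duality R_noeth (X_fg b) mx xl (D_inj _) (D_inj _)
  F_torsion (lift b b0) J_inj aug0 la_surj la0.
apply: (short_exact_iso AE (hom_mod_iso (mod_iso_refl B) DE)).
apply: (completion_dual mx xl F_torsion iota0 iota_pi pi_im V_killed P_dual).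
exact: (local_cohomology1_torsion la_surj la0).
Qed.
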